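(* Let $(R,\mathfrak m,k)$ be a local ring and $E$ the injective hull of $k$. If $M$ is an $R$-module with $\mathrm{Gfd}_R(M)$ finite, then $$\mathrm{depth}_R(M)=\mathrm{depth}\,R-\sup(E\otimes^{\mathbf L}_R M).$$
   Context: Local rings are commutative Noetherian. $M$ is not assumed finitely generated. For a complex $X$, $\sup(X)=\sup\{i\mid \mathrm{H}_i(X)\ne0\}$ (homological indexing). A homological dimension is ''finite'' if it is an integer (neither $\infty$ nor $-\infty$). Depth. If $K$ is the Koszul complex on a generating sequence of length $n$ for $\mathfrak m$, then $\mathrm{depth}_R(X)=n-\sup(K\otimes_R X)$ for any complex of $R$-modules $X$ (in particular any module); it is independent of the generating sequence and may be infinite. G-flat dimension. An $R$-module $G$ is G-flat if there is an exact complex $F=\cdots\to F_{1}\xrightarrow{\partial_1}F_0\xrightarrow{\partial_0}F_{-1}\to\cdots$ of flat $R$-modules with $\mathrm{Coker}(\partial_1)=G$ and $I\otimes_R F$ exact for every injective $R$-module $I$. A G-flat resolution of a homologically bounded complex $X$ of $R$-modules (e.g. a module in degree $0$) is a complex $G$ of G-flat modules with $G_i=0$ for $i\ll0$ and $G\simeq X$ in the derived category, and $\mathrm{Gfd}_R(X)=\inf\{\sup\{n\mid G_n\neq0\}\mid G\text{ a G-flat resolution of }X\}$. *)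

(* Defs.v *)
From HB Require Import structures.
From Stdlib Require Import Relation_Operators.
From mathcomp Require Import all_boot all_order all_algebra generic_quotient.
From mathcomp Require Import boolp classical_sets constructive_ereal.
From mathcomp Require Import zify ring.

Set Implicit Arguments.
Unset Strict Implicit.
Unset Printing Implicit Defensive.

Import Order.TTheory GRing.Theory Num.Theory.
Local Open Scope ring_scope.
Local Open Scope classical_set_scope.
Local Open Scope quotient_scope.

Section Rings.
Variable R : comNzRingType.

Definition submodule (V : lmodType R) (S : set V) : Prop :=
  [/\ S 0, forall u v, S u -> S v -> S (u + v) & forall a u, S u -> S (a *: u)].

Definition ideal (I : set R) : Prop := submodule (I : set R^o).

Definition generates (n : nat) (x : 'I_n -> R) (I : set R) : Prop :=
  I = [set r | exists a : 'I_n -> R, r = \sum_i a i * x i].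

Definition noetherian : Prop :=
  forall I : set R, ideal I -> exists n (x : 'I_n -> R), generates x I.

Definition maximal_ideal (m : set R) : Prop :=
  [/\ ideal m, ~ m 1 &
      forall J : set R, ideal J -> ~ J 1 -> m `<=` J -> J = m].

Definition local_ring (m : set R) : Prop :=
  maximal_ideal m /\ forall m' : set R, maximal_ideal m' -> m' = m.

End Rings.

(* The carrier of the tensor product consists of formal sums, i.e. finite
   sequences of pairs (u, v), modulo the congruence generated by the relations
   of the tensor product. *)
Section Tensor.
Variables (R : comNzRingType) (U V : lmodType R).

Inductive tens_rel : seq (U * V) -> seq (U * V) -> Prop :=
| TensRefl s : tens_rel s s
| TensSym s t : tens_rel s t -> tens_rel t s
| TensTrans s t r : tens_rel s t -> tens_rel t r -> tens_rel s r
| TensCat s s' t t' :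
    tens_rel s s' -> tens_rel t t' -> tens_rel (s ++ t) (s' ++ t')
| TensCatC s t : tens_rel (s ++ t) (t ++ s)
| TensDl u u' v : tens_rel [:: (u + u', v)] [:: (u, v); (u', v)]
| TensDr u v v' : tens_rel [:: (u, v + v')] [:: (u, v); (u, v')]
| TensZ a u v : tens_rel [:: (a *: u, v)] [:: (u, a *: v)]
| Tens0 v : tens_rel [:: (0, v)] [::].

Definition tens_relb (s t : seq (U * V)) : bool := `[< tens_rel s t >].

Lemma tens_relb_refl : reflexive tens_relb.
Proof. by move=> s; apply/asboolP; exact: TensRefl. Qed.

Lemma tens_relb_sym : symmetric tens_relb.
Proof. by move=> s t; apply/asboolP/asboolP; exact: TensSym. Qed.

Lemma tens_relb_trans : transitive tens_relb.
Proof.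
by move=> s t r /asboolP h1 /asboolP h2; apply/asboolP; exact: TensTrans h1 h2.
Qed.

Canonical tens_equiv :=
  EquivRel tens_relb tens_relb_refl tens_relb_sym tens_relb_trans.

Definition tensor := {eq_quot tens_equiv}.
HB.instance Definition _ := Choice.on tensor.

Definition tens_class (s : seq (U * V)) : tensor := \pi_{eq_quot tens_equiv} s.

Lemma tens_classP s t : tens_class s = tens_class t <-> tens_rel s t.
Proof.
split=> [/eqP|h]; first by rewrite eqmodE => /asboolP.
by apply/eqP; rewrite eqmodE; apply/asboolP.
Qed.

Lemma tens_class_repr (t : tensor) : tens_class (repr t) = t.
Proof. exact: reprK. Qed.

Definition tens_scale_seq (a : R) (s : seq (U * V)) :=
  [seq (a *: p.1, p.2) | p <- s].

Lemma tens_scale_rel a s t :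
  tens_rel s t -> tens_rel (tens_scale_seq a s) (tens_scale_seq a t).
Proof.
elim=> {s t} /=.
- move=> s; exact: TensRefl.
- move=> s t _; exact: TensSym.
- move=> s t r _ h1 _ h2; exact: TensTrans h1 h2.
- move=> s s' t t' _ h1 _ h2; rewrite /tens_scale_seq !map_cat; exact: TensCat.
- move=> s t; rewrite /tens_scale_seq !map_cat; exact: TensCatC.
- move=> u u' v; rewrite /= scalerDr; exact: TensDl.
- move=> u v v'; exact: TensDr.
- move=> b u v; rewrite scalerA mulrC -scalerA; exact: TensZ.
- move=> v; rewrite scaler0; exact: Tens0.
Qed.

Definition tens_zero : tensor := tens_class [::].
Definition tens_add (s t : tensor) : tensor := tens_class (repr s ++ repr t).
Definition tens_scale (a : R) (s : tensor) : tensor :=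
  tens_class (tens_scale_seq a (repr s)).
Definition tens_opp (s : tensor) : tensor := tens_scale (-1) s.

Lemma tens_repr s : tens_rel (repr (tens_class s)) s.
Proof. by apply/tens_classP; rewrite tens_class_repr. Qed.

Lemma tens_addE s t : tens_add (tens_class s) (tens_class t) = tens_class (s ++ t).
Proof. by apply/tens_classP; apply: TensCat; exact: tens_repr. Qed.

Lemma tens_scaleE a s :
  tens_scale a (tens_class s) = tens_class (tens_scale_seq a s).
Proof. by apply/tens_classP; apply: tens_scale_rel; exact: tens_repr. Qed.

Lemma tens_ind (P : tensor -> Prop) :
  (forall s, P (tens_class s)) -> forall t, P t.
Proof. by move=> h t; rewrite -(tens_class_repr t). Qed.

Lemma tens_addA : associative tens_add.
Proof.
elim/tens_ind=> s; elim/tens_ind=> t; elim/tens_ind=> r.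
by rewrite !tens_addE catA.
Qed.

Lemma tens_addC : commutative tens_add.
Proof.
elim/tens_ind=> s; elim/tens_ind=> t; rewrite !tens_addE.
by apply/tens_classP; exact: TensCatC.
Qed.

Lemma tens_add0 : left_id tens_zero tens_add.
Proof. by elim/tens_ind=> s; rewrite [tens_add _ _]tens_addE. Qed.

Lemma tens_scaleDr a : {morph tens_scale a : s t / tens_add s t}.
Proof.
elim/tens_ind=> s; elim/tens_ind=> t.
rewrite (tens_addE s t) !(tens_scaleE a) tens_addE.
by rewrite /tens_scale_seq map_cat.
Qed.

Lemma tens_scaleDl v :
  {morph tens_scale^~ v : a b / a + b >-> tens_add a b}.
Proof.
elim/tens_ind: v => s a b; rewrite !tens_scaleE tens_addE; apply/tens_classP.
elim: s => [|[u v] s ih] /=; first exact: TensRefl.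
rewrite scalerDl; set p := a *: u; set q := b *: u.
set sa := tens_scale_seq a s in ih *; set sb := tens_scale_seq b s in ih *.
set sab := tens_scale_seq (a + b) s in ih *.
apply: (@TensTrans _ ([:: (p, v); (q, v)] ++ (sa ++ sb))).
  exact: (@TensCat [:: (p + q, v)] _ sab _ (TensDl p q v) ih).
apply: (@TensCat [:: (p, v)] _ ((q, v) :: sa ++ sb) _ (TensRefl _)).
have -> : sa ++ (q, v) :: sb = (sa ++ [:: (q, v)]) ++ sb by rewrite -catA.
exact: (@TensCat ((q, v) :: sa) _ sb _ (@TensCatC [:: (q, v)] sa) (TensRefl sb)).
Qed.

Lemma tens_scaleA a b v : tens_scale a (tens_scale b v) = tens_scale (a * b) v.
Proof.
elim/tens_ind: v => s; rewrite (tens_scaleE b) !tens_scaleE.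
rewrite /tens_scale_seq -map_comp.
by congr tens_class; apply: eq_map => p /=; rewrite scalerA.
Qed.

Lemma tens_scale1 : left_id 1 tens_scale.
Proof.
elim/tens_ind=> s; rewrite tens_scaleE /tens_scale_seq; congr tens_class.
by rewrite -[RHS]map_id; apply: eq_map => -[u v] /=; rewrite scale1r.
Qed.

Lemma tens_scale0 v : tens_scale 0 v = tens_zero.
Proof.
elim/tens_ind: v => s; rewrite tens_scaleE; apply/tens_classP.
elim: s => [|[u v] s ih] /=; first exact: TensRefl.
rewrite scale0r.
exact: (@TensCat [:: (0, v)] [::] (tens_scale_seq 0 s) [::] (Tens0 v) ih).
Qed.

Lemma tens_addN : left_inverse tens_zero tens_opp tens_add.
Proof.
move=> v; rewrite /tens_opp -{2}[v]tens_scale1 -tens_scaleDl addNr.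
exact: tens_scale0.
Qed.

HB.instance Definition _ :=
  GRing.isZmodule.Build tensor tens_addA tens_addC tens_add0 tens_addN.
HB.instance Definition _ :=
  GRing.Zmodule_isLmodule.Build R tensor
    tens_scaleA tens_scale1 tens_scaleDr tens_scaleDl.

Definition tens (u : U) (v : V) : tensor := tens_class [:: (u, v)].

Lemma tens_class_sum s : tens_class s = \sum_(p <- s) tens p.1 p.2.
Proof.
elim: s => [|[u v] s ih]; first by rewrite big_nil.
by rewrite big_cons -ih -cat1s -tens_addE.
Qed.

Lemma tensDl u u' v : tens (u + u') v = tens u v + tens u' v.
Proof. by rewrite [RHS]tens_addE; apply/tens_classP; exact: TensDl. Qed.

Lemma tensDr u v v' : tens u (v + v') = tens u v + tens u v'.
Proof. by rewrite [RHS]tens_addE; apply/tens_classP; exact: TensDr. Qed.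

Lemma tensZl a u v : tens (a *: u) v = a *: tens u v.
Proof. by rewrite [RHS]tens_scaleE. Qed.

Lemma tensZr a u v : tens u (a *: v) = a *: tens u v.
Proof. by rewrite -tensZl; apply/esym/tens_classP; exact: TensZ. Qed.

Lemma tensor_span (t : tensor) :
  exists s : seq (U * V), t = \sum_(p <- s) tens p.1 p.2.
Proof. by exists (repr t); rewrite -tens_class_sum tens_class_repr. Qed.

End Tensor.

Section TensorUniversal.
Variables (R : comNzRingType) (U V W : lmodType R) (b : U -> V -> W).
Hypothesis b_linl : forall v, linear (b^~ v).
Hypothesis b_linr : forall u, linear (b u).

Definition tens_lift (t : tensor U V) : W := \sum_(p <- repr t) b p.1 p.2.

Let bDl u u' v : b (u + u') v = b u v + b u' v.
Proof. by have := b_linl v 1 u u'; rewrite !scale1r. Qed.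
Let bDr u v v' : b u (v + v') = b u v + b u v'.
Proof. by have := b_linr u 1 v v'; rewrite !scale1r. Qed.
Let b0l v : b 0 v = 0.
Proof. by apply: (addrI (b 0 v)); rewrite -bDl !addr0. Qed.
Let b0r u : b u 0 = 0.
Proof. by apply: (addrI (b u 0)); rewrite -bDr !addr0. Qed.
Let bZl a u v : b (a *: u) v = a *: b u v.
Proof. by have := b_linl v a u 0; rewrite !addr0 b0l addr0. Qed.
Let bZr a u v : b u (a *: v) = a *: b u v.
Proof. by have := b_linr u a v 0; rewrite !addr0 b0r addr0. Qed.

Let tens_lift_rel s t : tens_rel s t ->
  \sum_(p <- s) b p.1 p.2 = \sum_(p <- t) b p.1 p.2.
Proof.
elim=> {s t} //=.
- by move=> s t r _ -> _ ->.
- by move=> s s' t t' _ h1 _ h2; rewrite !big_cat /= h1 h2.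
- by move=> s t; rewrite !big_cat /= addrC.
- by move=> u u' v; rewrite !big_cons !big_nil /= bDl !addr0.
- by move=> u v v'; rewrite !big_cons !big_nil /= bDr !addr0.
- by move=> a u v; rewrite !big_cons !big_nil /= bZl bZr.
- by move=> v; rewrite !big_cons !big_nil /= b0l addr0.
Qed.

Lemma tens_lift_class s :
  tens_lift (tens_class s) = \sum_(p <- s) b p.1 p.2.
Proof. exact: tens_lift_rel (tens_repr s). Qed.

Lemma tens_lift_tens u v : tens_lift (tens u v) = b u v.
Proof. by rewrite tens_lift_class big_cons big_nil addr0. Qed.

Lemma tens_lift_linear : linear tens_lift.
Proof.
move=> a; elim/tens_ind=> s; elim/tens_ind=> t.
rewrite [a *: _]tens_scaleE [_ + tens_class t]tens_addE !tens_lift_class.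
rewrite big_cat big_map /= scaler_sumr; congr (_ + _).
by apply: eq_bigr => p _; rewrite bZl.
Qed.

HB.instance Definition _ :=
  GRing.isLinear.Build R (tensor U V) W *:%R tens_lift tens_lift_linear.

Lemma tens_lift_unique (f : {linear tensor U V -> W}) :
  (forall u v, f (tens u v) = b u v) -> f =1 tens_lift.
Proof.
move=> fE; elim/tens_ind=> s; rewrite tens_lift_class tens_class_sum raddf_sum.
by apply: eq_bigr => p _; exact: fE.
Qed.

End TensorUniversal.

Section TensorMap.
Variables (R : comNzRingType) (U U' V V' : lmodType R).
Variables (f : {linear U -> U'}) (g : {linear V -> V'}).

Definition tens_map : tensor U V -> tensor U' V' :=
  tens_lift (fun u v => tens (f u) (g v)).

Lemma tens_map_linl v : linear (fun u => tens (f u) (g v)).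
Proof. by move=> a u u'; rewrite linearP tensDl tensZl. Qed.

Lemma tens_map_linr u : linear (fun v => tens (f u) (g v)).
Proof. by move=> a v v'; rewrite linearP tensDr tensZr. Qed.

Lemma tens_map_linear : linear tens_map.
Proof. exact: tens_lift_linear tens_map_linl tens_map_linr. Qed.

HB.instance Definition _ :=
  GRing.isLinear.Build R (tensor U V) (tensor U' V') *:%R tens_map
    tens_map_linear.

Lemma tens_mapE u v : tens_map (tens u v) = tens (f u) (g v).
Proof. exact: (tens_lift_tens tens_map_linl tens_map_linr). Qed.

Lemma tens_map_eq0 : (forall u v, tens (f u) (g v) = 0) -> forall t, tens_map t = 0.
Proof.
move=> h t; have [s ->] := tensor_span t.
by rewrite raddf_sum big1 // => p _; rewrite /= tens_mapE.
Qed.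

End TensorMap.

Section Modules.
Variable R : comNzRingType.

Definition flat (A : lmodType R) : Prop :=
  forall (U V : lmodType R) (f : {linear U -> V}),
    injective f -> injective (tens_map (@idfun A) f).

Definition injective_module (I : lmodType R) : Prop :=
  forall (U V : lmodType R) (f : {linear U -> V}) (g : {linear U -> I}),
    injective f -> exists h : {linear V -> I}, forall u, h (f u) = g u.

Definition projective (P : lmodType R) : Prop :=
  forall (U V : lmodType R) (f : {linear U -> V}) (g : {linear P -> V}),
    (forall v, exists u, f u = v) ->
    exists h : {linear P -> U}, forall p, f (h p) = g p.

(* p exhibits C as the cokernel of f. *)
Definition is_coker (U V C : lmodType R) (f : {linear U -> V})
    (p : {linear V -> C}) : Prop :=
  (forall c, exists v, p v = c) /\
  (forall v, p v = 0 <-> exists u, f u = v).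

(* k is isomorphic to the R-module R / m. *)
Definition residue_module (m : set R) (k : lmodType R) : Prop :=
  exists pi : {linear R^o -> k},
    (forall c, exists a, pi a = c) /\ (forall a, pi a = 0 <-> m a).

Definition injective_hull (k E : lmodType R) : Prop :=
  injective_module E /\
  exists iota : {linear k -> E}, injective iota /\
    forall S : set E, submodule S -> S `&` range iota = [set 0] -> S = [set 0].

End Modules.

(* The family of maps [cdiff i j] has only its members with i = j + 1 as
   genuine differentials; the others vanish. This avoids transporting along
   equalities of indices. *)
Record complex (R : comNzRingType) := Complex {
  cobj :> int -> lmodType R;
  cdiff : forall i j : int, {linear cobj i -> cobj j};
  cdiff_shape : forall i j : int, i != j + 1 -> forall x, cdiff i j x = 0;
  cdiff_comp : forall (i j k : int) (x : cobj i), cdiff j k (cdiff i j x) = 0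
}.

Section Complexes.
Variable R : comNzRingType.
Implicit Types X Y : complex R.

Definition cycle X (i : int) (x : X i) : Prop := cdiff X i (i - 1) x = 0.

Definition boundary X (i : int) (x : X i) : Prop :=
  exists y : X (i + 1), cdiff X (i + 1) i y = x.

Definition homology_trivial X (i : int) : Prop :=
  forall x : X i, cycle x -> boundary x.

Definition exact X : Prop := forall i, homology_trivial X i.

(* -oo when X is exact, +oo when the set is unbounded above. *)
Definition hsup X : \bar int :=
  supremum -oo%E [set i%:E | i in [set i : int | ~ homology_trivial X i]].

Definition trivial_module (V : lmodType R) : Prop := forall v : V, v = 0.

Record chain_map X Y := ChainMap {
  cmap :> forall i : int, {linear X i -> Y i};
  cmap_comm : forall (i j : int) (x : X i),
    cmap j (cdiff X i j x) = cdiff Y i j (cmap i x)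
}.

(* The two clauses say that f induces injections, respectively surjections,
   in homology. *)
Definition quasi_iso X Y (f : chain_map X Y) : Prop :=
  forall i : int,
    (forall x : X i, cycle x -> boundary (f i x) -> boundary x) /\
    (forall y : Y i, cycle y -> exists x : X i, cycle x /\ boundary (f i x - y)).

(* Isomorphism in the derived category: a zigzag of quasi-isomorphisms. *)
Definition derived_iso : complex R -> complex R -> Prop :=
  clos_refl_sym_trans (complex R)
    (fun X Y => exists f : chain_map X Y, quasi_iso f).

Definition stalk_obj (V : lmodType R) (i : int) : lmodType R :=
  if i == 0 then V else 'rV[R]_0.

Program Definition stalk (V : lmodType R) : complex R :=
  {| cobj := stalk_obj V; cdiff := fun i j => \0 |}.

Program Definition tensor_cpx (V : lmodType R) X : complex R :=
  {| cobj := fun i => tensor V (X i);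
     cdiff := fun i j => tens_map (@idfun V) (cdiff X i j) |}.
Next Obligation.
apply: tens_map_eq0 => u v; rewrite cdiff_shape //.
by rewrite -(scale0r (0 : X j)) tensZr scale0r.
Qed.
Next Obligation.
have [s ->] := tensor_span x; rewrite !raddf_sum big1 // => p _ /=.
rewrite !tens_mapE cdiff_comp.
by rewrite -(scale0r (0 : X k)) tensZr scale0r.
Qed.

Program Definition cpx_tensor X (V : lmodType R) : complex R :=
  {| cobj := fun i => tensor (X i) V;
     cdiff := fun i j => tens_map (cdiff X i j) (@idfun V) |}.
Next Obligation.
apply: tens_map_eq0 => u v; rewrite cdiff_shape //.
by rewrite -(scale0r (0 : X j)) tensZl scale0r.
Qed.
Next Obligation.
have [s ->] := tensor_span x; rewrite !raddf_sum big1 // => p _ /=.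
rewrite !tens_mapE cdiff_comp.
by rewrite -(scale0r (0 : X k)) tensZl scale0r.
Qed.

End Complexes.

(* The Koszul complex on x_0, ..., x_(n-1): an element of degree p is a family
   of coefficients f(S), S a p-subset of the indices, standing for
   \sum_S f(S) e_S, and
     d e_S = \sum_(i in S) (-1)^#{j in S | j < i} x_i e_(S \ i). *)
Section Koszul.
Variables (R : comNzRingType) (n : nat) (x : 'I_n -> R).

Definition koszul_index (p : int) := {S : {set 'I_n} | #|S|%:Z == p}.

Definition koszul_obj (p : int) : lmodType R := {ffun koszul_index p -> R^o}.

Definition koszul_coef (p : int) (f : koszul_obj p) (S : {set 'I_n}) : R :=
  if insub S is Some s then f s else 0.

Definition koszul_sign (i : 'I_n) (T : {set 'I_n}) : R :=
  (-1) ^+ #|[set j in T | (j < i)%N]|.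

Definition koszul_sum (g : {set 'I_n} -> R) (T : {set 'I_n}) : R :=
  \sum_(i | i \notin T) koszul_sign i T * x i * g (i |: T).

Definition koszul_diff (p q : int) (f : koszul_obj p) : koszul_obj q :=
  [ffun T : koszul_index q => koszul_sum (koszul_coef f) (val T)].

Lemma koszul_coef_linear p (S : {set 'I_n}) a (f g : koszul_obj p) :
  koszul_coef (a *: f + g) S = a * koszul_coef f S + koszul_coef g S.
Proof.
rewrite /koszul_coef; case: insubP => [s _ _|_]; last by rewrite mulr0 addr0.
by rewrite !ffunE.
Qed.

Lemma koszul_diff_linear p q : linear (@koszul_diff p q).
Proof.
move=> a f g; apply/ffunP => T; rewrite !ffunE /koszul_sum scaler_sumr -big_split.
apply: eq_bigr => i _ /=; rewrite koszul_coef_linear mulrDr; congr (_ + _).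
by rewrite mulrCA.
Qed.

HB.instance Definition _ p q :=
  GRing.isLinear.Build R (koszul_obj p) (koszul_obj q) *:%R (@koszul_diff p q)
    (@koszul_diff_linear p q).

Lemma koszul_coef_out p (f : koszul_obj p) (S : {set 'I_n}) :
  #|S|%:Z != p -> koszul_coef f S = 0.
Proof. by move=> h; rewrite /koszul_coef insubN. Qed.

Lemma koszul_coef_in p q (f : koszul_obj p) (S : {set 'I_n}) :
  #|S|%:Z = q -> koszul_coef (koszul_diff q f) S = koszul_sum (koszul_coef f) S.
Proof.
move=> h; rewrite /koszul_coef; case: insubP => [s _ sE|]; last by rewrite h eqxx.
by rewrite ffunE sE.
Qed.

Lemma koszul_shape (p q : int) :
  p != q + 1 -> forall f : koszul_obj p, koszul_diff q f = 0.
Proof.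
move=> pq f; apply/ffunP => -[T Tq]; rewrite !ffunE /= /koszul_sum.
move/eqP: Tq => Tq; rewrite big1 // => i iT; rewrite koszul_coef_out ?mulr0 //.
rewrite cardsU1 iT; move: pq; rewrite -Tq; lia.
Qed.

Lemma koszul_signC (T : {set 'I_n}) (i j : 'I_n) : i \notin T -> j \notin T ->
  (i < j)%N ->
  koszul_sign i T * koszul_sign j (i |: T) =
  - (koszul_sign j T * koszul_sign i (j |: T)).
Proof.
move=> iT jT ij; rewrite /koszul_sign.
have -> : [set k in i |: T | (k < j)%N] = i |: [set k in T | (k < j)%N].
  apply/setP => k; rewrite !inE; case: eqP => [->|] //=; by rewrite ij.
have -> : [set k in j |: T | (k < i)%N] = [set k in T | (k < i)%N].
  apply/setP => k; rewrite !inE; case: eqP => [->|] //=.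
  by rewrite ltnNge (ltnW ij) /= andbF.
rewrite cardsU1 inE (negbTE iT) /= exprS; ring.
Qed.

Lemma koszul_sum_sum g (T : {set 'I_n}) : koszul_sum (koszul_sum g) T = 0.
Proof.
pose a (i j : 'I_n) := koszul_sign i T * koszul_sign j (i |: T) *
  (x i * x j) * g (j |: (i |: T)).
have -> : koszul_sum (koszul_sum g) T =
    \sum_(i | i \notin T) \sum_(j | j \notin T)
       (if (i < j)%N then a i j else if (j < i)%N then a i j else 0).
  apply: eq_bigr => i iT; rewrite mulr_sumr.
  rewrite [RHS](bigID (pred1 i)) /= [X in _ = X + _]big1 ?add0r; last first.
    by move=> j /andP[_ /eqP->]; rewrite ltnn.
  apply: eq_big => [j|j]; first by rewrite !inE negb_or andbC.
  rewrite !inE negb_or => /andP[ji jT].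
  have -> : (if (i < j)%N then a i j else if (j < i)%N then a i j else 0) = a i j.
    by case: ltngtP => // /val_inj E; rewrite E eqxx in ji.
  rewrite /a; ring.
pose b (i j : 'I_n) := if (i < j)%N then a i j else 0.
transitivity (\sum_(i | i \notin T) \sum_(j | j \notin T) (b i j - b j i)).
  apply: eq_bigr => i iT; apply: eq_bigr => j jT; rewrite /b.
  case: ltngtP => [ij|ji|_]; rewrite ?subr0 //.
  rewrite sub0r /a (finset.setUCA [set j] [set i] T).
  rewrite (koszul_signC jT iT ji); ring.
under eq_bigr do rewrite sumrB.
by rewrite sumrB [X in _ - X]exchange_big subrr.
Qed.

Lemma koszul_comp (p q r : int) (f : koszul_obj p) :
  koszul_diff r (koszul_diff q f) = 0.
Proof.
have [qr|/koszul_shape-> //] := eqVneq q (r + 1).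
apply/ffunP => -[T Tr]; rewrite !ffunE /=; move/eqP: Tr => Tr.
rewrite -[RHS](koszul_sum_sum (koszul_coef f) T) /koszul_sum.
apply: eq_bigr => i iT; congr (_ * _); rewrite koszul_coef_in //.
by rewrite cardsU1 iT qr -Tr; lia.
Qed.

Definition koszul : complex R :=
  @Complex R koszul_obj (fun p q => @koszul_diff p q) koszul_shape koszul_comp.

(* For x a generating sequence of the maximal ideal of a Noetherian local ring
   this is the depth of V, and it does not depend on x. *)
Definition depth (V : lmodType R) : \bar int :=
  ((n%:Z)%:E - hsup (cpx_tensor koszul V))%E.

End Koszul.

Section Resolutions.
Variable R : comNzRingType.

Definition Gflat (G : lmodType R) : Prop :=
  exists F : complex R,
    [/\ forall i, flat (F i),
        exact F,
        exists p : {linear F 0 -> G}, is_coker (cdiff F 1 0) p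
      & forall I : lmodType R, injective_module I -> exact (tensor_cpx I F)].

Definition Gflat_resolution (X G : complex R) : Prop :=
  [/\ forall i, Gflat (G i),
      exists N : int, forall i, i < N -> trivial_module (G i)
    & derived_iso G X].

Definition Gfd (X : complex R) : \bar int :=
  infimum +oo%E [set s | exists2 G, Gflat_resolution X G &
    s = supremum -oo%E [set i%:E | i in [set i | ~ trivial_module (G i)]]].

(* For such P, the complex [tensor_cpx E P] represents the derived tensor
   product of E and V. *)
Definition projective_resolution (V : lmodType R) (P : complex R) : Prop :=
  [/\ forall i, projective (P i),
      forall i : int, i < 0 -> trivial_module (P i)
    & exists f : chain_map P (stalk V), quasi_iso f].

End Resolutions.

(* Main.v *)
(* Let s be the largest degree in which the Koszul complex K has homology, so that
   depth R = n - s. As H(K) has finite length, K is quasi-isomorphic to a complex D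
   of finite powers of E that vanishes above degree s and whose differentials are
   matrices over R: D = Hom(P', E), where P' resolves Hom(K, E) by free modules of
   finite rank. The mapping cone of K -> D is exact. It stays exact after tensoring
   with a flat module and then, by dimension shifting along a complete flat
   resolution, with a G-flat module; so it does for every M that has a finite
   resolution by such modules and satisfies Tor_i(E, M) = 0 for i > 0. For these M
   the homology of K (x) M is that of D (x) M, whose terms are powers of E (x) M.
   It vanishes above degree s, and a socle element of E (x) M gives a nonzero class
   in degree s, because the first differential of D kills the image of the socle of
   E. The general case follows by passing to the u-th syzygy of M, where u is the
   top degree of Tor(E, M). *)

Require Import Defs.
From HB Require Import structures.
From mathcomp Require Import all_boot all_order all_algebra.
From mathcomp Require Import boolp classical_sets constructive_ereal.
From mathcomp Require Import zify ring.
From mathcomp Require finmap.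
From mathcomp Require Import -(notations) monalg.
Import Defs.

Set Implicit Arguments.
Unset Strict Implicit.
Unset Printing Implicit Defensive.

Import Order.TTheory GRing.Theory Num.Theory.
Local Open Scope ring_scope.
Local Open Scope classical_set_scope.

(** Hom(K, E) need not be finitely generated, so finite free modules can describe it only up to
    coboundaries: m kills H(K), hence a cocycle maps cycles into the socle R e0 of E, and over a
    Noetherian ring the cocycles are finitely generated modulo those of the form chi o d. The
    matrices over R arise from such generators. R is not assumed complete, so Matlis duality enters
    only through the socle: a linear map from a power of E to E acts on socle vectors by scalars
    modulo m, and these scalars name the Koszul cycle needed for exactness of the cone. The complete
    flat resolution of a G-flat module is unbounded on both sides. The shift to its right stops
    because the cone is zero at its start; its left half gives acyclicity for E. M may be infinitely
    generated, so nonvanishing is tested on elements: E is m-torsion, hence a nonzero element of E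
    (x) N has a nonzero multiple killed by m. For u > 0 this is applied to the kernel of E (x) N_u
    -> E (x) P_(u-1), and a connecting map carries the class from degree s to s + 1; plain shifting
    fails there, as H_s(K (x) P) need not vanish. *)

(** * Submodules and exact sequences *)

(* The carrier mentions the closure proof so that its module structure can be
   inferred from the type alone. *)
Definition submod (R : comNzRingType) (V : lmodType R) (S : set V)
  (hS : submodule S) : Type := {v : V | `[< S v >]}.

Section SubmoduleStructure.
Variables (R : comNzRingType) (V : lmodType R) (S : set V) (hS : submodule S).
Local Notation T := (submod hS).
HB.instance Definition _ := [isSub of T for (@sval V _)].
HB.instance Definition _ := [Choice of T by <:].

Let inS (v : T) : S (val v). Proof. exact/asboolP/(valP v). Qed.
Definition in_subm (v : V) (h : S v) : T := exist _ v (asboolT h).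
Let S0 : S 0. Proof. by case: hS. Qed.
Let SD v w : S v -> S w -> S (v + w). Proof. by case: hS => _ h _; exact: h. Qed.
Let SZ a v : S v -> S (a *: v). Proof. by case: hS => _ _ h; exact: h. Qed.
Let SN v : S v -> S (- v). Proof. by rewrite -scaleN1r; exact: SZ. Qed.

Definition subm_zero := in_subm S0.
Definition subm_add u v := in_subm (SD (inS u) (inS v)).
Definition subm_opp u := in_subm (SN (inS u)).
Definition subm_scale a u := in_subm (SZ a (inS u)).

Fact subm_addA : associative subm_add.
Proof. by move=> u v w; apply: val_inj; rewrite /= addrA. Qed.
Fact subm_addC : commutative subm_add.
Proof. by move=> u v; apply: val_inj; rewrite /= addrC. Qed.
Fact subm_add0 : left_id subm_zero subm_add.
Proof. by move=> u; apply: val_inj; rewrite /= add0r. Qed.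
Fact subm_addN : left_inverse subm_zero subm_opp subm_add.
Proof. by move=> u; apply: val_inj; rewrite /= addNr. Qed.
HB.instance Definition _ :=
  GRing.isZmodule.Build T subm_addA subm_addC subm_add0 subm_addN.

Fact subm_scaleA a b (v : T) :
  subm_scale a (subm_scale b v) = subm_scale (a * b) v.
Proof. by apply: val_inj; rewrite /= scalerA. Qed.
Fact subm_scale1 : left_id 1 subm_scale.
Proof. by move=> v; apply: val_inj; rewrite /= scale1r. Qed.
Fact subm_scaleDr : right_distributive subm_scale (@GRing.add T).
Proof. by move=> a u v; apply: val_inj; rewrite /= scalerDr. Qed.
Fact subm_scaleDl (v : T) : {morph subm_scale^~ v : a b / a + b}.
Proof. by move=> a b; apply: val_inj; rewrite /= scalerDl. Qed.
HB.instance Definition _ := GRing.Zmodule_isLmodule.Build R T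
  subm_scaleA subm_scale1 subm_scaleDr subm_scaleDl.

Definition submod_val (v : T) : V := sval v.
Fact submod_val_linear : linear submod_val. Proof. by []. Qed.
HB.instance Definition _ := GRing.isLinear.Build R T V *:%R submod_val
  submod_val_linear.

Lemma submod_val_inj : injective submod_val.
Proof. by move=> u v h; apply: val_inj. Qed.

Lemma submod_valP (v : T) : S (submod_val v).
Proof. exact/asboolP/(valP v). Qed.

Lemma submod_lift (v : V) : S v -> exists u : T, submod_val u = v.
Proof. by move=> h; exists (in_subm h). Qed.

Section Corestriction.
Variables (U : lmodType R) (f : {linear U -> V}) (hf : forall u, S (f u)).
Definition corestr (u : U) : T := in_subm (hf u).
Fact corestr_linear : linear corestr.
Proof. by move=> a u v; apply: val_inj; rewrite /= linearP. Qed.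
HB.instance Definition _ := GRing.isLinear.Build R U T *:%R corestr corestr_linear.
Lemma corestrE u : submod_val (corestr u) = f u. Proof. by []. Qed.
End Corestriction.

End SubmoduleStructure.

Section Sub.
Variables (R : comNzRingType).
Implicit Types U V W : lmodType R.

Definition kernel U V (f : {linear U -> V}) : set U := [set u | f u = 0].
Lemma kernelP U V (f : {linear U -> V}) : submodule (kernel f).
Proof.
split; rewrite /kernel /=; first exact: linear0.
- by move=> u v; rewrite linearD => -> ->; rewrite addr0.
- by move=> a u; rewrite linearZ /= => ->; rewrite scaler0.
Qed.
Definition image U V (f : {linear U -> V}) : set V := [set v | exists u, f u = v].
Lemma imageP U V (f : {linear U -> V}) : submodule (image f).
Proof.
split; first by exists 0; rewrite linear0.
- by move=> _ _ [u <-] [v <-]; exists (u + v); rewrite linearD.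
- by move=> a _ [u <-]; exists (a *: u); rewrite linearZ.
Qed.

Definition ker U V (f : {linear U -> V}) : lmodType R := submod (kernelP f).
Definition im U V (f : {linear U -> V}) : lmodType R := submod (imageP f).

Definition ses (A B C : lmodType R) (i : {linear A -> B}) (p : {linear B -> C}) :=
  injective i /\ is_coker i p.

Lemma linear_inj U V (f : {linear U -> V}) :
  (forall u, f u = 0 -> u = 0) -> injective f.
Proof.
by move=> h u v e; apply/eqP; rewrite -subr_eq0; apply/eqP/h; rewrite linearB e subrr.
Qed.

Lemma linear_inj0 U V (f : {linear U -> V}) u : injective f -> f u = 0 -> u = 0.
Proof. by move=> h e; apply: h; rewrite e linear0. Qed.

Definition mklin U V (f : U -> V) (h : linear f) : {linear U -> V} :=
  HB.pack_for {linear U -> V} f (GRing.isLinear.Build R U V *:%R f h).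

(** Two values at the same u differ by a value at 0, so the relation is a function. Maps obtained by
    lifting, or defined on homology classes, are given by such graphs, which avoids quotient
    modules. *)
Lemma graph_linear U V (G : U -> V -> Prop) :
  (forall a u v u' v', G u v -> G u' v' -> G (a *: u + u') (a *: v + v')) ->
  (forall u, exists v, G u v) -> (forall v, G 0 v -> v = 0) ->
  exists f : {linear U -> V}, forall u v, G u v <-> f u = v.
Proof.
move=> Glin /choice[f fP] G0.
have G1 u v v' : G u v -> G u v' -> v = v'.
  move=> h h'; apply/eqP; rewrite -subr_eq0; apply/eqP/G0.
  by have := Glin (-1) u v' u v h' h; rewrite scaleN1r addNr scaleN1r addrC.
have flin : linear f.
  by move=> a u v; apply: G1 (fP _) _; exact: Glin.
exists (mklin flin) => u v; split => /= [h|<-//]; exact: G1 (fP u) h.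
Qed.

Lemma ses_ker (B C : lmodType R) (p : {linear B -> C}) : (forall c, exists b, p b = c) ->
  ses (@submod_val R B _ (kernelP p)) p.
Proof.
move=> hp; split; first exact: submod_val_inj.
split=> // b; split=> [|[u <-]]; last exact: (@submod_valP R B _ (kernelP p) u).
exact: (@submod_lift R B _ (kernelP p) b).
Qed.

End Sub.

(** * Tensor products *)

Section TensorTheory.
Variable R : comNzRingType.
Implicit Types U V W A B C S Q : lmodType R.

Lemma tensor_elim U V (P : tensor U V -> Prop) :
  P 0 -> (forall u v, P (tens u v)) -> (forall s t, P s -> P t -> P (s + t)) ->
  forall t, P t.
Proof.
move=> P0 Pt PD t; have [s ->] := tensor_span t.
elim: s => [|p s ih]; first by rewrite big_nil.
by rewrite big_cons; apply: PD.
Qed.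

Lemma tensor_ext U V W (f g : {linear tensor U V -> W}) :
  (forall u v, f (tens u v) = g (tens u v)) -> f =1 g.
Proof.
move=> h; apply: tensor_elim => [|//|s t hs ht]; first by rewrite !linear0.
by rewrite !linearD hs ht.
Qed.

Lemma tens0l U V (v : V) : tens (0 : U) v = 0.
Proof. by rewrite -(scale0r (0 : U)) tensZl scale0r. Qed.

Lemma tens0r U V (u : U) : tens u (0 : V) = 0.
Proof. by rewrite -(scale0r (0 : V)) tensZr scale0r. Qed.

Lemma tens_map_id U V (f : {linear U -> U}) (g : {linear V -> V}) :
  f =1 id -> g =1 id -> tens_map f g =1 id.
Proof.
move=> ef eg t; rewrite -[RHS]/((idfun : {linear _ -> _}) t).
by move: t; apply: tensor_ext => u v; rewrite /= tens_mapE ef eg.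
Qed.

Lemma tens_map_comp U U' U'' V V' V'' (f : {linear U' -> U''}) (f' : {linear U -> U'})
    (f'' : {linear U -> U''}) (g : {linear V' -> V''}) (g' : {linear V -> V'})
    (g'' : {linear V -> V''}) :
  (forall u, f (f' u) = f'' u) -> (forall v, g (g' v) = g'' v) ->
  forall t, tens_map f g (tens_map f' g' t) = tens_map f'' g'' t.
Proof.
move=> ef eg t; rewrite -[LHS]/((tens_map f g \o tens_map f' g') t).
by move: t; apply: tensor_ext => u v; rewrite /= !tens_mapE ef eg.
Qed.

Lemma tens_mapDl U U' V V' (f f1 f2 : {linear U -> U'}) (g : {linear V -> V'}) :
  (forall u, f u = f1 u + f2 u) ->
  forall t, tens_map f g t = tens_map f1 g t + tens_map f2 g t.
Proof.
move=> e; apply: tensor_elim => [|u v|s t hs ht].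
- by rewrite !linear0 addr0.
- by rewrite !tens_mapE e tensDl.
- by rewrite !linearD /= hs ht addrACA.
Qed.

Lemma tens_mapZl U U' V V' (f f' : {linear U -> U'}) (g : {linear V -> V'}) a :
  (forall u, f u = a *: f' u) ->
  forall t, tens_map f g t = a *: tens_map f' g t.
Proof.
move=> e; apply: tensor_elim => [|u v|s t hs ht].
- by rewrite !linear0.
- by rewrite !tens_mapE e tensZl.
- by rewrite (linearD (tens_map f g)) (linearD (tens_map f' g)) /= hs ht scalerDr.
Qed.

Lemma tens_map_suml U U' V V' (I : Type) (r : seq I) (f : {linear U -> U'})
    (F : I -> {linear U -> U'}) (g : {linear V -> V'}) :
  (forall u, f u = \sum_(i <- r) F i u) ->
  forall t, tens_map f g t = \sum_(i <- r) tens_map (F i) g t.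
Proof.
move=> e; apply: tensor_elim => [|u v|s t hs ht].
- by rewrite linear0 big1 // => i _; rewrite linear0.
- rewrite tens_mapE e; elim: r {f e} => [|i r ih]; first by rewrite !big_nil tens0l.
  by rewrite !big_cons tensDl ih tens_mapE.
- rewrite (linearD (tens_map f g)) /= hs ht -big_split.
  by apply: eq_bigr => i _ /=; rewrite linearD.
Qed.

Lemma tens_map_eq0l U U' V V' (f : {linear U -> U'}) (g : {linear V -> V'}) :
  (forall u, f u = 0) -> forall t, tens_map f g t = 0.
Proof. by move=> h; apply: tens_map_eq0 => u v; rewrite h tens0l. Qed.

Lemma tens_map_eq0r U U' V V' (f : {linear U -> U'}) (g : {linear V -> V'}) :
  (forall v, g v = 0) -> forall t, tens_map f g t = 0.
Proof. by move=> h; apply: tens_map_eq0 => u v; rewrite h tens0r. Qed.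

Lemma tens_map_idl U V (f : {linear U -> U}) (g : {linear V -> V}) a :
  (forall u, f u = a *: u) -> g =1 id -> forall t, tens_map f g t = a *: t.
Proof.
move=> ef eg t; rewrite (@tens_mapZl _ _ _ _ f (@idfun U) g a) //.
by rewrite tens_map_id.
Qed.

Section Swap.
Variables U V : lmodType R.
Let b (u : U) (v : V) := tens v u.
Let bl v : linear (b^~ v). Proof. by move=> a u u'; rewrite /b tensDr tensZr. Qed.
Let br u : linear (b u). Proof. by move=> a v v'; rewrite /b tensDl tensZl. Qed.
Definition tensC : tensor U V -> tensor V U := tens_lift b.
HB.instance Definition _ := GRing.isLinear.Build R (tensor U V) (tensor V U) *:%R
  tensC (tens_lift_linear bl br).
Lemma tensCE u v : tensC (tens u v) = tens v u.
Proof. exact: (tens_lift_tens bl br). Qed.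
End Swap.

Lemma tensCK U V : cancel (@tensC U V) (@tensC V U).
Proof.
move=> t; rewrite -[LHS]/((@tensC V U \o @tensC U V) t) -[RHS]/((@idfun _) t).
by move: t; apply: tensor_ext => u v; rewrite /= !tensCE.
Qed.

Lemma tensC_map U U' V V' (f : {linear U -> U'}) (g : {linear V -> V'}) t :
  tensC (tens_map f g t) = tens_map g f (tensC t).
Proof.
rewrite -[LHS]/((@tensC U' V' \o tens_map f g) t).
rewrite -[RHS]/((tens_map g f \o @tensC U V) t).
by move: t; apply: tensor_ext => u v; rewrite /= !(tensCE, tens_mapE).
Qed.

Lemma tens_map_injC U U' V V' (f : {linear U -> U'}) (g : {linear V -> V'}) :
  injective (tens_map f g) -> injective (tens_map g f).
Proof.
move=> h s t e; apply: (can_inj (@tensCK V U)); apply: h.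
by rewrite -!tensC_map e.
Qed.

Lemma tens_map_surj U U' V V' (f : {linear U -> U'}) (g : {linear V -> V'}) :
  (forall u', exists u, f u = u') -> (forall v', exists v, g v = v') ->
  forall t', exists t, tens_map f g t = t'.
Proof.
move=> hf hg; apply: tensor_elim => [|u v|_ _ [s <-] [t <-]].
- by exists 0; rewrite linear0.
- have [[u' <-] [v' <-]] := (hf u, hg v); exists (tens u' v'); exact: tens_mapE.
- by exists (s + t); rewrite linearD.
Qed.

(* Tensor-equivalent formal sums over C have lifts to B whose classes differ by
   an element of the image of U (x) A. *)
Lemma tens_rexact U A B C (i : {linear A -> B}) (p : {linear B -> C}) :
  is_coker i p -> is_coker (tens_map (@idfun U) i) (tens_map (@idfun U) p).
Proof.
move=> [psurj pker]; split; first by apply: tens_map_surj => // u; exists u.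
move=> t; split=> [|[s <-]]; last first.
  rewrite /= (@tens_map_comp _ _ _ _ _ _ _ _ (@idfun U) _ _ (\0)) //.
    by rewrite tens_map_eq0r.
  by move=> v; apply/pker; exists v.
pose J (t : tensor U B) := exists s, tens_map (@idfun U) i s = t.
have JD s1 s2 : J s1 -> J s2 -> J (s1 + s2).
  by move=> [x <-] [y <-]; exists (x + y); rewrite linearD.
have JN s1 : J s1 -> J (- s1) by move=> [x <-]; exists (- x); rewrite linearN.
have J0 : J 0 by exists 0; rewrite linear0.
have Jb u b b' : p b = p b' -> J (tens u b - tens u b').
  move=> e; have [a ea] : exists a, i a = b - b' by apply/pker; rewrite linearB e subrr.
  exists (tens u a); rewrite tens_mapE ea.
  by rewrite -scaleN1r tensDr tensZr scaleN1r.
pose P := map (fun x : U * B => (x.1, p x.2)).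
have Pcat s1 s2 : P (s1 ++ s2) = P s1 ++ P s2 by rewrite /P map_cat.
have lift s : exists s', P s' = s.
  elim: s => [|[u c] s [s' <-]]; first by exists [::].
  by have [b <-] := psurj c; exists ((u, b) :: s').
have split_cat s1 s2 s' : P s' = s1 ++ s2 ->
    exists s1' s2', [/\ s' = s1' ++ s2', P s1' = s1 & P s2' = s2].
  move=> e; exists (take (size s1) s'), (drop (size s1) s'); rewrite cat_take_drop.
  by rewrite /P map_take map_drop -/(P s') e take_size_cat // drop_size_cat.
have same s1 s2 : P s1 = P s2 -> J (tens_class s1 - tens_class s2).
  elim: s1 s2 => [|[u b] s1 ih] [|[u' b'] s2] //=; first by rewrite subrr.
  move=> [<- eb /ih h]; rewrite !tens_class_sum !big_cons -!tens_class_sum /=.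
  by rewrite opprD addrACA; apply: JD => //; exact: Jb.
(* Quantifying over all lifts of both sums lets the transitivity case pick any lift of the middle
   sum. *)
have key s1 s2 : tens_rel s1 s2 -> forall s1' s2', P s1' = s1 -> P s2' = s2 ->
    J (tens_class s1' - tens_class s2').
  have cE s s' : tens_class (s ++ s') = tens_class s + tens_class s' :> tensor U B.
    by rewrite !tens_class_sum big_cat.
  have c1 (u : U) (b : B) : tens_class [:: (u, b)] = tens u b by [].
  have c2 (u u' : U) (b b' : B) :
    tens_class [:: (u, b); (u', b')] = tens u b + tens u' b' by rewrite -cat1s cE.
  elim=> {s1 s2}.
  - by move=> s s1' s2' e1 e2; apply: same; rewrite e1.
  - by move=> s1 s2 _ ih s1' s2' e1 e2; rewrite -opprB; apply: JN; exact: ih.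
  - move=> s1 s2 s3 _ ih1 _ ih2 s1' s3' e1 e3; have [s2' e2] := lift s2.
    rewrite -(subrK (tens_class s2') (tens_class s1')) -addrA.
    by apply: JD; [exact: ih1|exact: ih2].
  - move=> s s' t1 t2 _ ih1 _ ih2 s1' s2' /split_cat[x [y [-> ex ey]]].
    move=> /split_cat[z [w [-> ez ew]]]; rewrite !cE opprD addrACA.
    by apply: JD; [exact: ih1|exact: ih2].
  - move=> s1 s2 s1' s2' /split_cat[x [y [-> ex ey]]] /split_cat[z [w [-> ez ew]]].
    rewrite !cE [tens_class z + _]addrC opprD addrACA.
    by apply: JD; apply: same; rewrite ?ex ?ey ?ez ?ew.
  - move=> u u' c [|[a b] [|]] // [|[a1 b1] [|[a2 b2] [|]]] // [-> <-] [-> e1 -> e2].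
    rewrite c1 c2 tensDl opprD addrACA; apply: JD; exact: Jb.
  - move=> u c c' [|[a b] [|]] // [|[a1 b1] [|[a2 b2] [|]]] // [-> e] [-> e1 -> e2].
    by rewrite c1 c2 -tensDr; apply: Jb; rewrite linearD e1 e2.
  - move=> a u c [|[x b] [|]] // [|[x1 b1] [|]] // [-> e] [-> e1].
    by rewrite !c1 tensZl -tensZr; apply: Jb; rewrite linearZ /= e.
  - move=> c [|[x b] [|]] // [|?] // [-> e] _.
    by rewrite c1 tens0l -[tens_class [::]]/(0 : tensor U B) subrr.
elim/tens_ind: t => s e.
have h : tens_rel (P s) [::].
  apply/tens_classP; rewrite -[RHS]/(0 : tensor U C) -e.
  rewrite !tens_class_sum linear_sum big_map; apply: eq_bigr => q _.
  by rewrite /= tens_mapE.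
by have := key _ _ h s [::] erefl erefl; rewrite subr0.
Qed.

Lemma tens_lexact U A B C (i : {linear A -> B}) (p : {linear B -> C}) :
  is_coker i p -> is_coker (tens_map i (@idfun U)) (tens_map p (@idfun U)).
Proof.
move=> /(@tens_rexact U)[psurj pker]; split=> [t|t].
  by have [s es] := psurj (tensC t); exists (tensC s); rewrite /= -tensC_map;
      rewrite /= in es; rewrite es tensCK.
split=> [e|[s <-]].
  have [s es] : exists s, tens_map (@idfun U) i s = tensC t.
    by apply/pker; rewrite /= -tensC_map; rewrite /= in e; rewrite e linear0.
  by exists (tensC s); rewrite /= -tensC_map; rewrite /= in es; rewrite es tensCK.
apply: (can_inj (@tensCK _ _)); rewrite linear0 /= !tensC_map.
by apply/pker; exists (tensC s).
Qed.

End TensorTheory.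

(** * Flat modules and Tor *)

Section FreeModule.
Variables (R : comNzRingType) (T : lmodType R).
Local Notation free := (malg T R).

Definition free_coef (e : T) (q : free) : R^o := mcoeff e q.
Fact free_coef_linear e : linear (free_coef e).
Proof. by move=> a p q; rewrite /free_coef mcoeffD mcoeffZ. Qed.

Section Comb.
Variables (U : lmodType R) (b : T -> U).
Definition free_comb (q : free) : U :=
  \sum_(e <- finmap.enum_fset (msupp q)) free_coef e q *: b e.

Lemma free_combE (q : free) (d : finmap.finSet T) :
  finmap.fsubset (msupp q) d ->
  free_comb q = \sum_(e <- finmap.enum_fset d) free_coef e q *: b e.
Proof.
move=> h; apply: (finmap.big_fset_incl _ h) => e _.
by rewrite /free_coef => /mcoeff_outdom ->; rewrite scale0r.
Qed.

Fact free_comb_linear : linear free_comb.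
Proof.
move=> a p q.
pose d := finmap.fsetU (finmap.fsetU (msupp p) (msupp q))
  (msupp (a *: p + q)).
rewrite (@free_combE p d) ?(@free_combE q d) ?(@free_combE _ d).
- rewrite scaler_sumr -big_split; apply: eq_bigr => e _.
  by rewrite free_coef_linear scalerDl scalerA.
- exact: finmap.fsubsetUr.
- apply: finmap.fsubset_trans (finmap.fsubsetUl _ _); exact: finmap.fsubsetUr.
- apply: finmap.fsubset_trans (finmap.fsubsetUl _ _); exact: finmap.fsubsetUl.
Qed.
End Comb.

(** The coordinate maps [c W e] are natural in W, and an element is recovered from finitely many of
    its coordinates, so f can be cancelled coordinate by coordinate. *)
Lemma free_flat : flat free.
Proof.
move=> U V f finj; apply: linear_inj.
have bl (W : lmodType R) e (w : W) : linear (fun q => free_coef e q *: w).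
  by move=> a p q; rewrite free_coef_linear scalerDl scalerA.
have br (W : lmodType R) e (q : free) : linear (fun w : W => free_coef e q *: w).
  by move=> a v w; rewrite scalerDr !scalerA mulrC.
pose c (W : lmodType R) e : {linear tensor free W -> W} :=
  mklin (tens_lift_linear (bl W e) (br W e)).
have cE (W : lmodType R) e q (w : W) : c W e (tens q w) = free_coef e q *: w.
  exact: (tens_lift_tens (bl W e) (br W e)).
have cf e t : c V e (tens_map (@idfun _) f t) = f (c U e t).
  rewrite -[LHS]/((c V e \o tens_map (@idfun _) f) t) -[RHS]/((f \o c U e) t).
  by move: t; apply: tensor_ext => q u; rewrite /= tens_mapE !cE linearZ.
pose bs e : free := mkmalgU e 1.
(* Allowing every larger support d' makes it possible to add two expansions over a common
   support. *)
have expand t : exists d : finmap.finSet T, forall d', finmap.fsubset d d' ->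
    t = \sum_(e <- finmap.enum_fset d') tens (bs e) (c U e t).
  move: t; apply: tensor_elim => [|q u|s t [ds hs] [dt ht]].
  - exists (finmap.fset0) => d' _; rewrite big1 // => e _.
    by rewrite linear0 tens0r.
  - exists (msupp q) => d' hd; rewrite [in LHS](monalgEw hd).
    rewrite -[LHS]tensCK -[RHS]tensCK; congr tensC; rewrite tensCE.
    rewrite linear_sum; elim: (finmap.enum_fset d') => [|e r ih].
      by rewrite !big_nil tens0r.
    rewrite !big_cons tensDr ih; congr (_ + _); rewrite cE tensZr /= linearZ /= tensCE.
    rewrite -tensZr; congr tens; apply/malgP => k.
    by rewrite mcoeffZ !mcoeffU mulrnAr mulr1.
  - exists (finmap.fsetU ds dt) => d' hd.
    transitivity (\sum_(e <- finmap.enum_fset d') tens (bs e) (c U e s) +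
                  \sum_(e <- finmap.enum_fset d') tens (bs e) (c U e t)).
      congr (_ + _); [apply: hs|apply: ht]; apply: finmap.fsubset_trans hd.
        exact: finmap.fsubsetUl.
      exact: finmap.fsubsetUr.
    by rewrite -big_split; apply: eq_bigr => e _; rewrite linearD tensDr.
move=> t e0; have [d /(_ d (finmap.fsubset_refl d)) ->] := expand t.
rewrite big1 // => e _; have -> : c U e t = 0; last by rewrite tens0r.
by apply: (linear_inj0 finj); rewrite -cf /= -[tens_map _ _ _]/(tens_map (@idfun _) f t) e0 linear0.
Qed.

Lemma free_cover : exists p : {linear free -> T}, forall t, exists q, p q = t.
Proof.
exists (mklin (free_comb_linear (@id T))) => t; exists (mkmalgU t 1).
rewrite /= (@free_combE _ _ _ (finmap.fset1 t)) ?finmap.big_seq_fset1.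
  by rewrite /free_coef mcoeffUU scale1r.
by apply/finmap.fsubsetP => e; rewrite msuppU oner_eq0.
Qed.

End FreeModule.

Section FlatTheory.
Variable R : comNzRingType.
Implicit Types (U V W A B C S Q F P T : lmodType R).

Lemma flat_tensr F U V (f : {linear U -> V}) :
  flat F -> injective f -> injective (tens_map f (@idfun F)).
Proof. by move=> Fflat finj; apply: tens_map_injC; exact: Fflat. Qed.

Lemma im_factor U V (f : {linear U -> V}) :
  exists g : {linear U -> im f}, (forall u, submod_val (g u) = f u) /\
    forall v, exists u, g u = v.
Proof.
have h u : image f (f u) by exists u.
exists (corestr (imageP f) h); split=> // v.
have [u e] := submod_valP v; exists u; exact: submod_val_inj.
Qed.

(** g is factored through its image: right exactness handles the surjection onto [im g], flatness
    the inclusion of [im g] into W. *)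
Lemma flat_exact F U V W (f : {linear U -> V}) (g : {linear V -> W}) : flat F ->
  (forall v, g v = 0 <-> exists u, f u = v) ->
  forall t, tens_map g (@idfun F) t = 0 <-> exists s, tens_map f (@idfun F) s = t.
Proof.
move=> Fflat ex t; have [g1 [g1E g1s]] := im_factor g.
have ck : is_coker f g1.
  split=> // v; rewrite -ex -g1E; split=> [->|h]; first by rewrite linear0.
  by apply: submod_val_inj; rewrite h linear0.
have [_ /(_ t) /= <-] := tens_lexact F ck.
have gE s : tens_map g (@idfun F) s =
    tens_map (@submod_val _ _ _ (imageP g)) (@idfun F) (tens_map g1 (@idfun F) s).
  by rewrite (@tens_map_comp _ _ _ _ _ _ _ _ _ g _ _ (@idfun F)).
rewrite gE; split=> [|->]; last by rewrite linear0.
by apply: linear_inj0; apply: flat_tensr Fflat _; exact: submod_val_inj.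
Qed.

(** P is a retract of the free module on its own elements, and injectivity after tensoring passes to
    retracts. *)
Lemma proj_flat P : projective P -> flat P.
Proof.
move=> Pproj; have [p ps] := free_cover P; have [s sE] := Pproj _ _ p (@idfun P) ps.
move=> U V f finj; apply: linear_inj => t e.
have h : tens_map s (@idfun U) t = 0.
  apply: (linear_inj0 (@free_flat R P U V f finj)).
  rewrite /= (@tens_map_comp _ _ _ _ _ _ _ _ _ s _ _ f) //.
  have <- := (@tens_map_comp _ _ _ _ _ _ _ s (@idfun P) s (@idfun V) f f _ _ t) => //.
  by rewrite e linear0.
have : tens_map p (@idfun U) (tens_map s (@idfun U) t) = t.
  rewrite /= (@tens_map_comp _ _ _ _ _ _ _ _ _ (@idfun P) _ _ (@idfun U)) //.
  by rewrite tens_map_id.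
by rewrite h linear0.
Qed.

Lemma enough_flats S : exists (S' Q : lmodType R) (i : {linear S' -> Q})
  (p : {linear Q -> S}), ses i p /\ flat Q.
Proof.
have [p ps] := free_cover S.
exists (ker p), (malg S R), (@submod_val _ _ _ (kernelP p)), p.
by split; [exact: ses_ker | exact: free_flat].
Qed.

(* Both hypotheses on S' (x) C and S (x) A express that Tor_1(S, C) vanishes. *)
Lemma tor1_balance S' Q S A B C (j : {linear S' -> Q}) (q : {linear Q -> S})
    (i : {linear A -> B}) (p : {linear B -> C}) :
  ses j q -> ses i p -> flat Q ->
  injective (tens_map j (@idfun C)) -> injective (tens_map (@idfun S) i).
Proof.
move=> [jinj qcok] [iinj pcok] Qflat h; apply: linear_inj => z z0.
have [qs qk] := tens_lexact A qcok; have [y yz] := qs z; rewrite /= in yz qk.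
(* The image of y in Q (x) B dies in S (x) B, so it comes from some x in S' (x) B. The hypothesis on
   S' (x) C forces x to come from S' (x) A, and flatness of Q cancels i, which shows that y comes
   from S' (x) A as well. *)
have [x xy] : exists x, tens_map j (@idfun B) x = tens_map (@idfun Q) i y.
  have [_ /(_ (tens_map (@idfun Q) i y)) <-] := tens_lexact B qcok.
  rewrite /= (@tens_map_comp _ _ _ _ _ _ _ _ _ q _ _ i) //.
  by rewrite -(@tens_map_comp _ _ _ _ _ _ _ (@idfun S) q q i (@idfun A)) ?yz.
have [x' x'x] : exists x', tens_map (@idfun S') i x' = x.
  have [_ /(_ x) <-] := tens_rexact S' pcok; apply: (linear_inj0 h) => /=.
  rewrite /= (@tens_map_comp _ _ _ _ _ _ _ _ _ j _ _ p) //.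
  rewrite -(@tens_map_comp _ _ _ _ _ _ _ (@idfun Q) j j p (@idfun B)) // xy.
  rewrite /= (@tens_map_comp _ _ _ _ _ _ _ _ _ (@idfun Q) _ _ (\0)) //.
    by rewrite tens_map_eq0r.
  by move=> a; apply/(pcok.2); exists a.
have xy' : tens_map j (@idfun A) x' = y.
  apply: (Qflat _ _ i iinj); rewrite -xy -x'x.
  by rewrite !(@tens_map_comp _ _ _ _ _ _ _ _ _ j _ _ i).
by rewrite -yz -xy'; apply/qk; exists x'.
Qed.

Lemma tor1_balanceC S' Q S A B C (j : {linear S' -> Q}) (q : {linear Q -> S})
    (i : {linear A -> B}) (p : {linear B -> C}) :
  ses j q -> ses i p -> flat B ->
  injective (tens_map (@idfun S) i) -> injective (tens_map j (@idfun C)).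
Proof.
move=> hS hA Bflat h; apply: tens_map_injC.
by apply: (tor1_balance hA hS Bflat); exact: tens_map_injC.
Qed.

End FlatTheory.

(** * Vanishing of higher Tor against E *)

Section Acyclic.
Variables (R : comNzRingType) (E : lmodType R).
Implicit Types (A B C S Q F M : lmodType R).

(** For an i-th syzygy S of E, Tor_1(S, -) is Tor_(i+1)(E, -). Ranging over all flat presentations
    encodes the higher Tor without a chosen resolution. *)
Inductive syzygy : lmodType R -> Prop :=
| Syzygy0 : syzygy E
| SyzygyS S' Q S (j : {linear S' -> Q}) (q : {linear Q -> S}) :
    ses j q -> flat Q -> syzygy S -> syzygy S'.

(* Tor_i(E, M) = 0 for all i > 0. *)
Definition acyclic M := forall S' Q S (j : {linear S' -> Q}) (q : {linear Q -> S}),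
  ses j q -> flat Q -> syzygy S -> injective (tens_map j (@idfun M)).

Lemma flat_acyclic F : flat F -> acyclic F.
Proof. by move=> Fflat S' Q S j q [jinj _] _ _; exact: flat_tensr. Qed.

Lemma acyclic_inj A B C (i : {linear A -> B}) (p : {linear B -> C}) S :
  ses i p -> acyclic C -> syzygy S -> injective (tens_map (@idfun S) i).
Proof.
move=> hA hC hS; have [S' [Q [j [q [hj Qflat]]]]] := enough_flats S.
exact: (tor1_balance hj hA Qflat (hC _ _ _ _ _ hj Qflat hS)).
Qed.

Lemma acyclic_injE A B C (i : {linear A -> B}) (p : {linear B -> C}) :
  ses i p -> acyclic C -> injective (tens_map (@idfun E) i).
Proof. by move=> hA hC; exact: (acyclic_inj hA hC Syzygy0). Qed.

(** Tor_1(S, A) lies between Tor_2(S, C) = Tor_1(S', C) and Tor_1(S, B); the first vanishes because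
    S' is again a syzygy of E. *)
Lemma acyclic_ker A B C (i : {linear A -> B}) (p : {linear B -> C}) :
  ses i p -> acyclic B -> acyclic C -> acyclic A.
Proof.
move=> hA hB hC S' Q S j q hj Qflat hS; apply: linear_inj => z z0.
apply: (linear_inj0 (acyclic_inj hA hC (SyzygyS hj Qflat hS))).
apply: (linear_inj0 (hB _ _ _ _ _ hj Qflat hS)).
rewrite /= (@tens_map_comp _ _ _ _ _ _ _ _ _ j _ _ i) //.
by rewrite -(@tens_map_comp _ _ _ _ _ _ _ (@idfun Q) j j i (@idfun A)) // z0 linear0.
Qed.

Lemma acyclic_ext A B C (i : {linear A -> B}) (p : {linear B -> C}) :
  ses i p -> acyclic A -> acyclic C -> acyclic B.
Proof.
move=> hA aA aC S' Q S j q hj Qflat hS; apply: linear_inj => z z0.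
have [y yz] : exists y, tens_map (@idfun S') i y = z.
  have [_ /(_ z) <-] := tens_rexact S' hA.2.
  apply: (linear_inj0 (aC _ _ _ _ _ hj Qflat hS)).
  rewrite /= (@tens_map_comp _ _ _ _ _ _ _ _ _ j _ _ p) //.
  by rewrite -(@tens_map_comp _ _ _ _ _ _ _ (@idfun Q) j j p (@idfun B)) // z0 linear0.
rewrite -yz in z0 *; suff -> : y = 0 by rewrite linear0.
apply: (linear_inj0 (aA _ _ _ _ _ hj Qflat hS)).
apply: (linear_inj0 (Qflat _ _ i hA.1)); rewrite -z0.
by rewrite /= !(@tens_map_comp _ _ _ _ _ _ _ _ _ j _ _ i).
Qed.

(** Since Z contains the kernels of suitable flat covers of its members, Tor_(i+1)(E, M) is Tor_1(E,
    -) of a member of Z, and it suffices to kill Tor_1 on the whole class. *)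
Lemma acyclic_resolution (Z : lmodType R -> Prop) :
  (forall M, Z M -> exists (M' F : lmodType R) (i : {linear M' -> F})
     (p : {linear F -> M}),
     [/\ ses i p, flat F, injective (tens_map (@idfun E) i) & Z M']) ->
  forall M, Z M -> acyclic M.
Proof.
move=> step.
have key S : syzygy S -> forall M, Z M -> exists (M' F : lmodType R)
    (i : {linear M' -> F}) (p : {linear F -> M}),
    [/\ ses i p, flat F, injective (tens_map (@idfun S) i) & Z M'].
  elim=> {S} [|S' Q S j q hj Qflat _ ih] M ZM; first exact: step.
  have [M' [F [i [p [hi Fflat Si ZM']]]]] := ih M ZM.
  exists M', F, i, p; split=> //.
  (* Tor_1(S', M) = Tor_2(S, M) = Tor_1(S, M'), and the induction hypothesis at M' kills the last
     one. *)
  have [M'' [F' [i' [p' [hi' F'flat Si' _]]]]] := ih M' ZM'.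
  have h1 := tor1_balanceC hj hi' F'flat Si'.
  apply: linear_inj => z z0; apply: (linear_inj0 h1).
  apply: (linear_inj0 (Qflat _ _ i hi.1)).
  rewrite /= (@tens_map_comp _ _ _ _ _ _ _ _ _ j _ _ i) //.
  by rewrite -(@tens_map_comp _ _ _ _ _ _ _ j (@idfun S') j (@idfun F) i) // z0 linear0.
move=> M ZM S' Q S j q hj Qflat hS.
have [M' [F [i [p [hi Fflat Si _]]]]] := key S hS M ZM.
exact: tor1_balanceC hj hi Fflat Si.
Qed.

End Acyclic.

(** * Dimension shifting with a test complex *)

Section Sequences.
Variable R : comNzRingType.
Implicit Types (A B C U V W X Y : lmodType R).

Lemma ses_lift A B C (i : {linear A -> B}) (p : {linear B -> C}) U (f : {linear U -> B}) :
  ses i p -> (forall u, p (f u) = 0) -> exists g : {linear U -> A}, forall u, i (g u) = f u.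
Proof.
move=> [iinj [_ pk]] h.
have [|||g gE] := @graph_linear R U A (fun u a => i a = f u).
- by move=> a u v u' v' e e'; rewrite !linearP e e'.
- by move=> u; apply/pk.
- by move=> v; rewrite linear0; apply: linear_inj0.
- by exists g => u; apply/gE.
Qed.

Section Pairs.
Variables (U V W : lmodType R) (f : {linear W -> U}) (g : {linear W -> V}).
Definition pairl (w : W) : (U * V)%type := (f w, g w).
Fact pairl_linear : linear pairl.
Proof. by move=> a v w; rewrite /pairl !linearP. Qed.
HB.instance Definition _ := GRing.isLinear.Build R W (U * V)%type *:%R pairl pairl_linear.
End Pairs.

Section Copairs.
Variables (U V W : lmodType R) (f : {linear U -> W}) (g : {linear V -> W}).
Definition copair (w : U * V) : W := f w.1 + g w.2.
Fact copair_linear : linear copair.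
Proof. by move=> a v w; rewrite /copair !linearP scalerDr addrACA. Qed.
HB.instance Definition _ := GRing.isLinear.Build R (U * V)%type W *:%R copair copair_linear.
End Copairs.

Lemma ses_prod U V :
  ses (pairl (@idfun U) (\0 : {linear U -> V})) (copair (\0 : {linear U -> V}) (@idfun V)).
Proof.
split=> [u u' [] //|]; split=> [v|[u v]]; first by exists (0, v); exact: add0r.
rewrite /= [copair _ _ _]add0r /=.
by split=> [->|[u' [_ <-]] //]; exists u.
Qed.

End Sequences.

Section ComplexCycles.
Variables (R : comNzRingType) (X : complex R).

Lemma cycle_at i j (x : X i) : i = j + 1 -> cycle x <-> cdiff X i j x = 0.
Proof. by move=> e; have -> : j = i - 1; [rewrite e addrK|]. Qed.

Lemma boundary_at i j (x : X i) : j = i + 1 ->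
  boundary x <-> exists y : X j, cdiff X j i y = x.
Proof. by move=> ->. Qed.

Definition cyc i : lmodType R := ker (cdiff X i (i - 1)).

Lemma ses_cyc j : homology_trivial X j -> exists p : {linear X (j + 1) -> cyc j},
  ses (@submod_val R _ _ (kernelP (cdiff X (j + 1) (j + 1 - 1)))) p /\
  forall x, submod_val (p x) = cdiff X (j + 1) j x.
Proof.
move=> ex.
have h (x : X (j + 1)) : kernel (cdiff X j (j - 1)) (cdiff X (j + 1) j x).
  exact: cdiff_comp.
exists (corestr (kernelP _) h); split=> //; split; first exact: submod_val_inj.
split=> [c|x].
  have [y ye] := ex (submod_val c) (submod_valP c).
  by exists y; apply: submod_val_inj.
have -> : corestr (kernelP (cdiff X j (j - 1))) h x = 0 <-> cdiff X (j + 1) j x = 0.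
  split=> [e|e]; last by apply: submod_val_inj; rewrite /= e.
  by rewrite -(corestrE (kernelP (cdiff X j (j - 1))) h) e linear0.
rewrite -(cycle_at _ erefl) /cycle; split=> [e|[u <-]].
  exact: (@submod_lift R _ _ (kernelP (cdiff X (j + 1) (j + 1 - 1)))).
exact: (@submod_valP R _ _ (kernelP (cdiff X (j + 1) (j + 1 - 1)))).
Qed.

End ComplexCycles.

Section TestComplex.
Variables (R : comNzRingType) (E : lmodType R).
Variables (T : nat -> lmodType R) (d : forall r, {linear T r -> T r.+1}).
Hypothesis dd : forall r x, d r.+1 (d r x) = 0.
Hypothesis T0 : trivial_module (T 0%N).
Hypothesis T_inj : forall r (A B C : lmodType R) (i : {linear A -> B}) (p : {linear B -> C}),
  ses i p -> acyclic E C -> injective (tens_map (@idfun (T r)) i).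
Implicit Types (A B C M : lmodType R).

Definition test_d M r : {linear tensor (T r) M -> tensor (T r.+1) M} :=
  tens_map (d r) (@idfun M).
Definition test_map r (A B : lmodType R) (i : {linear A -> B})
    : {linear tensor (T r) A -> tensor (T r) B} :=
  tens_map (@idfun (T r)) i.
Lemma test_d_comp M r t : test_d M r.+1 (test_d M r t) = 0.
Proof.
rewrite /= (@tens_map_comp _ _ _ _ _ _ _ _ _ (\0) _ _ (@idfun M)) => [||//].
  by rewrite tens_map_eq0l.
by move=> x; rewrite dd.
Qed.
Lemma test_d_map r A B (i : {linear A -> B}) t : test_d B r (test_map r i t) = test_map r.+1 i (test_d A r t).
Proof. by rewrite /= !(@tens_map_comp _ _ _ _ _ _ _ _ _ (d r) _ _ i). Qed.

Definition test_boundary M r : tensor (T r) M -> Prop :=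
  match r with 0%N => fun t => t = 0 | r'.+1 => fun t => exists s, test_d M r' s = t end.
Definition test_exact M r := forall t : tensor (T r) M, test_d M r t = 0 -> test_boundary t.

Lemma test_exact0 M : test_exact M 0.
Proof.
by move=> t _; apply: tensor_elim t => [//|u v|s t /= -> ->];
    rewrite ?addr0 // (T0 u) tens0l.
Qed.

Lemma test_boundaryD M r (s t : tensor (T r) M) : test_boundary s -> test_boundary t ->
    test_boundary (s + t).
Proof.
case: r s t => [|r] s t /=; first by move=> -> ->; rewrite addr0.
by move=> [x <-] [y <-]; exists (x + y); rewrite linearD.
Qed.

Lemma test_boundary_cycle M r (t : tensor (T r) M) : test_boundary t -> test_d M r t = 0.
Proof. by case: r t => [t /= ->|r t [s <-]]; rewrite ?linear0 // test_d_comp. Qed.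

Lemma test_boundary_map r A B (i : {linear A -> B}) (t : tensor (T r) A) : test_boundary t -> test_boundary (test_map r i t).
Proof.
case: r t => [t /= ->|r t [s <-]]; first by rewrite linear0.
by exists (test_map r i s); rewrite test_d_map.
Qed.

Section Ses.
Variables (A B C : lmodType R) (i : {linear A -> B}) (p : {linear B -> C}).
Hypotheses (hs : ses i p) (aC : acyclic E C).

Let fi_inj r : injective (test_map r i). Proof. exact: (T_inj hs aC). Qed.
Let fp_surj r t : exists s, test_map r p s = t.
Proof. by have [h _] := tens_rexact (T r) hs.2; exact: h. Qed.
Let fker r t : test_map r p t = 0 -> exists s, test_map r i s = t.
Proof. by have [_ h] := tens_rexact (T r) hs.2; move/h. Qed.
Let fpi r t : test_map r p (test_map r i t) = 0.
Proof. by have [_ h] := tens_rexact (T r) hs.2; apply/h; exists t. Qed.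

Let test_boundary_lift r (t : tensor (T r) C) : test_boundary t ->
    exists2 s : tensor (T r) B, test_map r p s = t & test_boundary s.
Proof.
case: r t => [t /= ->|r t [s <-]]; first by exists 0; rewrite ?linear0.
by have [s' <-] := fp_surj s; exists (test_d B r s'); [rewrite test_d_map|exists s'].
Qed.

(** One place of the long exact sequence. It asks for exactness of C one position earlier only,
    which allows the induction on r for the cycles of a complete flat resolution. *)
Lemma test_exact_ker_step r : test_exact B r.+1 -> test_exact C r -> test_exact A r.+1.
Proof.
move=> hB hC t t0; have [s es] : test_boundary (test_map r.+1 i t)
    by apply: hB; rewrite test_d_map t0 linear0.
have /test_boundary_lift[w ew bw] : test_boundary (test_map r p s)
    by apply: hC; rewrite test_d_map es fpi.
have [a ea] : exists a, test_map r i a = s - w by apply: fker; rewrite linearB ew subrr.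
exists a; apply: (fi_inj (r := r.+1)); rewrite -test_d_map ea linearB es.
by rewrite (test_boundary_cycle bw) subr0.
Qed.

Lemma test_exact_ker : (forall r, test_exact B r) -> (forall r, test_exact C r) ->
    forall r, test_exact A r.
Proof. by move=> hB hC [|r]; [exact: test_exact0 | exact: test_exact_ker_step]. Qed.

Lemma test_exact_coker : (forall r, test_exact A r) -> (forall r, test_exact B r) ->
    forall r, test_exact C r.
Proof.
move=> hA hB r t t0; have [s es] := fp_surj t.
have [a ea] : exists a, test_map r.+1 i a = test_d B r s
    by apply: fker; rewrite -test_d_map es.
have [a' ea'] : test_boundary a.
  by apply: hA; apply: (fi_inj (r := r.+2)); rewrite -test_d_map ea test_d_comp linear0.
have -> : t = test_map r p (s - test_map r i a') by rewrite linearB fpi es subr0.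
by apply/test_boundary_map/hB; rewrite linearB test_d_map ea' ea subrr.
Qed.

Lemma test_exact_ext : (forall r, test_exact A r) -> (forall r, test_exact C r) ->
    forall r, test_exact B r.
Proof.
move=> hA hC r t t0.
have /test_boundary_lift[w ew bw] : test_boundary (test_map r p t)
    by apply: hC; rewrite test_d_map t0 linear0.
have [a ea] : exists a, test_map r i a = t - w by apply: fker; rewrite linearB ew subrr.
rewrite -(subrK w t) -ea; apply: test_boundaryD => //; apply/test_boundary_map/hA.
apply: (fi_inj (r := r.+1)).
by rewrite -test_d_map ea linearB t0 (test_boundary_cycle bw) subr0 linear0.
Qed.
End Ses.

(* For such M the comparison map K (x) M -> D (x) M is a quasi-isomorphism, once
   T is the mapping cone of K -> D. *)
Definition good M := acyclic E M /\ forall r, test_exact M r.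

Lemma good_ker A B C (i : {linear A -> B}) (p : {linear B -> C}) :
  ses i p -> good B -> good C -> good A.
Proof.
move=> hs [aB eB] [aC eC]; split; first exact: acyclic_ker hs aB aC.
exact: test_exact_ker hs aC eB eC.
Qed.

Lemma good_ext A B C (i : {linear A -> B}) (p : {linear B -> C}) :
  ses i p -> good A -> good C -> good B.
Proof.
move=> hs [aA eA] [aC eC]; split; first exact: acyclic_ext hs aA aC.
exact: test_exact_ext hs aC eA eC.
Qed.

Lemma good_coker A B C (i : {linear A -> B}) (p : {linear B -> C}) :
  ses i p -> acyclic E C -> good A -> good B -> good C.
Proof. by move=> hs aC [aA eA] [aB eB]; split=> //;
    exact: test_exact_coker hs aC eA eB. Qed.

Lemma good_prod A B : good A -> good B -> good (A * B)%type.
Proof. by move=> gA gB; apply: good_ext (ses_prod A B) gA gB. Qed.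

Hypothesis T_exact : forall r x, d r.+1 x = 0 -> exists y, d r y = x.

Lemma flat_good F : flat F -> good F.
Proof.
move=> Fflat; split; first exact: flat_acyclic.
move=> [|r]; first exact: test_exact0.
move=> t t0; apply/(flat_exact (f := d r) (g := d r.+1) Fflat) => // v.
by split=> [/T_exact|[u <-]].
Qed.

(** The cycle modules of F, together with G, are closed under the flat covers provided by F, and
    exactness of E (x) F makes E (x) - injective on the kernels; so all of them are acyclic.
    Exactness of the test complex on G then follows from that on Z_0 and F_0. *)
Lemma Gflat_good G : injective_module E -> Gflat G -> good G.
Proof.
move=> Einj [F [Fflat Fex [p pcok] FE]].
have sesF j : exists q : {linear F (j + 1) -> cyc F j}, _ := ses_cyc (Fex j).
have EF j : injective (tens_map (@idfun E)
    (@submod_val R _ _ (kernelP (cdiff F (j + 1) (j + 1 - 1))))).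
  (* If z dies in E (x) F_(j+1), its lift w one degree higher is a cycle of E (x) F, hence a
     boundary, and boundaries die under q. *)
  apply: linear_inj => z z0; have [q [[_ qcok] qE]] := sesF (j + 1).
  have [w wz] := (tens_rexact E qcok).1 z.
  have wE : tens_map (@idfun E) (cdiff F (j + 1 + 1) (j + 1)) w = 0.
    rewrite -z0 -wz /= (@tens_map_comp _ _ _ _ _ _ _ _ _ (@idfun E) _ _
      (cdiff F (j + 1 + 1) (j + 1))) //.
  have [y yw] : boundary (w : tensor_cpx E F (j + 1 + 1)).
    by apply: (FE _ Einj); apply/(cycle_at (X := tensor_cpx E F) _ erefl).
  rewrite -wz -yw /= (@tens_map_comp _ _ _ _ _ _ _ _ _ (@idfun E) _ _ (\0)) //.
    by rewrite tens_map_eq0r.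
  by move=> x; apply: submod_val_inj; rewrite qE cdiff_comp.
have step j : exists (q : {linear F (j + 1) -> cyc F j}), [/\
    ses (@submod_val R _ _ (kernelP (cdiff F (j + 1) (j + 1 - 1)))) q, flat (F (j + 1)) &
    injective (tens_map (@idfun E)
    (@submod_val R _ _ (kernelP (cdiff F (j + 1) (j + 1 - 1)))))].
  by have [q [hq _]] := sesF j; exists q.
have hsG : ses (@submod_val R _ _ (kernelP (cdiff F 0 (0 - 1)))) p.
  split; first exact: submod_val_inj.
  split=> [|v]; first exact: pcok.1.
  rewrite pcok.2; split=> [h|[u <-]]; last exact: (Fex 0 _ (submod_valP u)).
  apply: (@submod_lift R _ _ (kernelP (cdiff F 0 (0 - 1)))).
  by case: h => u <-; exact: cdiff_comp.
have EG : injective (tens_map (@idfun E) (@submod_val R _ _ (kernelP (cdiff F 0 (0 - 1))))).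
  exact: (EF (-1)).
pose Z M := (M = G) \/ exists j, M = cyc F j.
have acZ : forall M, Z M -> acyclic E M.
  apply: acyclic_resolution => M [->|[j ->]].
    exists (cyc F 0), (F 0), (submod_val (hS := kernelP _)), p; split=> //.
    by right; exists 0.
  have [q [h1 h2 h3]] := step j.
  exists (cyc F (j + 1)), (F (j + 1)), (submod_val (hS := kernelP _)), q; split=> //.
  by right; exists (j + 1).
have gF j : good (F j) by exact: flat_good.
have gZ j : good (cyc F j).
  split; first by apply: acZ; right; exists j.
  (* Position r + 1 for Z_j follows from position r for Z_(j-1), for all j simultaneously; F never
     ends on the right, but position 0 is trivial. *)
  move=> r; elim: r j => [|r ih] j; first exact: test_exact0.
  have [q [h1 _ _]] := step (j - 1); rewrite -{1}(subrK 1 j).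
  apply: (test_exact_ker_step h1); first by apply: acZ; right; exists (j - 1).
    exact: (gF _).2.
  exact: ih.
by apply: (good_coker hsG) => //; [apply: acZ; left | exact: gZ].
Qed.

(** * Finite resolutions by good modules *)

Inductive fin_good : nat -> lmodType R -> Prop :=
| FinGood0 (M : lmodType R) : good M -> fin_good 0 M
| FinGoodS b (A X M : lmodType R) (i : {linear A -> X}) (p : {linear X -> M}) :
    ses i p -> good X -> fin_good b A -> fin_good b.+1 M.

Lemma fin_good_prod (P : lmodType R) b A : good P -> fin_good b A ->
    fin_good b (P * A)%type.
Proof.
move=> gP; elim=> {b A} [A gA|b A X M i p [iinj [ps pk]] gX fA _].
  by apply: FinGood0; exact: good_prod.
apply: (@FinGoodS b A (P * X)%type _ (pairl \0 i)
   (pairl (copair (@idfun P) \0) (copair \0 p))) => //; last exact: good_prod.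
split=> [u v []|]; first exact: iinj.
split=> [[u v]|[u v]].
  by have [x <-] := ps v; exists (u, x); congr (_, _); [exact: addr0|exact: add0r].
rewrite [X in X = 0](_ : _ = (u, p v)); last first.
  by congr (_, _); [exact: addr0|exact: add0r].
split=> [[-> /pk[a <-]]|[a [<- <-]]]; first by exists a.
by congr (_, _); apply/pk; exists a.
Qed.

(** If Y covers W with kernel A, then the kernel of Y -> W -> X is the pullback of Y and N over W:
    it is good, and it covers N with the same kernel A. *)
Lemma fin_good_ker b (N W X : lmodType R) (i : {linear N -> W}) (p : {linear W -> X}) :
  ses i p -> fin_good b W -> good X -> fin_good b N.
Proof.
move=> hs fW gX; case: fW i p hs => {b W} [W gW|b A Y W a q hq gY fA] i p hs.
  by apply: FinGood0; exact: good_ker hs gW gX.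
pose pq : {linear Y -> X} := p \o q.
have pqs x : exists y, pq y = x.
  by have [w <-] := hs.2.1 x; have [y <-] := hq.2.1 w; exists y.
have hY := ses_ker pqs.
have [g gE] : exists g : {linear ker pq -> N}, forall u, i (g u) = (q \o submod_val (hS := kernelP pq)) u.
  by apply: (ses_lift hs) => u; exact: (submod_valP (hS := kernelP pq) u).
have [a' aE] : exists a' : {linear A -> ker pq}, forall u, submod_val (a' u) = a u.
  apply: (ses_lift hY) => u /=; have -> : q (a u) = 0 by apply/(hq.2.2); exists u.
  by rewrite linear0.
apply: (@FinGoodS b A (ker pq) N a' g) => //; last exact: good_ker hY gY gX.
split=> [u v e|]; first by apply: hq.1; rewrite -!aE e.
split=> [n|y].
  have [y ye] := hq.2.1 (i n).
  have [y' y'E] : exists u : ker pq, submod_val u = y.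
    apply: submod_lift; rewrite /kernel /= ye; apply/(hs.2.2); by exists n.
  by exists y'; apply: hs.1; rewrite gE /= y'E.
split=> [g0|[u <-]].
  have [u ue] : exists u, a u = submod_val y.
    by apply/(hq.2.2); rewrite -[LHS]gE g0 linear0.
  by exists u; apply: submod_val_inj; rewrite aE.
by apply: hs.1; rewrite gE linear0 /= aE; apply/(hq.2.2); exists u.
Qed.

(** A variant of Schanuel's lemma: lifting P -> M to f : P -> X yields 0 -> N -> P x A -> X -> 0,
    where A already has the shorter resolution. *)
Lemma fin_good_syzygy b (M N P : lmodType R) (j : {linear N -> P}) (q : {linear P -> M}) :
  ses j q -> projective P -> fin_good b.+1 M -> fin_good b N.
Proof.
move=> hj Pproj; move eb : b.+1 => b1 fM; case: fM eb q hj
    => // b' A X {}M i p hi gX fA [eb] q hj.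
rewrite -{}eb in fA.
have [f fE] := Pproj _ _ p q hi.2.1.
have jq n : q (j n) = 0 by apply/(hj.2.2); exists n.
have [g gE] : exists g : {linear N -> A}, forall u, i (g u) = (f \o j) u.
  by apply: (ses_lift hi) => u /=; rewrite fE.
apply: (@fin_good_ker b N (P * A)%type X (pairl j g) (copair f (\- i))) => //.
  split=> [u v [e _]|]; first exact: hj.1.
  split=> [x|[u a]].
    have [u ue] := hj.2.1 (p x).
    have [a ae] : exists a, i a = f u - x by apply/(hi.2.2); rewrite linearB fE ue subrr.
    by exists (u, a); rewrite -[LHS]/(f u - i a) ae subKr.
  rewrite -[X in X = 0]/(f u - i a); split=> [/eqP|[n [<- <-]]]; last by rewrite gE subrr.
  rewrite subr_eq0 => /eqP e.
  have [n ne] : exists n, j n = u.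
    by apply/(hj.2.2); rewrite -fE e; apply/(hi.2.2); exists a.
  exists n; congr (_, _); first exact: ne.
  by apply: hi.1; rewrite gE /= ne.
apply: fin_good_prod => //; apply: flat_good; exact: proj_flat.
Qed.

End TestComplex.

(** * The injective hull of the residue field *)

Section InjectiveExtension.
Variables (R : comNzRingType) (E : lmodType R).
Hypothesis E_inj : injective_module E.

(** The partial map is given by its graph, a submodule of V x E. Its projection to V is injective
    because 0 has no other value than 0, and the projection to E extends along it. *)
Lemma inj_ext (V : lmodType R) (G : V -> E -> Prop) : G 0 0 ->
  (forall a v e v' e', G v e -> G v' e' -> G (a *: v + v') (a *: e + e')) ->
  (forall e, G 0 e -> e = 0) ->
  exists h : {linear V -> E}, forall v e, G v e -> h v = e.
Proof.
move=> G00 Glin G0.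
have GZ a v e : G v e -> G (a *: v) (a *: e).
  by move=> h; have := Glin a _ _ _ _ h G00; rewrite !addr0.
have hS : submodule [set w : V * E | G w.1 w.2].
  split=> //= [[v e] [v' e']|a [v e]] /=; last exact: GZ.
  by move=> h h'; have := Glin 1 _ _ _ _ h h'; rewrite !scale1r.
have fl : linear (fun w : submod hS => (submod_val w).1) by move=> a u w; rewrite linearP.
have gl : linear (fun w : submod hS => (submod_val w).2) by move=> a u w; rewrite linearP.
have finj : injective (mklin fl).
  apply: linear_inj => /= w w1; apply: submod_val_inj; rewrite linear0.
  have := submod_valP w; case: (submod_val w) w1 => v e /= -> h.
  by rewrite (G0 e h).
have [h hE] := E_inj (mklin gl) finj.
by exists h => v e vGe; have := hE (in_subm hS (v := (v, e)) vGe).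
Qed.

End InjectiveExtension.

(** * Finite generation over a Noetherian ring *)

Section FiniteGeneration.
Variable R : comNzRingType.
Implicit Types V : lmodType R.

(** For submodules T of S this is finite generation of S / T, phrased without a quotient. *)
Definition fgen_mod V (S T : set V) := exists n (y : 'I_n -> V),
  (forall j, S (y j)) /\ forall v, S v -> exists a : 'I_n -> R, T (v - \sum_j a j *: y j).

Lemma submodule_sum V (S : set V) n (y : 'I_n -> V) (a : 'I_n -> R) : submodule S ->
  (forall j, S (y j)) -> S (\sum_j a j *: y j).
Proof.
by move=> [S0 SD SZ] h; apply: big_ind => // j _; exact: SZ.
Qed.

Lemma fgen_mod_trans V (S T U : set V) : submodule S -> T `<=` S ->
  fgen_mod S T -> fgen_mod T U -> fgen_mod S U.
Proof.
move=> hS TS [n [y [Sy hy]]] [l [z [Tz hz]]].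
exists (n + l)%N, (fun j => match fintype.split j with inl i => y i | inr i => z i end).
split=> [j|v Sv]; first by case: fintype.split => // i; exact: TS.
have [a /hz[b hb]] := hy v Sv.
exists (fun j => match fintype.split j with inl i => a i | inr i => b i end).
rewrite big_split_ord /= opprD addrA.
under eq_bigr do rewrite (unsplitK (inl _)).
by under [X in _ - X]eq_bigr do rewrite (unsplitK (inr _)).
Qed.

Lemma fgen_mod_refl V (S : set V) : fgen_mod S S.
Proof.
exists 0%N, (fun _ => 0); split=> [[]//|v Sv]; exists (fun _ => 0).
by rewrite big_ord0 subr0.
Qed.

Hypothesis noethR : noetherian R.

(** A relation rather than a function, since scalars b with e = b e0 are determined only modulo
    m. *)
Definition linear_rel V (G : V -> R -> Prop) := forall a v x v' x',
  G v x -> G v' x' -> G (a *: v + v') (a * x + x').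

(** The values of G on S form an ideal; elements of S taking a finite set of generators as values
    generate S modulo the part where 0 is a value. *)
Lemma fgen_rel V (S : set V) (G : V -> R -> Prop) : submodule S -> linear_rel G ->
  (forall v, S v -> exists x, G v x) -> fgen_mod S [set v | S v /\ G v 0].
Proof.
move=> hS Glin Gtot; have [S0 SD SZ] := hS.
have G00 : G 0 0.
  have [x h] := Gtot 0 S0; have := Glin (-1) _ _ _ _ h h.
  by rewrite scaler0 addr0 mulN1r addNr.
have [] := noethR (I := [set x | exists2 v, S v & G v x]).
  split; first by exists 0.
  - move=> x x' [v Sv h] [v' Sv' h']; exists (v + v'); first exact: SD.
    by have := Glin 1 _ _ _ _ h h'; rewrite scale1r mul1r.
  - move=> a x [v Sv h]; exists (a *: v); first exact: SZ.
    by have := Glin a _ _ _ _ h G00; rewrite !addr0.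
move=> n [x gx].
have xI j : exists v, S v /\ G v (x j).
  have [v Sv h] : [set x | exists2 v, S v & G v x] (x j); last by exists v.
  rewrite gx; exists (fun i => (i == j)%:R).
  rewrite (bigD1 j) //= eqxx mul1r big1 ?addr0 // => i /negbTE->.
  by rewrite mul0r.
have [y yP] := choice xI.
exists n, y; split=> [j|v Sv]; first exact: (yP j).1.
have [z vz] := Gtot v Sv.
have : [set x | exists2 v, S v & G v x] z by exists v.
rewrite gx => -[a az]; exists a; split.
  rewrite -scaleN1r addrC; apply: SD; last by []; apply: SZ.
  by apply: submodule_sum => // j; exact: (yP j).1.
have hs : G (\sum_j a j *: y j) (\sum_j a j * x j).
  elim: (index_enum _) => [|j r ih]; first by rewrite !big_nil.
  by rewrite !big_cons; apply: Glin => //; exact: (yP j).2.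
by have := Glin (-1) _ _ _ _ hs vz; rewrite scaleN1r mulN1r -az addNr addrC.
Qed.

Lemma fgen_rels V (S : set V) (I : eqType) (r : seq I) (G : I -> V -> R -> Prop) :
  submodule S -> (forall i, linear_rel (G i)) ->
  (forall i v, S v -> exists x, G i v x) ->
  submodule [set v | S v /\ forall i, i \in r -> G i v 0] /\
  fgen_mod S [set v | S v /\ forall i, i \in r -> G i v 0].
Proof.
move=> hS Glin Gtot; elim: r => [|i r [hr fr]].
  have -> : [set v | S v /\ forall i, i \in [::] -> G i v 0] = S.
    by apply/seteqP; split=> v //= [].
  by split=> //; exact: fgen_mod_refl.
set S' := [set v | S v /\ forall j, j \in r -> G j v 0] in hr fr.
have -> : [set v | S v /\ forall j, j \in i :: r -> G j v 0] = [set v | S' v /\ G i v 0].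
  apply/seteqP; split=> v /=.
    move=> [Sv h]; split; last by apply: h; rewrite inE eqxx.
    by split=> // j jr; apply: h; rewrite inE jr orbT.
  move=> [[Sv h] h0]; split=> // j; rewrite inE => /orP[/eqP-> //|]; exact: h.
have G00 : G i 0 0.
  have [Z0 _ _] := hS; have [x h] := Gtot i 0 Z0; have := Glin i (-1) _ _ _ _ h h.
  by rewrite scaler0 addr0 mulN1r addNr.
split.
  have [S0 SD SZ] := hr; split=> //= [v w [Sv v0] [Sw w0]|a v [Sv v0]].
    by split; [exact: SD | have := Glin i 1 _ _ _ _ v0 w0; rewrite scale1r mul1r addr0].
  by split; [exact: SZ | have := Glin i a _ _ _ _ v0 G00; rewrite !addr0 mulr0].
apply: fgen_mod_trans hS _ fr _; first by move=> v [].
by apply: fgen_rel => // v [Sv _]; exact: Gtot.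
Qed.

Lemma fgen_ffun (I : finType) (S : set {ffun I -> R^o}) : submodule S ->
  exists n (y : 'I_n -> {ffun I -> R^o}), (forall j, S (y j)) /\
    forall v, S v -> exists a : 'I_n -> R, v = \sum_j a j *: y j.
Proof.
move=> hS.
have [] := @fgen_rels _ S I (enum I) (fun i (v : {ffun I -> R^o}) x => v i = x) hS.
- by move=> i a v x v' x' <- <-; rewrite !ffunE.
- by move=> i v _; exists (v i).
move=> _ [n [y [Sy hy]]]; exists n, y; split=> // v /hy[a [_ h]]; exists a.
apply/eqP; rewrite -subr_eq0; apply/eqP/ffunP => i; rewrite [RHS]ffunE.
by apply: h; rewrite mem_enum.
Qed.

End FiniteGeneration.

Section InjectiveHull.
Variables (R : comNzRingType) (m : set R) (k E : lmodType R).
Hypotheses (noethR : noetherian R) (maxm : maximal_ideal m).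
Hypotheses (resk : residue_module m k) (hullE : injective_hull k E).

Lemma max_unit a : ~ m a -> exists b, m (1 - b * a).
Proof.
move=> na; have [[m0 mD mZ] n1 mm] := maxm; apply: contrapT => h.
pose J := [set x | exists b, m (x - b * a)].
have J0 x : m x -> J x by move=> mx; exists 0; rewrite mul0r subr0.
apply: na; have <- : J = m; last by exists 1; rewrite mul1r subrr.
apply: mm => [|[b hb]|x /J0 //]; last by apply: h; exists b.
split; first exact: J0.
- move=> x y [b hb] [c hc]; exists (b + c).
  by have := mD _ _ hb hc; rewrite mulrDl opprD addrACA.
- move=> c x [b hb]; exists (c * b).
  by have := mZ c _ hb; rewrite scalerBr -mulrA.
Qed.

(** e0 is the image of 1 under R -> k -> E. By essentiality, each nonzero element of E has a nonzero
    multiple in R e0; this is [meet], from which the other two claims follow. *)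
Lemma hull_socle : exists e0 : E, [/\ forall a, a *: e0 = 0 <-> m a,
  forall e : E, (forall a, m a -> a *: e = 0) -> exists b, e = b *: e0 &
  forall a (e : E), m a -> exists j, a ^+ j *: e = 0].
Proof.
have [[m0 mD mZ] n1 mm] := maxm.
have [pi [pis pik]] := resk; have [Einj [iota [iinj ess]]] := hullE.
pose e0 := iota (pi 1).
have iE a : iota (pi a) = a *: e0.
  by rewrite -{1}[a]mulr1 -[a * 1]/(a *: (1 : R^o)) !linearZ.
have e0P a : a *: e0 = 0 <-> m a.
  rewrite -iE -pik; split=> [/(linear_inj0 iinj) //|->]; exact: linear0.
have meet e : e <> 0 -> exists r b, r *: e <> 0 /\ r *: e = b *: e0.
  move=> ne; apply: contrapT => h; apply: ne.
  have : [set f | exists r, f = r *: e] e by exists 1; rewrite scale1r.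
  rewrite (ess [set f | exists r, f = r *: e]) //.
    split; first by exists 0; rewrite scale0r.
    - by move=> _ _ [r ->] [s ->]; exists (r + s); rewrite scalerDl.
    - by move=> a _ [r ->]; exists (a * r); rewrite scalerA.
  apply/seteqP; split=> [_ [[r ->] [c _ ce]] /=|_ ->]; last first.
    by split; [exists 0; rewrite scale0r | exists 0 => //; rewrite linear0].
  apply: contrapT => nz; apply: h; have [b bc] := pis c.
  by exists r, b; rewrite -iE bc ce.
exists e0; split=> // [e em|a e ma].
  have [->|/eqP /meet[r [b [re eb]]]] := eqVneq e 0; first by exists 0; rewrite scale0r.
  have /max_unit[s ms] : ~ m r by move=> /em.
  exists (s * b); rewrite -scalerA -eb scalerA.
  by apply/eqP; rewrite -subr_eq0 -{1}(scale1r e) -scalerBl em.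
(* The annihilators of the a^j e increase with j, so their finitely generated union I annihilates
   a^J e for some J. Were a^J e nonzero, some nonzero multiple r a^J e would lie in R e0; a kills
   it, so r is in I, a contradiction. *)
pose I := [set r | exists j, r *: (a ^+ j *: e) = 0].
have up j l r : r *: (a ^+ j *: e) = 0 -> r *: (a ^+ (l + j) *: e) = 0.
  by move=> h; rewrite exprD -scalerA scalerA mulrC -scalerA h scaler0.
have [] := noethR (I := I).
  split; first by exists 0%N; rewrite scale0r.
  - move=> r s [j hj] [l hl]; exists (l + j)%N; rewrite scalerDl up //.
    by rewrite addnC up // addr0.
  - by move=> c r [j hj]; exists j; rewrite -scalerA hj scaler0.
move=> n [x gx].
have xI i : exists j, x i *: (a ^+ j *: e) = 0.
  rewrite -[exists j, _]/(I (x i)) gx; exists (fun l => (l == i)%:R).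
  rewrite (bigD1 i) //= eqxx mul1r big1 ?addr0 // => l /negbTE->.
  by rewrite mul0r.
have [f fP] := choice xI.
pose J := (\sum_i f i)%N; exists J; apply: contrapT => /meet[r [b [nz rb]]].
apply: nz; have : I r.
  exists J.+1; rewrite exprS -scalerA scalerA mulrC -scalerA rb scalerA.
  by apply/e0P; rewrite mulrC; exact: mZ.
rewrite gx => -[c ->]; rewrite scaler_suml big1 // => i _; rewrite -scalerA.
by rewrite /J (bigD1 i) //= addnC up // scaler0.
Qed.

End InjectiveHull.

(** * The Koszul complex *)

Section DirectSums.
Variable R : comNzRingType.
Implicit Types (U V X Y : lmodType R).

Section Coordinates.
Variables (I : finType) (Y : lmodType R).
Definition ff_proj (i : I) (f : {ffun I -> Y}) : Y := f i.
Fact ff_proj_linear i : linear (ff_proj i).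
Proof. by move=> a f g; rewrite /ff_proj !ffunE. Qed.
HB.instance Definition _ i := GRing.isLinear.Build R {ffun I -> Y} Y *:%R
  (ff_proj i) (ff_proj_linear i).
Definition ff_inj (i : I) (y : Y) : {ffun I -> Y} := [ffun j => if j == i then y else 0].
Fact ff_inj_linear i : linear (ff_inj i).
Proof.
by move=> a f g; apply/ffunP => j; rewrite !ffunE; case: eqP => //; rewrite scaler0 addr0.
Qed.
HB.instance Definition _ i := GRing.isLinear.Build R Y {ffun I -> Y} *:%R
  (ff_inj i) (ff_inj_linear i).
Lemma ff_decomp (f : {ffun I -> Y}) : f = \sum_i ff_inj i (ff_proj i f).
Proof.
apply/ffunP => j; rewrite sum_ffunE (bigD1 j) //= ffunE eqxx big1 ?addr0 // => i ij.
by rewrite ffunE eq_sym (negbTE ij).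
Qed.
End Coordinates.

Lemma tens_ffun_inj (I : finType) Y U V (f : {linear U -> V}) :
  injective (tens_map (@idfun Y) f) -> injective (tens_map (@idfun {ffun I -> Y}) f).
Proof.
move=> finj; apply: linear_inj => t t0.
rewrite -[t](tens_map_id (f := @idfun _) (g := @idfun _)) //.
rewrite (@tens_map_suml _ _ _ _ _ I (index_enum I) _ (fun i => ff_inj i \o ff_proj i)).
  rewrite big1 // => i _.
  rewrite -(@tens_map_comp _ _ _ _ _ _ _ (ff_inj i) (ff_proj i) _ (@idfun U) (@idfun U)) //.
  suff -> : tens_map (ff_proj i) (@idfun U) t = 0 by rewrite linear0.
  apply: (linear_inj0 finj).
  rewrite /= (@tens_map_comp _ _ _ _ _ _ _ _ _ (ff_proj i) _ _ f) //.
  by rewrite -(@tens_map_comp _ _ _ _ _ _ _ (ff_proj i) (@idfun _) (ff_proj i) (@idfun V) f) // t0 linear0.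
by move=> u; rewrite -ff_decomp.
Qed.

Lemma pair_decomp X Y (w : X * Y) :
  w = (pairl (@idfun X) \0 \o fst) w + (pairl \0 (@idfun Y) \o snd) w.
Proof. by case: w => u v; congr (_, _); rewrite /= ?addr0 ?add0r. Qed.

Lemma tens_pair_inj X Y U V (f : {linear U -> V}) :
  injective (tens_map (@idfun X) f) -> injective (tens_map (@idfun Y) f) ->
  injective (tens_map (@idfun (X * Y)%type) f).
Proof.
move=> Xinj Yinj; apply: linear_inj => t t0.
rewrite -[t](tens_map_id (f := @idfun _) (g := @idfun _)) //.
rewrite (tens_mapDl (f1 := pairl (@idfun X) \0 \o fst) (f2 := pairl \0 (@idfun Y) \o snd)).
  rewrite -(@tens_map_comp _ _ _ _ _ _ _ (pairl (@idfun X) \0) fst _ (@idfun U) (@idfun U)) //.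
  rewrite -(@tens_map_comp _ _ _ _ _ _ _ (pairl \0 (@idfun Y)) snd _ (@idfun U) (@idfun U)) //.
  have -> : tens_map fst (@idfun U) t = 0.
    apply: (linear_inj0 Xinj).
    rewrite /= (@tens_map_comp _ _ _ _ _ _ _ _ _ fst _ _ f) //.
    by rewrite -(@tens_map_comp _ _ _ _ _ _ _ fst (@idfun _) fst (@idfun V) f)
        // t0 linear0.
  have -> : tens_map snd (@idfun U) t = 0.
    apply: (linear_inj0 Yinj).
    rewrite /= (@tens_map_comp _ _ _ _ _ _ _ _ _ snd _ _ f) //.
    by rewrite -(@tens_map_comp _ _ _ _ _ _ _ snd (@idfun _) snd (@idfun V) f)
        // t0 linear0.
  by rewrite !linear0 addr0.
exact: pair_decomp.
Qed.

Lemma regular_flat : flat (R^o : lmodType R).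
Proof.
apply: proj_flat => U V f g fs; have [u fu] := fs (g 1).
have hl : linear (fun a : R^o => a *: u) by move=> a b c; rewrite scalerDl scalerA.
exists (mklin hl) => a; rewrite linearZ fu -linearZ /=; congr (g _); exact: mulr1.
Qed.

Lemma ffun_flat (I : finType) : flat ({ffun I -> R^o} : lmodType R).
Proof. by move=> U V f finj; apply: tens_ffun_inj; exact: regular_flat. Qed.

Section TensorUnit.
Variable X : lmodType R.
Let b (v : X) (a : R^o) := a *: v.
Let bl a : linear (b^~ a).
Proof. by move=> c u v; rewrite /b scalerDr !scalerA mulrC. Qed.
Let br v : linear (b v).
Proof. by move=> c a a'; rewrite /b scalerDl scalerA. Qed.
Definition tens_unit : {linear tensor X R^o -> X} := mklin (tens_lift_linear bl br).
Lemma tens_unitE v a : tens_unit (tens v a) = a *: v.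
Proof. exact: (tens_lift_tens bl br). Qed.
Lemma tens_unitK t : tens (tens_unit t) (1 : R^o) = t.
Proof.
move: t; apply: tensor_elim => [|v a|s t hs ht].
- by rewrite linear0 tens0l.
- by rewrite tens_unitE tensZl -tensZr; congr tens; exact: mulr1.
- by rewrite linearD tensDl hs ht.
Qed.
End TensorUnit.

Lemma tens_unit_map X Y (f : {linear X -> Y}) t :
  tens_unit Y (tens_map f (@idfun _) t) = f (tens_unit X t).
Proof.
rewrite -[LHS]/((tens_unit Y \o tens_map f (@idfun R^o)) t) -[RHS]/((f \o tens_unit X) t).
by move: t; apply: tensor_ext => u v; rewrite /= tens_mapE !tens_unitE linearZ.
Qed.

Lemma homology_unit (X : complex R) i :
  homology_trivial (cpx_tensor X (R^o : lmodType R)) i <-> homology_trivial X i.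
Proof.
split=> h t.
  move=> tc; have [|s es] := h (tens t (1 : R^o)).
    by rewrite /cycle /= tens_mapE tc tens0l.
  exists (tens_unit _ s); rewrite -tens_unit_map -[tens_map _ _ _]/(cdiff (cpx_tensor X R^o) _ _ s).
  by rewrite es tens_unitE scale1r.
move=> tc; have [|s es] := h (tens_unit _ t).
  by rewrite /cycle -tens_unit_map -[tens_map _ _ _]/(cdiff (cpx_tensor X R^o) _ _ t) tc linear0.
by exists (tens s (1 : R^o)); rewrite /= tens_mapE es tens_unitK.
Qed.

End DirectSums.

(** * Homotopies and functionals on the Koszul complex *)

Section KoszulTheory.
Variables (R : comNzRingType) (n : nat) (x : 'I_n -> R).
Local Notation K := (koszul x).

(** Exterior multiplication by e_i, a homotopy from multiplication by x_i to 0. *)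
Definition koszul_htp (i : 'I_n) (g : {set 'I_n} -> R) (S : {set 'I_n}) : R :=
  if i \in S then koszul_sign R i (S :\ i) * g (S :\ i) else 0.

Lemma koszul_sign_sqr i (T : {set 'I_n}) : koszul_sign R i T * koszul_sign R i T = 1.
Proof. by rewrite /koszul_sign -expr2 sqrr_sign. Qed.

Lemma koszul_sign_swap (T : {set 'I_n}) (i j : 'I_n) : i \notin T -> j \notin T -> i != j ->
  koszul_sign R j (i |: T) * koszul_sign R i (j |: T) =
  - (koszul_sign R i T * koszul_sign R j T).
Proof.
move=> iT jT ij; wlog lij : i j iT jT ij / (i < j)%N.
  move=> h; case: (ltngtP i j) => [|lji|/val_inj e]; first exact: h.
    by rewrite mulrC h // 1?eq_sym // mulrC.
  by rewrite e eqxx in ij.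
have e := koszul_signC R iT jT lij.
have -> : koszul_sign R j (i |: T) =
    - (koszul_sign R i T * (koszul_sign R j T * koszul_sign R i (j |: T))).
  by rewrite -mulrN -e mulrA koszul_sign_sqr mul1r.
rewrite mulNr; congr (- _); rewrite -!mulrA koszul_sign_sqr mulr1 //.
Qed.

(** If i is in T, the terms with j different from i cancel by [koszul_sign_swap] and the diagonal
    term remains; otherwise only j = i contributes. *)
Lemma koszul_htpE i g (T : {set 'I_n}) :
  koszul_sum x (koszul_htp i g) T + koszul_htp i (koszul_sum x g) T = x i * g T.
Proof.
rewrite /koszul_htp; case: ifP => iT.
  pose T' := T :\ i; have iT' : i \notin T' by rewrite !inE eqxx.
  have eT : T = i |: T' by rewrite finset.setD1K.
  rewrite -/T' {2}/koszul_sum (bigD1 i) //= mulrDr -eT.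
  have -> : koszul_sign R i T' * (koszul_sign R i T' * x i * g T) = x i * g T.
    by rewrite !mulrA koszul_sign_sqr mul1r.
  rewrite addrCA -[RHS]addr0; congr (_ + _); rewrite mulr_sumr /koszul_sum.
  rewrite (eq_bigl (fun j => (j \notin T') && (j != i))); last first.
    by move=> j; rewrite eT !inE negb_or andbC; case: eqP.
  rewrite -big_split big1 // => j /andP[jT' ji] /=.
  have -> : (i \in j |: T) by rewrite !inE iT orbT.
  have -> : (j |: T) :\ i = j |: T'.
    apply/setP => l; rewrite !inE; case: eqP => [->|] /=; last by case: (l == j).
    by rewrite eq_sym (negbTE ji).
  have := koszul_sign_swap iT' jT' (_ : i != j); rewrite eq_sym => /(_ ji).
  rewrite -eT => e.
  move: (koszul_sign R j T) (koszul_sign R i (j |: T')) (koszul_sign R i T')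
    (koszul_sign R j T') e => s1 s2 s3 s4 e.
  by ring: e.
rewrite addr0 /koszul_sum (bigD1 i) ?iT //= big1 ?addr0 => [|j /andP[jT ji]].
  have -> : (i |: T) :\ i = T by rewrite setU1K ?iT.
  rewrite setU11 -[RHS]mul1r -(koszul_sign_sqr i T); ring.
by rewrite !inE iT orbF eq_sym (negbTE ji) mulr0.
Qed.

Lemma koszul_coef_val p (f : K p) (S : koszul_index n p) : koszul_coef f (val S) = f S.
Proof. by rewrite /koszul_coef valK. Qed.

Lemma koszul_kill (i : 'I_n) (p q : int) (f : K p) : q = p + 1 -> cycle f ->
  exists g : K q, cdiff K q p g = x i *: f.
Proof.
move=> qp fc; pose g : K q := [ffun S : koszul_index n q => koszul_htp i (koszul_coef f) (val S)].
exists g; apply/ffunP => -[T Tp]; rewrite !ffunE /=; have /eqP Tc := Tp.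
have <- : koszul_coef f T = f (exist _ T Tp).
  by rewrite -(koszul_coef_val f (exist _ T Tp)).
rewrite -[RHS]koszul_htpE.
have -> : koszul_htp i (koszul_sum x (koszul_coef f)) T = 0.
  rewrite /koszul_htp; case: ifP => // iT.
  rewrite -(@koszul_coef_in _ _ x p (p - 1)) /koszul_coef.
    by rewrite -[koszul_diff _ _ _]/(cdiff K p (p - 1) f) fc; case: insubP => [s _ _|_];
        rewrite ?ffunE mulr0.
  by rewrite -Tc (cardsD1 i T) iT add1n intS addrC addKr.
rewrite addr0 /koszul_sum; apply: eq_bigr => j jT; congr (_ * _).
rewrite {1}/koszul_coef; case: insubP => [s _ sE|]; first by rewrite ffunE sE.
have -> : #|j |: T| = #|T|.+1 by rewrite cardsU1 jT.
by rewrite intS Tc qp addrC eqxx.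
Qed.

Lemma koszul_empty p (f g : K p) : (p < 0 \/ n%:Z < p) -> f = g.
Proof.
move=> h; apply/ffunP => -[S Sp]; exfalso; have := max_card (mem S); rewrite card_ord.
by case: h; rewrite -(eqP Sp) // ltz_nat ltnNge => /negPf ->.
Qed.

Lemma koszul_kill_ideal (m : set R) a (p q : int) (f : K p) : generates x m -> m a ->
  q = p + 1 -> cycle f -> exists g : K q, cdiff K q p g = a *: f.
Proof.
move=> -> [b ->] qp fc.
have [h hP] := choice (fun i => koszul_kill i qp fc).
exists (\sum_i b i *: h i); rewrite linear_sum scaler_suml; apply: eq_bigr => i _.
by rewrite linearZ hP; exact: scalerA.
Qed.

(** Boundaries in degree 0 lie in the ideal generated by x, which does not contain 1. *)
Lemma koszul_H0 (m : set R) : generates x m -> ~ m 1 -> ~ homology_trivial K 0.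
Proof.
move=> gx n1 h; have S0 : #|(finset.set0 : {set 'I_n})|%:Z == 0 by rewrite cards0.
have [|g gE] := h [ffun=> 1].
  exact: koszul_empty (or_introl _ _).
apply: n1; rewrite gx; exists (fun i => koszul_coef g (i |: finset.set0)).
have := congr1 (fun f : K 0 => f (exist _ finset.set0 S0)) gE; rewrite !ffunE => <- /=.
rewrite /koszul_sum; apply: eq_big => [i|i _]; first by rewrite finset.in_set0.
rewrite /koszul_sign.
rewrite eq_card0 => [|j]; first by rewrite expr0 mul1r mulrC.
by rewrite !inE.
Qed.

Section Evaluation.
Variables (E : lmodType R) (p : int).

(** phi is indexed by all subsets, whatever p is, so that the type of functionals, and with it
    [stage], does not depend on a degree. *)
Definition koszul_ev (phi : {ffun {set 'I_n} -> E}) (f : K p) : E :=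
  \sum_(S : koszul_index n p) f S *: phi (val S).

Fact koszul_ev_linear phi : linear (koszul_ev phi).
Proof.
move=> a f g; rewrite /koszul_ev scaler_sumr -big_split; apply: eq_bigr => S _.
by rewrite !ffunE /= scalerDl scalerA.
Qed.
HB.instance Definition _ phi := GRing.isLinear.Build R (K p) E *:%R
  (koszul_ev phi) (koszul_ev_linear phi).

Lemma koszul_evP a phi psi f :
  koszul_ev (a *: phi + psi) f = a *: koszul_ev phi f + koszul_ev psi f.
Proof.
rewrite /koszul_ev scaler_sumr -big_split; apply: eq_bigr => S _.
by rewrite !ffunE scalerDr !scalerA mulrC.
Qed.

Lemma koszul_ev_surj (h : {linear K p -> E}) : exists phi, forall f, koszul_ev phi f = h f.
Proof.
pose phi : {ffun {set 'I_n} -> E} := [ffun T => if insub T is Some s then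
   h (ff_inj s (1 : R^o)) else 0].
exists phi => f; rewrite [f in RHS]ff_decomp linear_sum; apply: eq_bigr => S _.
rewrite /phi ffunE valK -linearZ; congr (h _); apply/ffunP => T.
by rewrite !ffunE /=; case: eqP => _; rewrite ?scaler0 //; exact: mulr1.
Qed.

End Evaluation.
End KoszulTheory.

(** * Matrices over R acting on powers of E *)

Section Dot.
Variables (R : comNzRingType) (E : lmodType R).

(** The pairing that identifies E^c with Hom(R^c, E); under it [colmul] is the dual of [rowmul]. *)
Definition dot c (p : {ffun 'I_c -> R^o}) (y : {ffun 'I_c -> E}) : E :=
  \sum_l p l *: y l.

Lemma dotPl c a p q (y : {ffun 'I_c -> E}) : dot (a *: p + q) y = a *: dot p y + dot q y.
Proof.
rewrite /dot scaler_sumr -big_split; apply: eq_bigr => l _.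
by rewrite !ffunE scalerDl scalerA.
Qed.

Lemma dotPr c a p (y z : {ffun 'I_c -> E}) : dot p (a *: y + z) = a *: dot p y + dot p z.
Proof.
rewrite /dot scaler_sumr -big_split; apply: eq_bigr => l _.
by rewrite !ffunE scalerDr !scalerA mulrC.
Qed.

Lemma dot0l c (y : {ffun 'I_c -> E}) : dot 0 y = 0.
Proof. by rewrite /dot big1 // => l _; rewrite ffunE scale0r. Qed.

Lemma dot0r c (p : {ffun 'I_c -> R^o}) : dot p (0 : {ffun 'I_c -> E}) = 0.
Proof. by rewrite /dot big1 // => l _; rewrite ffunE scaler0. Qed.

Lemma dot_ff_inj c l (y : {ffun 'I_c -> E}) : dot (ff_inj l (1 : R^o)) y = y l.
Proof.
rewrite /dot (bigD1 l) //= ffunE eqxx scale1r big1 ?addr0 // => j /negbTE jl.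
by rewrite ffunE jl scale0r.
Qed.

(* The rows of a c' x c matrix over R. *)
Variables (c c' : nat) (delta : 'I_c' -> {ffun 'I_c -> R^o}).
Definition rowmul (q : {ffun 'I_c' -> R^o}) : {ffun 'I_c -> R^o} := \sum_j q j *: delta j.
Definition colmul (y : {ffun 'I_c -> E}) : {ffun 'I_c' -> E} := [ffun j => dot (delta j) y].

Lemma rowmulP a p q : rowmul (a *: p + q) = a *: rowmul p + rowmul q.
Proof.
rewrite /rowmul scaler_sumr -big_split; apply: eq_bigr => j _.
by rewrite !ffunE scalerDl scalerA.
Qed.

Lemma rowmul0 : rowmul 0 = 0.
Proof. by rewrite /rowmul big1 // => j _; rewrite ffunE scale0r. Qed.

Lemma dot_colmul q y : dot q (colmul y) = dot (rowmul q) y.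
Proof.
rewrite /rowmul /dot; transitivity (\sum_j \sum_l (q j * delta j l) *: y l).
  apply: eq_bigr => j _; rewrite ffunE scaler_sumr; apply: eq_bigr => l _.
  by rewrite scalerA.
rewrite exchange_big; apply: eq_bigr => l _; rewrite -scaler_suml; congr (_ *: _).
by rewrite sum_ffunE; apply: eq_bigr => j _; rewrite ffunE.
Qed.

Lemma colmul_linear : linear colmul.
Proof. by move=> a y z; apply/ffunP => j; rewrite !ffunE dotPr. Qed.
HB.instance Definition _ := GRing.isLinear.Build R {ffun 'I_c -> E} {ffun 'I_c' -> E}
  *:%R colmul colmul_linear.
End Dot.

(** * An injective model of the Koszul complex *)

Section Construction.
Variables (R : comNzRingType) (m : set R) (E : lmodType R) (e0 : E).
Hypotheses (noethR : noetherian R) (maxm : maximal_ideal m) (Einj : injective_module E).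
Hypothesis e0P : forall a, a *: e0 = 0 <-> m a.
Hypothesis socE : forall e : E, (forall a, m a -> a *: e = 0) -> exists b, e = b *: e0.
Variables (n : nat) (x : 'I_n -> R).
Hypothesis genx : generates x m.
Local Notation K := (koszul x).

(* Degrees run downwards from n + 2, where K vanishes. *)
Definition deg (r : nat) : int := n%:Z + 2 - r%:Z.
Lemma degS r : deg r = deg r.+1 + 1.
Proof. by rewrite /deg intS; ring. Qed.

Definition dK r : {linear K (deg r) -> K (deg r.+1)} := cdiff K (deg r) (deg r.+1).

(* [rels] are the relations satisfied by the generators of the previous stage,
   which the next stage has to resolve. *)
Record stage := Stage {
  rk : nat;
  gen : 'I_rk -> {ffun {set 'I_n} -> E};
  rels : {ffun 'I_rk -> R^o} -> Prop }.

Definition alpha p (st : stage) (f : K p) : {ffun 'I_(rk st) -> E} :=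
  [ffun l => koszul_ev (@gen st l) f].
Fact alpha_linear p st : linear (@alpha p st).
Proof. by move=> a f g; apply/ffunP => l; rewrite !ffunE linearP. Qed.
HB.instance Definition _ p st := GRing.isLinear.Build R (K p) {ffun 'I_(rk st) -> E}
  *:%R (@alpha p st) (@alpha_linear p st).


Lemma boundary_dK r (f : K (deg r.+1)) : boundary f <-> exists g, dK r g = f.
Proof. exact: (boundary_at f (degS r)). Qed.

Lemma cycle_dK r (f : K (deg r)) : cycle f <-> dK r f = 0.
Proof. exact: (cycle_at f (degS r)). Qed.

Lemma dK_comp r f : dK r.+1 (dK r f) = 0.
Proof. exact: cdiff_comp. Qed.

(** For a relation q, the functional q . gen is a cocycle in degree [deg r]. The incoming degree i
    is arbitrary because no index precedes [deg 0]; only i = deg r + 1 has content. *)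
Definition stage_inv r st := submodule (@rels st) /\
  forall q, rels q -> forall i (f : K i), dot q (alpha st (cdiff K i (deg r) f)) = 0.

(* One step in the construction of a resolution of Hom(K, E) by free modules of
   finite rank: the pairs (phi, p) considered are the cycles of its mapping cone,
   and the rows of delta, with the functionals of st', generate them modulo the
   boundaries chi o d. *)
Definition stage_step r st st' (delta : 'I_(rk st') -> {ffun 'I_(rk st) -> R^o}) :=
  [/\ forall j, rels (delta j),
      forall f : K (deg r), alpha st' (dK r f) = colmul delta (alpha st f),
      forall (phi : {linear K (deg r.+1) -> E}) p, rels p ->
        (forall f, phi (dK r f) = dot p (alpha st f)) ->
        exists q (chi : {linear K (deg r.+2) -> E}), p = rowmul delta q /\
          forall f, phi f = dot q (alpha st' f) + chi (dK r.+1 f),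
      forall q, rels q <-> rowmul delta q = 0
    & rk st = 0%N -> homology_trivial K (deg r.+1) -> rk st' = 0%N].

Lemma vanish_factor r (phi : {linear K (deg r) -> E}) :
  (forall f, dK r f = 0 -> phi f = 0) ->
  exists chi : {linear K (deg r.+1) -> E}, forall f, phi f = chi (dK r f).
Proof.
move=> h; have [||e [f [/esym /h -> ->]] //|chi chiE] := inj_ext Einj
    (G := fun v e => exists f, v = dK r f /\ e = phi f).
- by exists 0; rewrite !linear0.
- by move=> a _ _ _ _ [f [-> ->]] [g [-> ->]]; exists (a *: f + g); rewrite !linearP.
- by exists chi => f; apply/esym/chiE; exists f.
Qed.

Lemma cycles_fgen r : exists g (z : 'I_g -> K (deg r)), (forall j, dK r (z j) = 0) /\
  forall f, dK r f = 0 -> exists a : 'I_g -> R, f = \sum_j a j *: z j.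
Proof.
have [|g [z [h1 h2]]] := @fgen_ffun R noethR _ [set f : K (deg r) | dK r f = 0].
  exact: (kernelP (dK r)).
by exists g, z.
Qed.

(** m f consists of boundaries, on which phi vanishes; so m kills phi f. *)
Lemma cocycle_socle r (phi : {linear K (deg r.+1) -> E}) f :
  (forall g, phi (dK r g) = 0) -> dK r.+1 f = 0 -> exists b, phi f = b *: e0.
Proof.
move=> h fc; apply: socE => a ma; rewrite -linearZ.
have /cycle_dK fc' := fc.
by have [g <-] := koszul_kill_ideal genx ma (degS r) fc'; exact: h.
Qed.

Lemma stage_next r st : stage_inv r st ->
  exists st' delta, @stage_step r st st' delta /\ stage_inv r.+1 st'.
Proof.
move=> [relS relB].
(* Taking the zero stage whenever possible is what makes D vanish above degree s. *)
have [[c0 H0]|nc] := pselect (rk st = 0%N /\ homology_trivial K (deg r.+1)).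
  exists (@Stage 0 (fun _ => 0) (fun _ => True)), (fun _ => 0); split; last first.
    by split=> // q _ i f; rewrite /dot big_ord0.
  split=> //.
  - by case.
  - by move=> f; apply/ffunP => -[].
  - move=> phi p _ h; have p0 q : q = 0 :> {ffun 'I_(rk st) -> R^o}.
      by apply/ffunP => -[l hl]; exfalso; rewrite c0 in hl.
    have [|chi chiE] := @vanish_factor r.+1 phi.
      by move=> f /cycle_dK /H0 /boundary_dK[g <-]; rewrite h (p0 p) dot0l.
    exists 0, chi; split=> [|f]; first by rewrite (p0 p) (p0 (rowmul _ _)).
    by rewrite dot0l add0r.
  - by move=> q; split=> // _; rewrite /rowmul big_ord0.
pose V := ({ffun {set 'I_n} -> E} * {ffun 'I_(rk st) -> R^o})%type.
pose ev (v : V) : K (deg r.+1) -> E := koszul_ev v.1.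
pose S := [set v : V | rels v.2 /\ forall f, ev v (dK r f) = dot v.2 (alpha st f)].
have evP a v w f : ev (a *: v + w) f = a *: ev v f + ev w f by exact: koszul_evP.
have ev0 f : ev 0 f = 0.
  by rewrite /ev /koszul_ev big1 // => T _; rewrite ffunE scaler0.
have S0 : S 0 by split=> [|f /=]; [case: relS|rewrite ev0 dot0l].
have SP a v w : S v -> S w -> S (a *: v + w).
  move=> [v1 v2] [w1 w2]; split=> [|f]; last by rewrite evP v2 w2 [_.2]/= dotPl.
  by case: relS => _ D Z; apply: D w1; exact: Z.
have hS : submodule S.
  split=> // [v w hv hw|a v hv]; last by rewrite -[_ *: _]addr0; exact: SP.
  by rewrite -[v]scale1r; exact: SP.
(* S1 will consist of the pairs in S with second component 0; S / S1 embeds in a finite power of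
   R. *)
have [||hS1] := @fgen_rels R noethR V S _ (enum 'I_(rk st)) (fun l v a => v.2 l = a) hS.
- by move=> l a v _ w _ <- <-; rewrite !ffunE.
- by move=> l v _; exists (v.2 l).
set S1 := [set v | S v /\ _] in hS1 * => fS1.
have [g [z [zc zg]]] := cycles_fgen r.+1.
have S1E v : S1 v -> v.2 = 0.
  by move=> [_ h]; apply/ffunP => l; rewrite [RHS]ffunE; apply: h; rewrite mem_enum.
have ev_soc v f : S1 v -> dK r.+1 f = 0 -> exists b, ev v f = b *: e0.
  move=> v1; apply: (@cocycle_socle r (koszul_ev v.1)) => f'.
  by have [[_ h] _] := v1; rewrite -[LHS]/(ev v (dK r f')) h S1E // dot0l.
(* The pairs in S1 are cocycles, with values in R e0 on the generating cycles z_j, so S1 modulo S2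
   is finitely generated even if S1 is not. Those in S2 vanish on all cycles and are therefore
   coboundaries chi o d. *)
have [||hS2] := @fgen_rels R noethR V S1 _ (enum 'I_g) (fun j v a => ev v (z j) = a *: e0) hS1.
- by move=> j a v b w b' hb hb'; rewrite evP hb hb' scalerDl scalerA.
- by move=> j v v1; exact: ev_soc.
set S2 := [set v | S1 v /\ _] in hS2 * => fS2.
have [l [y [Sy yg]]] : fgen_mod S S2 by apply: fgen_mod_trans fS1 fS2 => // v [].
pose st' := @Stage l (fun j => (y j).1) (fun q => rowmul (fun j => (y j).2) q = 0).
have al' j (f : K (deg r.+1)) : alpha st' f j = ev (y j) f by rewrite ffunE.
have stepA (f : K (deg r)) : alpha st' (dK r f) = colmul (fun j => (y j).2) (alpha st f).
  by apply/ffunP => j; rewrite al' (Sy j).2 ffunE.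
exists st', (fun j => (y j).2); split; [split|split].
- by move=> j; exact: (Sy j).1.
- exact: stepA.
- move=> phi p relp h; have [ph phE] := koszul_ev_surj phi.
  have [|q hq] := yg (ph, p); first (split=> [//|f]; by rewrite [ev _ _]phE h).
  have [q1 q2] := hq; have := S1E _ q1; rewrite /= => e2.
  have sum2 : (\sum_j q j *: y j).2 = rowmul (fun j => (y j).2) [ffun j => q j].
    rewrite /rowmul -[LHS]/(snd _) linear_sum; apply: eq_bigr => j _.
    by rewrite ffunE.
  have sum1 f : ev (\sum_j q j *: y j) f = dot [ffun j => q j] (alpha st' f).
    rewrite /dot; elim: (index_enum _) => [|j s ih]; first by rewrite !big_nil ev0.
    by rewrite !big_cons evP ih al' ffunE.
  pose w : V := (ph, p) - \sum_j q j *: y j.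
  have [|chi chiE] := @vanish_factor r.+1 (koszul_ev w.1).
    move=> f /zg[a ->]; rewrite linear_sum big1 // => j _.
    have e : koszul_ev w.1 (z j) = 0.
      by rewrite -[LHS]/(ev w (z j)) q2 ?mem_enum // scale0r.
    by rewrite linearZ /= e; exact: scaler0.
  exists [ffun j => q j], chi; split.
    by apply/eqP; rewrite -subr_eq0 -sum2; apply/eqP.
  move=> f; rewrite -chiE -[X in _ + X]/(ev w f) -sum1 -phE.
  have := evP (-1) (\sum_j q j *: y j) (ph, p) f.
  by rewrite !scaleN1r addrC -/w => ->; rewrite addrA subrr add0r.
- by [].
- by move=> c0 H0; case: nc.
- split=> /= [|q q' e e'|a q e]; first exact: rowmul0.
    by have := rowmulP (fun j => (y j).2) 1 q q'; rewrite !scale1r e e' addr0.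
  have := rowmulP (fun j => (y j).2) a q 0.
  by rewrite rowmul0 !addr0 e scaler0.
move=> q q0 i f; have {}q0 : rowmul (fun j => (y j).2) q = 0 := q0.
have [e|ne] := eqVneq i (deg r.+1 + 1); last by rewrite cdiff_shape // linear0 dot0r.
move: f; rewrite e -degS => f; rewrite -[cdiff _ _ _]/(dK r) stepA dot_colmul q0.
exact: dot0l.
Qed.

Lemma stages_exist : exists (st : nat -> stage)
    (delta : forall r, 'I_(rk (st r.+1)) -> {ffun 'I_(rk (st r)) -> R^o}),
  rk (st 0%N) = 0%N /\
  forall r, stage_step r (delta r) /\ stage_inv r (st r).
Proof.
pose s0 := @Stage 0 (fun _ => 0) (fun _ => True).
have inv0 : stage_inv 0 s0 by split=> // q _ i f; rewrite /dot big_ord0.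
(* The invariant is kept inside the implication so that choice yields a total function, with the
   default [s0]. The matrix is extracted later, since its type involves two consecutive stages. *)
have /choice[f fP] : forall w : nat * stage, exists s, stage_inv w.1 w.2 ->
    exists delta, @stage_step w.1 w.2 s delta /\ stage_inv w.1.+1 s.
  move=> [r s] /=.
  have [/stage_next[st' [delta h]]|nh] := pselect (stage_inv r s); last by exists s0.
  by exists st' => _; exists delta.
pose st := fix st r := if r is r'.+1 then f (r', st r') else s0.
have inv r : stage_inv r (st r).
  by elim: r => // r ih; have [delta []] := fP (r, st r) ih.
have hd r : exists delta, @stage_step r (st r) (st r.+1) delta.
  by have [delta []] := fP (r, st r) (inv r); exists delta.
by exists st, (fun r => sval (cid (hd r))); split=> // r; split=> //; case: cid.
Qed.

End Construction.

(** * Exactness of the mapping cone *)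

Section TestComplexOf.
Variables (R : comNzRingType) (m : set R) (E : lmodType R) (e0 : E).
Hypotheses (noethR : noetherian R) (maxm : maximal_ideal m) (Einj : injective_module E).
Hypothesis e0P : forall a, a *: e0 = 0 <-> m a.
Hypothesis socE : forall e : E, (forall a, m a -> a *: e = 0) -> exists b, e = b *: e0.
Variables (n : nat) (x : 'I_n -> R).
Hypothesis genx : generates x m.
Local Notation K := (koszul x).
Local Notation deg := (deg n).
Local Notation dK := (dK x).
Variables (st : nat -> stage E n)
  (delta : forall r, 'I_(rk (st r.+1)) -> {ffun 'I_(rk (st r)) -> R^o}).
Hypothesis st0 : rk (st 0%N) = 0%N.
Hypothesis stS : forall r, stage_step x r (@delta r).
Hypothesis stI : forall r, stage_inv x r (st r).

(* The mapping cone of K -> D, where D is the complex with E^(rk (st r)) in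
   degree [deg r] and differentials [colmul (delta r)]. *)
Definition theta r : lmodType R := (K (deg r.+1) * {ffun 'I_(rk (st r)) -> E})%type.

Definition theta_d r : {linear theta r -> theta r.+1} :=
  pairl (dK r.+1 \o fst)
    (copair (@alpha R E n x (deg r.+1) (st r.+1)) (\- colmul (@delta r))).

Lemma theta_dE r f y :
  theta_d r (f, y) = (dK r.+1 f, alpha (st r.+1) f - colmul (@delta r) y).
Proof. by []. Qed.

Lemma colmul_comp r (y : {ffun 'I_(rk (st r)) -> E}) :
  colmul (@delta r.+1) (colmul (@delta r) y) = 0.
Proof.
apply/ffunP => j; rewrite !ffunE dot_colmul.
have [h1 _ _ _ _] := stS r.+1; have [_ _ _ h4 _] := stS r.
by have -> : rowmul (@delta r) (@delta r.+1 j) = 0; [apply/h4 | exact: dot0l].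
Qed.

Lemma theta_dd r w : theta_d r.+1 (theta_d r w) = 0.
Proof.
case: w => f y; rewrite !theta_dE dK_comp; have [_ h2 _ _ _] := stS r.+1.
by rewrite h2 linearB /= colmul_comp subr0 subrr.
Qed.

Lemma theta0 : trivial_module (theta 0).
Proof.
move=> [f y]; congr (_, _).
  by apply: koszul_empty; right; rewrite /deg; lia.
by apply/ffunP => -[l hl]; exfalso; rewrite st0 in hl.
Qed.

Lemma theta_inj r (A B C : lmodType R) (i : {linear A -> B}) (p : {linear B -> C}) :
  ses i p -> acyclic E C -> injective (tens_map (@idfun (theta r)) i).
Proof.
move=> hs aC; apply: tens_pair_inj; first by apply: ffun_flat; exact: hs.1.
by apply: tens_ffun_inj; exact: acyclic_injE hs aC.
Qed.

(** The map b f + dg -> b e0 is well defined: if b f is a boundary with b outside m, then b is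
    invertible modulo m, m f consists of boundaries, and f would be a boundary. Injectivity of E
    extends it. *)
Lemma koszul_detect r f : dK r.+1 f = 0 -> ~ (exists g, dK r g = f) ->
  exists2 psi : {linear K (deg r.+1) -> E}, (forall g, psi (dK r g) = 0) & psi f <> 0.
Proof.
move=> fc nb.
have kill a : m a -> exists g, dK r g = a *: f.
  by move=> ma; apply: (koszul_kill_ideal genx ma (degS n r)); apply/cycle_dK.
have e0n0 : e0 <> 0.
  by move=> h; have [_ n1 _] := maxm; apply: n1; apply/e0P; rewrite scale1r.
have [||e [b [g [/esym h ->]]]|psi psiE] := inj_ext Einj
    (G := fun v e => exists b g, v = b *: f + dK r g /\ e = b *: e0).
- by exists 0, 0; rewrite !scale0r linear0 addr0.
- move=> a _ _ _ _ [b [g [-> ->]]] [b' [g' [-> ->]]].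
  exists (a * b + b'), (a *: g + g'); rewrite !scalerDl !scalerA linearP.
  by rewrite scalerDr scalerA addrACA.
- apply/e0P; apply: contrapT => /(max_unit maxm)[s /kill[g' g'E]]; apply: nb.
  exists (g' - s *: g); rewrite linearB linearZ g'E scalerBl scale1r -scalerA /=.
  have -> : dK r g = - (b *: f) by apply/eqP; rewrite -addr_eq0 addrC h.
  by rewrite scalerN opprK subrK.
- exists psi => [g|]; first by apply: psiE; exists 0, g; rewrite !scale0r add0r.
  rewrite (psiE f e0) //; exists 1, 0; by rewrite !scale1r linear0 addr0.
Qed.

Lemma theta_exact r w : theta_d r.+1 w = 0 -> exists v, theta_d r v = w.
Proof.
case: w => f y; rewrite theta_dE => -[fc] /eqP; rewrite subr_eq0 => /eqP fy.
have {}fc : dK r.+2 f = 0 := fc.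
have [_ h2 h3 _ _] := stS r.+1; have [_ _ _ h4 _] := stS r.
(* Otherwise a cocycle psi detects f. Up to a coboundary psi is q . alpha with q a relation among
   the rows, and this vanishes at f because alpha f is [colmul] of y. *)
have [f0 f0E] : exists g, dK r.+1 g = f.
  apply: contrapT => nb; have [psi psi0 psif] := koszul_detect fc nb; apply: psif.
  have [||q [chi [/esym q0 psiE]]] := h3 psi 0.
  - by have [[h _ _] _] := stI r.+1.
  - by move=> g; rewrite psi0 dot0l.
  by rewrite psiE fc linear0 addr0 fy dot_colmul q0 dot0l.
pose y1 := y - alpha (st r.+1) f0.
have y1c : colmul (@delta r.+1) y1 = 0 by rewrite linearB /= -fy -f0E h2 subrr.
have [g [z [zc zg]]] := cycles_fgen noethR x r.+1.
have [[syz0 syzD syzZ] syzB] := stI r.+1.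
pose ev q : {ffun 'I_g -> E} := [ffun j => dot q (alpha (st r.+1) (z j))].
have evP a q q' : ev (a *: q + q') = a *: ev q + ev q'.
  by apply/ffunP => j; rewrite !ffunE dotPl.
have ev0 : ev 0 = 0 by apply/ffunP => j; rewrite !ffunE dot0l.
have qlin q : linear (fun f' : K (deg r.+1) => dot q (alpha (st r.+1) f')).
  by move=> a u v; rewrite linearP dotPr.
(* On relations, q . y1 depends only on the values of q . alpha at the z_j: if these vanish, q .
   alpha is a coboundary, q is a combination of rows of the next matrix, and that matrix kills
   y1. *)
have [||e [q [sq [/esym hq ->]]]|h hE] := inj_ext Einj
    (G := fun v e => exists q, rels q /\ (v = ev q /\ e = dot q y1)).
- by exists 0; rewrite ev0 dot0l.
- move=> a _ _ _ _ [q [sq [-> ->]]] [q' [sq' [-> ->]]].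
  exists (a *: q + q'); rewrite evP dotPl; split=> //.
  by apply: syzD => //; exact: syzZ.
- have [|chi chiE] := vanish_factor Einj (x := x) (r := r.+1) (phi := mklin (qlin q)).
    move=> f' /zg[a ->]; rewrite linear_sum big1 // => j _; rewrite linearZ /=.
    have -> : dot q (alpha (st r.+1) (z j)) = 0.
      by have := congr1 (fun v : {ffun 'I_g -> E} => v j) hq; rewrite !ffunE.
    by rewrite scaler0.
  have [|q' [_ [-> _]]] := h3 chi q sq; first by move=> f'; rewrite -chiE.
  by rewrite -dot_colmul y1c dot0r.
(* The vectors [ev q] have entries in R e0, so only the action of h on socle vectors matters. Its
   coefficients b_j make h agree there with evaluation at the cycle f1. *)
have hsoc j : exists b, h (ff_inj j e0) = b *: e0.
  apply: socE => a /e0P ae0; rewrite -!linearZ -[RHS](linear0 h) /=.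
  by rewrite ae0 !linear0.
have [b bE] := choice hsoc.
pose f1 := \sum_j b j *: z j.
have f1c : dK r.+1 f1 = 0.
  rewrite linear_sum big1 // => j _; rewrite linearZ zc; exact: scaler0.
have f1E q : rels q -> dot q (y1 - alpha (st r.+1) f1) = 0.
  move=> sq.
  have -> : dot q (y1 - alpha (st r.+1) f1) = dot q y1 - dot q (alpha (st r.+1) f1).
    have := dotPr (-1) q (alpha (st r.+1) f1) y1.
    by rewrite !scaleN1r addrC => ->; rewrite addrC.
  apply/eqP; rewrite subr_eq0 -(hE (ev q) (dot q y1)); last by exists q.
  rewrite [ev q]ff_decomp linear_sum -[dot q _]/(mklin (qlin q) f1) linear_sum.
  apply/eqP/eq_bigr => j _; rewrite linearZ /= /ff_proj ffunE.
  have [|c cE] := cocycle_socle socE genx (phi := mklin (qlin q)) _ (zc j).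
    by move=> g'; exact: syzB.
  rewrite /= in cE; rewrite cE.
  have -> : ff_inj j (c *: e0) = c *: ff_inj j e0 :> {ffun 'I_g -> E} by rewrite linearZ.
  by rewrite linearZ /= bE !scalerA mulrC.
(* y1 - alpha f1 is orthogonal to the relations among the rows of [delta r], so pairing with it is
   defined on the row space; the coordinates of an extension form y0. *)
have [||e [q [/esym hq ->]]|h' h'E] := inj_ext Einj (G := fun v e => exists q,
    v = rowmul (@delta r) q /\ e = dot q (y1 - alpha (st r.+1) f1)).
- by exists 0; rewrite rowmul0 dot0l.
- move=> a _ _ _ _ [q [-> ->]] [q' [-> ->]]; exists (a *: q + q').
  by rewrite rowmulP dotPl.
- by apply: f1E; apply/h4.
pose y0 : {ffun 'I_(rk (st r)) -> E} := [ffun l => h' (ff_inj l (1 : R^o))].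
have h'y q : h' q = dot q y0.
  rewrite [q in LHS]ff_decomp linear_sum; apply: eq_bigr => l _.
  rewrite ffunE -linearZ; congr (h' _); apply/ffunP => l'; rewrite !ffunE.
  by case: eqP => _; rewrite ?scaler0 //; exact/esym/mulr1.
have y0E : colmul (@delta r) y0 = y1 - alpha (st r.+1) f1.
  apply/ffunP => j; rewrite -[LHS](dot_ff_inj j) -[RHS](dot_ff_inj j) dot_colmul -h'y.
  by apply: h'E; exists (ff_inj j (1 : R^o)).
exists (f0 + f1, - y0); rewrite theta_dE linearD f0E f1c addr0; congr (_, _).
by rewrite linearN /= opprK y0E linearD /= addrACA subrr addr0 addrC subrK.
Qed.

Lemma rk_vanish (s : int) : (forall i, s < i -> homology_trivial K i) ->
  forall r, s < deg r -> rk (st r) = 0%N.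
Proof.
move=> h; elim=> [//|r ih] sr; have [_ _ _ _ h5] := stS r.
apply: h5; last exact: h.
apply: ih; apply: lt_trans sr _; rewrite /deg; lia.
Qed.

End TestComplexOf.

(** * Koszul homology *)

Section LongExact.
Variables (R : comNzRingType) (X : complex R).
Hypothesis Xflat : forall i, flat (X i).
Variables (A B C : lmodType R) (i : {linear A -> B}) (p : {linear B -> C}).
Hypothesis hs : ses i p.

Let dX M j l : {linear cpx_tensor X M j -> cpx_tensor X M l} := cdiff (cpx_tensor X M) j l.
Let fX j (A B : lmodType R) (f : {linear A -> B}) : {linear cpx_tensor X A j -> cpx_tensor X B j} :=
  tens_map (@idfun (X j)) f.
Let dfX j l (A' B' : lmodType R) (f : {linear A' -> B'}) t : dX B' j l (fX j f t) = fX l f (dX A' j l t).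
Proof. by rewrite /= !(@tens_map_comp _ _ _ _ _ _ _ _ _ (cdiff X j l) _ _ f). Qed.
Let fi_inj j : injective (fX j i). Proof. by apply: Xflat; exact: hs.1. Qed.
Let fp_surj j t : exists s, fX j p s = t.
Proof. by have [h _] := tens_rexact (X j) hs.2; exact: h. Qed.
Let fker j t : fX j p t = 0 -> exists s, fX j i s = t.
Proof. by have [_ h] := tens_rexact (X j) hs.2; move/h. Qed.
Let fpi j t : fX j p (fX j i t) = 0.
Proof. by have [_ h] := tens_rexact (X j) hs.2; apply/h; exists t. Qed.

Lemma les_connect j l (a : cpx_tensor X A j) : l = j + 1 ->
  homology_trivial (cpx_tensor X C) l -> boundary (fX j i a) -> boundary a.
Proof.
move=> -> hC [t et]; have [|w we] := hC (fX (j + 1) p t).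
  by apply: (cycle_at (X := cpx_tensor X C) _ (erefl (j + 1))).2;
      rewrite [LHS]dfX [dX _ _ _ _]et fpi.
have [v vw] := fp_surj w.
have [b be] : exists b, fX (j + 1) i b = t - dX B (j + 1 + 1) (j + 1) v.
  by apply: fker; rewrite linearB -dfX vw [X in _ - X]we subrr.
exists b; apply: (fi_inj (j := j)); rewrite -[RHS]et -[LHS]dfX be linearB.
by rewrite [X in _ - X](@cdiff_comp R (cpx_tensor X B) _ _ _ _) subr0.
Qed.

Lemma les_left j l : l = j + 1 -> homology_trivial (cpx_tensor X B) j ->
  homology_trivial (cpx_tensor X C) l -> homology_trivial (cpx_tensor X A) j.
Proof.
move=> lj hB hC a ac; apply: les_connect lj hC _; apply: hB.
by rewrite /cycle [LHS]dfX [dX _ _ _ _]ac linear0.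
Qed.

Lemma les_right j l : l = j + 1 -> homology_trivial (cpx_tensor X A) j ->
  homology_trivial (cpx_tensor X B) l -> homology_trivial (cpx_tensor X C) l.
Proof.
move=> -> hA hB t tc; have [s es] := fp_surj t.
have {}tc : dX C (j + 1) j t = 0 := (cycle_at (X := cpx_tensor X C) t (erefl (j + 1))).1 tc.
have [a ea] : exists a, fX j i a = dX B (j + 1) j s by apply: fker; rewrite -dfX es tc.
have [|a' ea'] := hA a.
  apply: (fi_inj (j := j - 1)); rewrite -[LHS]dfX ea linear0.
  exact: (@cdiff_comp R (cpx_tensor X B) _ _ _ _).
have [|w we] := hB (s - fX (j + 1) i a').
  apply: (cycle_at (X := cpx_tensor X B) _ (erefl (j + 1))).2.
  by rewrite linearB [X in _ - X]dfX [dX _ _ _ a']ea' ea subrr.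
exists (fX (j + 1 + 1) p w); rewrite [LHS]dfX [dX _ _ _ _]we linearB es fpi.
exact: subr0.
Qed.

End LongExact.

(** * Koszul homology of good modules *)

Section KoszulVanishing.
Variables (R : comNzRingType) (m : set R) (E : lmodType R) (e0 : E).
Hypotheses (noethR : noetherian R) (maxm : maximal_ideal m) (Einj : injective_module E).
Hypothesis e0P : forall a, a *: e0 = 0 <-> m a.
Hypothesis socE : forall e : E, (forall a, m a -> a *: e = 0) -> exists b, e = b *: e0.
Variables (n : nat) (x : 'I_n -> R).
Hypothesis genx : generates x m.
Local Notation K := (koszul x).
Local Notation deg := (deg n).
Local Notation dK := (dK x).
Variables (st : nat -> stage E n)
  (delta : forall r, 'I_(rk (st r.+1)) -> {ffun 'I_(rk (st r)) -> R^o}).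
Hypothesis st0 : rk (st 0%N) = 0%N.
Hypothesis stS : forall r, stage_step x r (@delta r).
Hypothesis stI : forall r, stage_inv x r (st r).
Local Notation Th := (theta x st).
Local Notation d := (theta_d x delta).
Local Notation good := (good E d).
Local Notation D r := ({ffun 'I_(rk (st r)) -> E} : lmodType R).

Let T0 := theta0 (x := x) st0.
Let Tex := theta_exact noethR maxm Einj e0P socE genx stS stI.

Lemma koszul_flat i : flat (K i). Proof. exact: ffun_flat. Qed.

Definition inK r : {linear K (deg r.+1) -> Th r} :=
  pairl (@idfun (K (deg r.+1))) (\0 : {linear _ -> D r}).
Definition inD r : {linear D r -> Th r} :=
  pairl (\0 : {linear _ -> K (deg r.+1)}) (@idfun (D r)).
Definition prK r : {linear Th r -> K (deg r.+1)} := fst.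
Definition prD r : {linear Th r -> D r} := snd.
Definition al r : {linear K (deg r) -> D r} := @alpha R E n x (deg r) (st r).
Definition de r : {linear D r -> D r.+1} := colmul (@delta r).

Definition Kin N r : {linear tensor (K (deg r.+1)) N -> tensor (Th r) N} :=
  tens_map (inK r) (@idfun N).
Definition Din N r : {linear tensor (D r) N -> tensor (Th r) N} :=
  tens_map (inD r) (@idfun N).
Definition Kpr N r : {linear tensor (Th r) N -> tensor (K (deg r.+1)) N} :=
  tens_map (prK r) (@idfun N).
Definition Dpr N r : {linear tensor (Th r) N -> tensor (D r) N} :=
  tens_map (prD r) (@idfun N).
Definition dKN N r : {linear tensor (K (deg r)) N -> tensor (K (deg r.+1)) N} :=
  tens_map (dK r) (@idfun N).
Definition alN N r : {linear tensor (K (deg r)) N -> tensor (D r) N} :=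
  tens_map (al r) (@idfun N).
Definition deN N r : {linear tensor (D r) N -> tensor (D r.+1) N} :=
  tens_map (de r) (@idfun N).

Lemma KinK N r t : Kpr N r (Kin N r t) = t.
Proof.
transitivity (tens_map (@idfun (K (deg r.+1))) (@idfun N) t); last exact: tens_map_id.
exact: tens_map_comp.
Qed.

Lemma KprD N r t : Kpr N r (Din N r t) = 0.
Proof.
transitivity (tens_map (\0 : {linear D r -> K (deg r.+1)}) (@idfun N) t).
  exact: tens_map_comp.
exact: tens_map_eq0l.
Qed.

Lemma DinK N r t : Dpr N r (Din N r t) = t.
Proof.
transitivity (tens_map (@idfun (D r)) (@idfun N) t); last exact: tens_map_id.
exact: tens_map_comp.
Qed.

Lemma DprK N r t : Dpr N r (Kin N r t) = 0.
Proof.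
transitivity (tens_map (\0 : {linear K (deg r.+1) -> D r}) (@idfun N) t).
  exact: tens_map_comp.
exact: tens_map_eq0l.
Qed.

Lemma Kpr_d N r t : Kpr N r.+1 (test_d d N r t) = dKN N r.+1 (Kpr N r t).
Proof.
transitivity (tens_map (dK r.+1 \o prK r) (@idfun N) t); first exact: tens_map_comp.
by apply/esym; exact: tens_map_comp.
Qed.

Lemma split_theta N r (t : tensor (Th r) N) : t = Kin N r (Kpr N r t) + Din N r (Dpr N r t).
Proof.
have -> : Kin N r (Kpr N r t) = tens_map (inK r \o prK r) (@idfun N) t.
  exact: tens_map_comp.
have -> : Din N r (Dpr N r t) = tens_map (inD r \o prD r) (@idfun N) t.
  exact: tens_map_comp.
rewrite -(tens_mapDl (f := @idfun (Th r))); first by rewrite tens_map_id.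
exact: pair_decomp.
Qed.

Lemma d_Kin N r t : test_d d N r (Kin N r t) = Kin N r.+1 (dKN N r.+1 t) + Din N r.+1 (alN N r.+1 t).
Proof.
have -> : test_d d N r (Kin N r t) = tens_map (d r \o inK r) (@idfun N) t.
  exact: tens_map_comp.
have -> : Kin N r.+1 (dKN N r.+1 t) = tens_map (inK r.+1 \o dK r.+1) (@idfun N) t.
  exact: tens_map_comp.
have -> : Din N r.+1 (alN N r.+1 t) = tens_map (inD r.+1 \o al r.+1) (@idfun N) t.
  exact: tens_map_comp.
apply: tens_mapDl => f; rewrite [LHS]theta_dE; congr (_, _); first exact/esym/addr0.
by rewrite linear0 subr0 [RHS]add0r.
Qed.

Lemma d_Din N r t : test_d d N r (Din N r t) = - Din N r.+1 (deN N r t).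
Proof.
rewrite -scaleN1r.
have -> : test_d d N r (Din N r t) = tens_map (d r \o inD r) (@idfun N) t.
  exact: tens_map_comp.
have -> : Din N r.+1 (deN N r t) = tens_map (inD r.+1 \o de r) (@idfun N) t.
  exact: tens_map_comp.
apply: tens_mapZl => y; rewrite [LHS]theta_dE; congr (_, _).
  by rewrite linear0 [RHS]scaler0.
by rewrite linear0 add0r [RHS]scaleN1r.
Qed.

Lemma tensor_trivial (U N : lmodType R) : trivial_module U -> trivial_module (tensor U N).
Proof.
move=> U0; apply: tensor_elim => [//|u v|s t -> ->]; last by rewrite addr0.
by rewrite (U0 u) tens0l.
Qed.

Lemma D_trivial r : rk (st r) = 0%N -> trivial_module (D r).
Proof. by move=> h f; apply/ffunP => -[l hl]; exfalso; rewrite h in hl. Qed.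

Lemma cycle_KN N r (t : cpx_tensor K N (deg r)) : cycle t <-> dKN N r t = 0.
Proof. exact: (cycle_at (X := cpx_tensor K N) t (degS n r)). Qed.

Lemma boundary_KN N r (t : cpx_tensor K N (deg r.+1)) : boundary t <->
    exists s, dKN N r s = t.
Proof. exact: (boundary_at (X := cpx_tensor K N) t (degS n r)). Qed.

(** (t, 0) is a cycle of the cone tensored with N, hence a boundary; the K-component of a preimage
    bounds t. *)
Lemma good_cycle N r (t : tensor (K (deg r.+1)) N) : good N -> dKN N r.+1 t = 0 ->
  alN N r.+1 t = 0 -> exists s, dKN N r s = t.
Proof.
move=> [_ gN] t0 a0; have : test_boundary d (Kin N r t).
  by apply: gN; rewrite d_Kin t0 a0 !linear0 addr0.
case: r t t0 a0 => [|r] t t0 a0 /=.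
  by move=> h; exists 0; rewrite linear0 -[t]KinK /= h linear0.
move=> [w we]; exists (Kpr N r w); rewrite -Kpr_d [test_d _ _ _ _]we.
exact: KinK.
Qed.

Lemma deg_onto (i : int) : i <= n%:Z + 1 -> exists r, i = deg r.+1.
Proof.
move=> h; exists (absz (n%:Z + 1 - i)%R); rewrite /deg intS gez0_abs ?subr_ge0 //; ring.
Qed.

Lemma koszul_tensor_trivial N i : n%:Z < i -> trivial_module (tensor (K i) N).
Proof. by move=> h; apply: tensor_trivial => f; apply: koszul_empty; right. Qed.

Lemma good_homology N i : good N ->
  (forall r, i = deg r.+1 -> trivial_module (tensor (D r.+1) N)) ->
  homology_trivial (cpx_tensor K N) i.
Proof.
move=> gN hD; have [/deg_onto[r ir]|] := leP i (n%:Z + 1); last first.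
  move=> hi t _; exists 0; rewrite linear0; apply/esym/koszul_tensor_trivial.
  by apply: lt_trans hi; rewrite ltrDl.
move: ir (hD r ir) => -> {hD} D0 t /cycle_KN t0; apply/boundary_KN.
by apply: good_cycle gN t0 _; exact: D0.
Qed.

Lemma Dtensor_trivial N r : trivial_module (tensor E N) -> trivial_module (tensor (D r) N).
Proof.
move=> EN t; rewrite -[t](tens_map_id (f := @idfun _) (g := @idfun _)) //.
rewrite (@tens_map_suml _ _ _ _ _ _ (index_enum 'I_(rk (st r))) _
   (fun i => ff_inj i \o ff_proj i)).
  rewrite big1 // => i _.
  rewrite -(@tens_map_comp _ _ _ _ _ _ _ (ff_inj i) (ff_proj i) _ (@idfun N) (@idfun N)) //.
  by rewrite (EN (tens_map (ff_proj i) _ t)) linear0.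
by move=> u; rewrite -ff_decomp.
Qed.

(** * Classes in the top degree s *)

Section TopDegree.
Variables (s : int) (r : nat).
Hypotheses (sr : s = deg r.+1) (Kvan : forall i, s < i -> homology_trivial K i).
Hypothesis Knv : ~ homology_trivial K s.

Let rk0 : rk (st r) = 0%N.
Proof. by apply: (rk_vanish st0 stS Kvan); rewrite sr (degS n r) ltrDl. Qed.

Lemma good_vanish N i : good N -> s < i -> homology_trivial (cpx_tensor K N) i.
Proof.
move=> gN si; apply: good_homology => // r' ir'; apply/tensor_trivial/D_trivial.
have [_ _ _ _ h5] := stS r'; apply: h5; last by rewrite -ir'; exact: Kvan.
apply: (rk_vanish st0 stS Kvan); rewrite (degS n r') -ir'.
by apply: lt_trans si _; rewrite ltrDl.
Qed.

Lemma alK0 N (t : tensor (K (deg r)) N) : alN N r.+1 (dKN N r t) = 0.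
Proof.
have -> : alN N r.+1 (dKN N r t) = tens_map (al r.+1 \o dK r) (@idfun N) t.
  exact: tens_map_comp.
apply: tens_map_eq0l => f; have [_ h2 _ _ _] := stS r; rewrite [LHS]h2.
apply/ffunP => j; rewrite !ffunE /dot big1 // => -[l hl] _; exfalso.
by rewrite rk0 in hl.
Qed.

(** The scalars are the coordinates, in terms of e0, of the image in D of a nonbounding cycle f of
    degree s. If all were in m, then (f, 0) would be a cycle of the cone, and f a boundary. *)
Lemma socle_scalars : exists b : 'I_(rk (st r.+1)) -> R,
  (exists j, ~ m (b j)) /\ forall j, m (\sum_l @delta r.+1 j l * b l).
Proof.
have [f fc fb] : exists2 f : K (deg r.+1), dK r.+1 f = 0 & ~ exists g, dK r g = f.
  apply: contrapT => h; apply: Knv; rewrite sr => f /cycle_dK fc; apply/boundary_dK.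
  by apply: contrapT => fb; apply: h; exists f.
have yl l : exists b, al r.+1 f l = b *: e0.
  apply: socE => a ma.
  have [g gE] := koszul_kill_ideal genx ma (degS n r) ((cycle_dK f).2 fc).
  have <- : al r.+1 (a *: f) l = a *: al r.+1 f l by rewrite linearZ ffunE.
  rewrite -gE; have [_ h2 _ _ _] := stS r; rewrite -[cdiff _ _ _]/(dK r) [al _ _]h2.
  rewrite ffunE /dot big1 // => -[l' hl'] _; exfalso.
  by rewrite rk0 in hl'.
have [b bE] := choice yl; exists b; split.
  apply: contrapT => h; apply: fb.
  have y0 : al r.+1 f = 0.
    apply/ffunP => l; rewrite bE [RHS]ffunE; apply/e0P.
    by apply: contrapT => nb; apply: h; exists l.
  have w0 : d r (f, 0) = 0 by rewrite theta_dE fc [alpha _ _]y0 linear0 subr0.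
  (* Exactness is available from position 1 on; at r = 0 the whole term is trivial. *)
  clear -w0 T0 Tex; move: f w0; case: (r) => [|r'] f w0.
    by exists 0; rewrite linear0; have [] := T0 (f, 0).
  by have [[g y] []] := Tex w0; exists g.
move=> j; apply/e0P; have [_ h2 _ _ _] := stS r.+1.
have := congr1 (fun v : {ffun 'I_(rk (st r.+2)) -> E} => v j) (h2 f).
rewrite fc linear0 !ffunE /dot => h; rewrite [RHS]h scaler_suml; apply: eq_bigr => l _.
by rewrite -scalerA -bE.
Qed.

(* A socle element z of E (x) N gives a class in H_s(K (x) N): map it into the
   injective module in degree s of the test complex by scalars. *)
Lemma socle_class N (z : tensor E N) : good N -> z <> 0 -> (forall a, m a -> a *: z = 0) ->
  exists (eta : {linear E -> D r.+1}) (t : tensor (K (deg r.+1)) N),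
  [/\ dKN N r.+1 t = 0, alN N r.+1 t = tens_map eta (@idfun N) z
    & tens_map eta (@idfun N) z <> 0].
Proof.
move=> gN nz mz; have [b [[j0 bj0] bm]] := socle_scalars.
have etal : linear (fun e : E => [ffun j => b j *: e] : D r.+1).
  by move=> a e e'; apply/ffunP => j; rewrite !ffunE scalerDr !scalerA mulrC.
pose eta : {linear E -> D r.+1} := mklin etal; exists eta.
pose Y := tens_map eta (@idfun N) z.
have Ynz : Y <> 0.
  (* The coordinate j0 of Y is b_j0 z, and b_j0 is invertible modulo m, which kills z. *)
  move=> Y0; apply: nz.
  have bz : b j0 *: z = 0.
    rewrite -(@tens_map_idl _ _ _ (ff_proj j0 \o eta) (@idfun N)) //; last first.
      by move=> e; rewrite /= /ff_proj ffunE.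
    by rewrite -(@tens_map_comp _ _ _ _ _ _ _ (ff_proj j0) eta _ (@idfun N) (@idfun N)) // [tens_map eta _ z]Y0 linear0.
  have [c /mz] := max_unit maxm bj0.
  by rewrite scalerBl scale1r -scalerA bz scaler0 subr0.
(* After [eta], the differential acts on each coordinate by a scalar of m, which kills z. *)
have dY : deN N r.+1 Y = 0.
  have -> : deN N r.+1 Y = tens_map (de r.+1 \o eta) (@idfun N) z by exact: tens_map_comp.
  pose be j : R := \sum_l @delta r.+1 j l * b l.
  have bel j : linear (fun e : E => be j *: e) by move=> a e e';
      rewrite scalerDr !scalerA mulrC.
  pose bl j : {linear E -> E} := mklin (bel j).
  rewrite (@tens_map_suml _ _ _ _ _ _ (index_enum 'I_(rk (st r.+2))) _
    (fun j => ff_inj j \o bl j)); last first.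
    move=> e; rewrite [LHS]ff_decomp; apply: eq_bigr => j _; congr (ff_inj j _).
    rewrite /ff_proj [LHS]ffunE /dot /= scaler_suml; apply: eq_bigr => l _.
    by rewrite ffunE scalerA.
  rewrite big1 // => j _.
  rewrite -(@tens_map_comp _ _ _ _ _ _ _ (ff_inj j) (bl j) _ (@idfun N) (@idfun N)) //.
  have -> : tens_map (bl j) (@idfun N) z = be j *: z by exact: tens_map_idl.
  by rewrite mz ?linear0 //; exact: bm.
(* (0, Y) is a cycle of the cone tensored with N. D vanishes one position earlier, so a preimage
   lives in K (x) N alone and serves as t. *)
have [_ ex] := gN; have [|w we] := ex r.+1 (Din N r.+1 Y).
  by rewrite d_Din dY linear0 oppr0.
have Dw : Dpr N r w = 0 by apply: tensor_trivial; exact: D_trivial.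
move: we; rewrite [w]split_theta Dw linear0 addr0 [test_d _ _ _ _]d_Kin => we.
exists (Kpr N r w); split=> //.
  have := congr1 (Kpr N r.+1) we; rewrite linearD KinK.
  by rewrite !KprD addr0.
have := congr1 (Dpr N r.+1) we; rewrite linearD !DinK.
by rewrite DprK add0r.
Qed.

Lemma socle_class_nb N (z : tensor E N) (eta : {linear E -> D r.+1})
    (t : tensor (K (deg r.+1)) N) :
  alN N r.+1 t = tens_map eta (@idfun N) z -> tens_map eta (@idfun N) z <> 0 ->
  ~ boundary (t : cpx_tensor K N (deg r.+1)).
Proof. by move=> h nz /boundary_KN[g gt]; apply: nz; rewrite -h -gt alK0. Qed.

Lemma socle_nontrivial N (z : tensor E N) : good N -> z <> 0 ->
  (forall a, m a -> a *: z = 0) -> ~ homology_trivial (cpx_tensor K N) s.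
Proof.
move=> gN nz mz; have [eta [t [t0 ta tnz]]] := socle_class gN nz mz.
rewrite sr => h; apply: (socle_class_nb ta tnz); apply: h.
exact/cycle_KN.
Qed.

(** The class t built from z becomes a boundary over P, since its image in D (x) P comes from i z =
    0. So it lies in the image of the connecting map from H_(s+1)(K (x) C). *)
Lemma connecting_nontrivial (N P C : lmodType R) (i : {linear N -> P}) (p : {linear P -> C})
    (z : tensor E N) : ses i p -> good N -> good P -> z <> 0 ->
  (forall a, m a -> a *: z = 0) -> tens_map (@idfun E) i z = 0 ->
  ~ homology_trivial (cpx_tensor K C) (s + 1).
Proof.
move=> hs gN gP nz mz iz; have [eta [t [t0 ta tnz]]] := socle_class gN nz mz.
rewrite sr => h; apply: (socle_class_nb ta tnz).
apply: (les_connect koszul_flat hs erefl h); apply/boundary_KN.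
apply: good_cycle => //.
  have -> : dKN P r.+1 (tens_map (@idfun _) i t) = tens_map (@idfun _) i (dKN N r.+1 t).
    transitivity (tens_map (dK r.+1) i t); first exact: tens_map_comp.
    by apply/esym; exact: tens_map_comp.
  by rewrite t0 linear0.
have -> : alN P r.+1 (tens_map (@idfun _) i t) = tens_map (@idfun _) i (alN N r.+1 t).
  transitivity (tens_map (al r.+1) i t); first exact: tens_map_comp.
  by apply/esym; exact: tens_map_comp.
rewrite ta; have -> : tens_map (@idfun _) i (tens_map eta (@idfun N) z) =
    tens_map eta (@idfun P) (tens_map (@idfun E) i z).
  transitivity (tens_map eta i z); first exact: tens_map_comp.
  by apply/esym; exact: tens_map_comp.
by rewrite iz linear0.
Qed.

End TopDegree.
End KoszulVanishing.

(** * Resolutions of a module *)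

Section Zigzag.
Variables (R : comNzRingType) (M : lmodType R).
Implicit Types X Y A B : complex R.

(* The homology of X is M, concentrated in degree 0; the identification of
   H_0(X) with M is given by its graph on cycles. *)
Definition resolves X := (forall i, i <> 0 -> homology_trivial X i) /\
  exists G : X 0 -> M -> Prop, [/\
    forall a x u y v, G x u -> G y v -> G (a *: x + y) (a *: u + v),
    forall x u, G x u -> cycle x, forall x, cycle x -> exists u, G x u,
    forall u, exists x, G x u & forall x u, G x u -> u = 0 <-> boundary x].

Lemma boundaryP X i a (x y : X i) : boundary x -> boundary y -> boundary (a *: x + y).
Proof. by move=> [u <-] [v <-]; exists (a *: u + v); rewrite linearP. Qed.

Lemma boundaryB X i (x y : X i) : boundary x -> boundary y -> boundary (x - y).
Proof. by move=> hx hy; rewrite addrC -scaleN1r; exact: boundaryP. Qed.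

Lemma boundary0 X i : boundary (0 : X i).
Proof. by exists 0; rewrite linear0. Qed.

Lemma cycleP X i a (x y : X i) : cycle x -> cycle y -> cycle (a *: x + y).
Proof. by rewrite /cycle linearP => -> ->; rewrite scaler0 addr0. Qed.

Lemma cmap_cycle A B (f : chain_map A B) i (x : A i) : cycle x -> cycle (f i x).
Proof. by rewrite /cycle -cmap_comm => ->; rewrite linear0. Qed.

Lemma cmap_boundary A B (f : chain_map A B) i (x : A i) : boundary x -> boundary (f i x).
Proof. by move=> [y <-]; exists (f (i + 1) y); rewrite cmap_comm. Qed.

Lemma qiso_resolves A B (f : chain_map A B) : quasi_iso f -> resolves A <-> resolves B.
Proof.
move=> qf; split=> -[hX [G [Gl Gc Gt Gs G0]]]; split.
- move=> i /hX hA y yc; have [_ /(_ y yc)[x [xc xy]]] := qf i.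
  have -> : y = f i x - (f i x - y) by rewrite subKr.
  by apply: boundaryB => //; apply/cmap_boundary/hA.
- exists (fun y u => cycle y /\ exists2 x, G x u & boundary (f 0 x - y)); split.
  + move=> a x u y v [xc [x' x'u x'x]] [yc [y' y'v y'y]]; split; first exact: cycleP.
    exists (a *: x' + y'); first exact: Gl.
    have -> : f 0 (a *: x' + y') - (a *: x + y) = a *: (f 0 x' - x) + (f 0 y' - y).
      by rewrite linearP scalerBr opprD addrACA.
    exact: boundaryP.
  + by move=> x u [].
  + move=> y yc; have [_ /(_ y yc)[x [xc xy]]] := qf 0; have [u xu] := Gt x xc.
    by exists u; split=> //; exists x.
  + move=> u; have [x xu] := Gs u; exists (f 0 x); split.
      by apply: cmap_cycle; exact: Gc xu.
    by exists x => //; rewrite subrr; exact: boundary0.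
  + move=> y u [yc [x xu xy]]; rewrite (G0 _ _ xu); split=> h.
      have -> : y = f 0 x - (f 0 x - y) by rewrite subKr.
      by apply: boundaryB => //; exact: cmap_boundary.
    have [inj _] := qf 0; apply: inj; first exact: Gc xu.
    rewrite -(subrK y (f 0 x)) -[X in X + y]scale1r; exact: boundaryP.
- move=> i /hX hB x xc; have [inj _] := qf i; apply: inj => //.
  by apply: hB; exact: cmap_cycle.
- exists (fun x u => cycle x /\ G (f 0 x) u); split.
  + move=> a x u y v [xc xu] [yc yv]; split; first exact: cycleP.
    by rewrite linearP; exact: Gl.
  + by move=> x u [].
  + by move=> x xc; have [u xu] := Gt _ (cmap_cycle f xc); exists u.
  + move=> u; have [y yu] := Gs u; have [_ /(_ y (Gc _ _ yu))[x [xc xy]]] := qf 0.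
    exists x; split=> //; have [v xv] := Gt _ (cmap_cycle f xc).
    suff -> : u = v by [].
    apply/esym/eqP; rewrite -subr_eq0; apply/eqP.
    have h := Gl (-1) _ _ _ _ yu xv; rewrite !scaleN1r addrC [- u + v]addrC in h.
    exact/(G0 _ _ h).
  + move=> x u [xc xu]; rewrite (G0 _ _ xu); split=> [|]; last exact: cmap_boundary.
    by have [inj _] := qf 0; exact: inj.
Qed.

Lemma stalk_trivial i : i <> 0 -> trivial_module (stalk_obj M i).
Proof.
move=> /eqP/negbTE h; rewrite /stalk_obj h => v; apply/rowP => -[] //.
Qed.

Lemma stalk_resolves : resolves (stalk M).
Proof.
split=> [i /stalk_trivial h x _|]; first by rewrite (h x); exact: boundary0.
exists (fun x u => x = u); split=> //.
- by move=> a x u y v -> ->.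
- by move=> x _; exists x.
- by move=> u; exists u.
- by move=> x u ->; split=> [->|[y <-]] //; exact: boundary0.
Qed.

Lemma derived_resolves X : derived_iso X (stalk M) -> resolves X.
Proof.
move=> h; suff : resolves X <-> resolves (stalk M) by move=> ->; exact: stalk_resolves.
elim: h => {X} [A B [f qf]|A|A B _ ih|A B C _ ih1 _ ih2] //.
- exact: qiso_resolves qf.
- by rewrite ih.
- by rewrite ih1.
Qed.

End Zigzag.

(** * From a bounded good resolution to a finite one *)

Section BoundedResolution.
Variables (R : comNzRingType) (E : lmodType R).
Variables (T : nat -> lmodType R) (d : forall r, {linear T r -> T r.+1}).
Hypothesis dd : forall r x, d r.+1 (d r x) = 0.
Hypothesis T0 : trivial_module (T 0%N).
Hypothesis T_inj : forall r (A B C : lmodType R) (i : {linear A -> B}) (p : {linear B -> C}),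
  ses i p -> acyclic E C -> injective (tens_map (@idfun (T r)) i).
Hypothesis T_exact : forall r x, d r.+1 x = 0 -> exists y, d r y = x.
Local Notation good := (good E d).
Local Notation fin_good := (fin_good E d).

Lemma good_trivial Z : trivial_module Z -> good Z.
Proof.
move=> Z0; apply: flat_good => // U V f _ s t _.
have h : trivial_module (tensor Z U).
  by apply: tensor_elim => [//|z u|a b -> ->]; rewrite ?addr0 // (Z0 z) tens0l.
by rewrite (h s) (h t).
Qed.

Lemma cyc_trivial (X : complex R) i : trivial_module (X i) -> trivial_module (cyc X i).
Proof. by move=> h v; apply: submod_val_inj; rewrite (h (submod_val v)) linear0. Qed.

Variables (M : lmodType R) (X : complex R) (a b : int).
Hypotheses (resX : resolves M X) (Xgood : forall i, good (X i)).
Hypotheses (Xa : forall i, i < a -> trivial_module (X i)).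
Hypotheses (Xb : forall i, b < i -> trivial_module (X i)).

(** The resolution may have terms in negative degrees. Climbing from below a, each cycle module is
    the kernel of a surjection from a good term onto the preceding one. *)
Lemma cyc_good_le0 i : i <= 0 -> good (cyc X i).
Proof.
have [Xex _] := resX.
have key k : a - 1 + k%:Z <= 0 -> good (cyc X (a - 1 + k%:Z)).
  elim: k => [|k ih] hk.
    by apply/good_trivial/cyc_trivial/Xa; rewrite addr0 gtrBl.
  have e : a - 1 + k.+1%:Z = a - 1 + k%:Z + 1 by rewrite intS [1 + _]addrC addrA.
  rewrite e in hk *; have lk : a - 1 + k%:Z < 0.
    by apply: lt_le_trans hk; rewrite ltrDl.
  have [|p [hp _]] := @ses_cyc R X (a - 1 + k%:Z).
    by apply: Xex => h; rewrite h ltxx in lk.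
  by apply: (good_ker dd T0 T_inj hp) => //; apply: ih; exact: ltW.
move=> hi; have [ia|ai] := ltP i a; first exact/good_trivial/cyc_trivial/Xa.
have -> : i = a - 1 + (absz (i - a + 1)%R)%:Z by rewrite gez0_abs; lia.
apply: key; rewrite gez0_abs; lia.
Qed.

Lemma cyc_fin_ge1 : exists c, fin_good c (cyc X 1).
Proof.
have [Xex _] := resX.
have [b' bb'] : exists b' : nat, b <= b'%:Z by exists (absz b); lia.
have key k : (k <= b')%N -> fin_good k (cyc X (b'%:Z + 1 - k%:Z)).
  elim: k => [|k ih] hk.
    apply/FinGood0/good_trivial/cyc_trivial/Xb; lia.
  have [|p [hp _]] := @ses_cyc R X (b'%:Z + 1 - k.+1%:Z).
    by apply: Xex; lia.
  apply: (FinGoodS hp (Xgood _)).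
  have -> : b'%:Z + 1 - k.+1%:Z + 1 = b'%:Z + 1 - k%:Z by lia.
  apply: ih; lia.
exists b'; have := key b' (leqnn _).
by have -> : b'%:Z + 1 - b'%:Z = 1 by lia.
Qed.

(** M is Z_0 / B_0, where Z_0 is good by climbing from below and B_0 = X_1 / Z_1 has a finite
    resolution coming from above. *)
Lemma resolves_fin : exists c, fin_good c M.
Proof.
have [Xex [G [Gl Gc Gt Gs G0]]] := resX.
have [c fc] := cyc_fin_ge1; exists c.+2.
pose B := im (cdiff X 1 0).
have [g1 [g1E g1s]] := im_factor (cdiff X 1 0).
have h1 : ses (submod_val (hS := kernelP (cdiff X 1 (1 - 1)))) g1.
  split; first exact: submod_val_inj.
  split=> // v; split=> [gv|[u <-]].
    by apply: submod_lift; rewrite /kernel /= -[LHS]g1E gv linear0.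
  by apply: submod_val_inj; rewrite g1E linear0; exact: (submod_valP u).
have fB : fin_good c.+1 B := FinGoodS h1 (Xgood 1) fc.
have [|||q qE] := @graph_linear R (cyc X 0) M (fun x u => G (submod_val x) u).
- by move=> s x u y v xu yv; rewrite linearP; exact: Gl.
- by move=> x; apply: Gt; exact: (submod_valP x).
- by move=> u; rewrite linear0 => h; apply/(G0 _ _ h); exact: boundary0.
have hB (x : B) : kernel (cdiff X 0 (0 - 1)) (submod_val x).
  by have [y <-] := submod_valP x; exact: cdiff_comp.
pose j : {linear B -> cyc X 0} := corestr (kernelP (cdiff X 0 (0 - 1))) hB.
apply: (@FinGoodS _ _ _ _ c.+1 B (cyc X 0) M j q) => //; last exact: cyc_good_le0.
split=> [x y e|].
  by apply: submod_val_inj; have := congr1 (@submod_val _ _ _ _) e.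
split=> [u|v].
  have [x xu] := Gs u.
  have [x' x'x] : exists x' : cyc X 0, submod_val x' = x.
    by apply: submod_lift; exact: Gc xu.
  by exists x'; apply/qE; rewrite x'x.
have vq : G (submod_val v) (q v) by apply/qE.
rewrite (G0 _ _ vq); split=> [[y ye]|[y <-]].
  have [y' y'E] : exists y' : B, submod_val y' = submod_val v.
    by apply: submod_lift; exists y.
  by exists y'; apply: submod_val_inj.
by have [z ze] := submod_valP y; exists z.
Qed.

End BoundedResolution.

(** * The depth formula *)

Section ExtendedSups.
Implicit Types (A : set int) (R : comNzRingType).

Definition degrees A : set (\bar int) := [set i%:E | i in A].

Lemma supremum_max A (s : int) : A s -> (forall i, A i -> i <= s) ->
  supremum -oo%E (degrees A) = s%:E.
Proof.
move=> As mx; have As' : degrees A s%:E by exists s.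
rewrite /supremum ifF; last by apply/negP => /eqP h; rewrite h in As'.
apply: xget_subset1; last exact: is_subset1_supremums.
by split=> [_ [i Ai <-]|y]; [rewrite lee_fin mx | exact].
Qed.

Lemma supremum_bounded A : supremum -oo%E (degrees A) <> +oo%E ->
  exists b : int, forall i, A i -> i <= b.
Proof.
move=> h; apply: contrapT => nb.
have {}nb b : exists2 i, A i & b < i.
  apply: contrapT => hb; apply: nb; exists b => i Ai; rewrite leNgt; apply/negP => bi.
  by apply: hb; exists i.
(* A witness that the set is nonempty, so that the default -oo is not taken. *)
have [i0 Ai0 _] := nb 0; apply: h.
rewrite /supremum ifF; last first.
  apply/negP => /eqP h; have : degrees A i0%:E by exists i0.
  by rewrite h.
apply: xget_subset1; last exact: is_subset1_supremums.
split=> [_ [i Ai <-]|[r| |] //= ub]; first exact: leey.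
  by have [i Ai ri] := nb r; have := ub _ (ex_intro2 _ _ i Ai erefl);
      rewrite lee_fin leNgt ri.
by have := ub _ (ex_intro2 _ _ i0 Ai0 erefl).
Qed.

Lemma infimum_finite (S : set (\bar int)) (d : int) : infimum +oo%E S = d%:E ->
  exists2 s, S s & s <> +oo%E.
Proof.
move=> h; apply: contrapT => no.
have {}no s : S s -> s = +oo%E.
  by move=> Ss; apply: contrapT => ns; apply: no; exists s.
move: h; rewrite /infimum; case: ifPn => // /set0P[s Ss].
have ioo : infimums S +oo%E by split=> [t /no ->|t _] //; exact: leey.
by rewrite (xget_subset1 _ ioo (@is_subset1_infimums _ _ S)).
Qed.

Lemma hsup_max R (X : complex R) (s : int) : ~ homology_trivial X s ->
  (forall i, s < i -> homology_trivial X i) -> hsup X = s%:E.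
Proof.
move=> hs mx; apply: supremum_max => // i ni; rewrite leNgt; apply/negP => si.
exact/ni/mx.
Qed.

Lemma hsup_exact R (X : complex R) : exact X -> hsup X = -oo%E.
Proof.
move=> ex; rewrite -[LHS]/(supremum _ (degrees [set i : int | ~ homology_trivial X i])).
suff -> : degrees [set i : int | ~ homology_trivial X i] = set0 by rewrite supremum0.
by apply/seteqP; split=> // t [i /= ni]; case: ni; exact: ex.
Qed.

End ExtendedSups.

(** * Socle elements of E (x) N *)

Section SocleElements.
Variables (R : comNzRingType) (m : set R) (E N : lmodType R).
Hypothesis mtors : forall a (e : E), m a -> exists j, a ^+ j *: e = 0.

Lemma tensor_torsion a (t : tensor E N) : m a -> exists j, a ^+ j *: t = 0.
Proof.
move=> ma; move: t; apply: tensor_elim => [|e v|s t [j hj] [l hl]].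
- by exists 0%N; rewrite scaler0.
- by have [j hj] := mtors e ma; exists j; rewrite -tensZl hj tens0l.
- exists (j + l)%N; rewrite scalerDr {1}addnC !exprD -!scalerA hj hl.
  by rewrite !scaler0 addr0.
Qed.

(** The generators of m are treated one after another: z is multiplied by the last power of x_i that
    does not kill it, which preserves the earlier annihilations. *)
Lemma socle_exists n (x : 'I_n -> R) (z : tensor E N) : generates x m -> z <> 0 ->
  exists c, c *: z <> 0 /\ forall a, m a -> a *: (c *: z) = 0.
Proof.
move=> gx nz.
have mx i : m (x i).
  rewrite gx; exists (fun j => (j == i)%:R).
  rewrite (bigD1 i) //= eqxx mul1r big1 ?addr0 // => j /negbTE->.
  by rewrite mul0r.
have key (r : seq 'I_n) : exists c, c *: z <> 0 /\ forall i, i \in r -> x i *: (c *: z) = 0.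
  elim: r => [|i r [c [cz hc]]]; first by exists 1; rewrite scale1r.
  have ex : exists j, x i ^+ j *: (c *: z) == 0.
    by have [j hj] := tensor_torsion (c *: z) (mx i); exists j; apply/eqP.
  case: (ex_minnP ex) => -[|j] /eqP hj jmin; first by rewrite scale1r in hj.
  exists (x i ^+ j * c); have -> : (x i ^+ j * c) *: z = x i ^+ j *: (c *: z).
    by rewrite scalerA.
  split; first by move=> h; have := jmin j; rewrite h eqxx ltnn => /(_ isT).
  move=> l; rewrite inE => /orP[/eqP->|lr].
    by move: (c *: z) hj => y hj; rewrite scalerA -exprS.
  by move: (c *: z) (hc l lr) => y hy; rewrite scalerA mulrC -scalerA hy scaler0.
have [c [cz hc]] := key (enum 'I_n); exists c; split=> // a; rewrite gx => -[b ->].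
rewrite scaler_suml big1 // => i _; move: (c *: z) (hc i) => y hy.
by rewrite -scalerA hy ?mem_enum // scaler0.
Qed.

End SocleElements.

(** * Dimension shifting along a projective resolution *)

Section ResolutionShift.
Variables (R : comNzRingType) (m : set R) (E : lmodType R) (e0 : E).
Hypotheses (noethR : noetherian R) (maxm : maximal_ideal m) (Einj : injective_module E).
Hypothesis e0P : forall a, a *: e0 = 0 <-> m a.
Hypothesis socE : forall e : E, (forall a, m a -> a *: e = 0) -> exists b, e = b *: e0.
Hypothesis mtors : forall a (e : E), m a -> exists j, a ^+ j *: e = 0.
Variables (n : nat) (x : 'I_n -> R).
Hypothesis genx : generates x m.
Local Notation K := (koszul x).
Variables (st : nat -> stage E n)
  (delta : forall r, 'I_(rk (st r.+1)) -> {ffun 'I_(rk (st r)) -> R^o}).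
Hypothesis st0 : rk (st 0%N) = 0%N.
Hypothesis stS : forall r, stage_step x r (@delta r).
Hypothesis stI : forall r, stage_inv x r (st r).
Local Notation good := (good E (theta_d x delta)).
Local Notation fin_good := (fin_good E (theta_d x delta)).

Variables (N P : nat -> lmodType R) (i : forall j, {linear N j.+1 -> P j})
  (p : forall j, {linear P j -> N j}).
Hypotheses (hs : forall j, ses (i j) (p j)) (Pproj : forall j, projective (P j)).
Variable b : nat.
Hypothesis finN : fin_good b (N 0%N).
Variable s : int.
Hypotheses (Knv : ~ homology_trivial K s) (Kvan : forall l, s < l -> homology_trivial K l).

Let dd := theta_dd stS.
Let T0 := theta0 (x := x) st0.
Let Tin := @theta_inj _ E n x st.
Let Tex := theta_exact noethR maxm Einj e0P socE genx stS stI.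

(** The projectives are flat, so Tor_(u+1)(E, N_0) = Tor_1(E, N_u), the kernel of E (x) N_(u+1) -> E
    (x) P_u. *)
Definition tor_trivial j : Prop :=
  match j with
  | 0%N => trivial_module (tensor E (N 0%N))
  | u.+1 => injective (tens_map (@idfun E) (i u))
  end.

Let sdeg : exists r, s = deg n r.+1.
Proof.
apply: deg_onto; rewrite leNgt; apply/negP => hn; apply: Knv => f _; exists 0.
by rewrite linear0; apply: koszul_empty; right; apply: lt_trans hn; rewrite ltrDl.
Qed.

Let goodP j : good (P j).
Proof. exact: (flat_good E dd T0 Tex (proj_flat (@Pproj j))). Qed.

(** Each projective syzygy shortens the good resolution by one; from the b-th on, syzygies are
    good. *)
Let good_tail k : good (N (b + k)).
Proof.
elim: k => [|k ih]; last first.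
  by rewrite addnS; apply: (good_ker dd T0 Tin (hs (b + k)%N)).
have key j : (j <= b)%N -> fin_good (b - j) (N j).
  elim: j => [|j ih] jb; first by rewrite subn0.
  apply: (fin_good_syzygy dd T0 Tin Tex (hs j)) => //.
  by rewrite -subSn // subSS; apply: ih; exact: ltnW.
by have := key b (leqnn _); rewrite subnn addn0 => h; inversion h.
Qed.

Let tor_tail j : (b <= j)%N -> tor_trivial j.+1.
Proof.
move=> bj; have [aN _] := good_tail (j - b); rewrite subnKC // in aN.
exact: acyclic_injE (hs j) aN.
Qed.

(** The vanishing makes all N_j with j >= u acyclic; this is what [good_coker] needs to carry
    goodness back from N_(u+b) to N_u. *)
Let good_from u : (forall j, (u <= j)%N -> tor_trivial j.+1) -> good (N u).
Proof.
move=> hu.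
have ac j : (u <= j)%N -> acyclic E (N j).
  move=> uj; apply: (@acyclic_resolution _ E (fun M => exists2 j, (u <= j)%N & M = N j)).
    move=> _ [l ul ->]; exists (N l.+1), (P l), (i l), (p l); split=> //.
    - exact: proj_flat.
    - exact: hu.
    - by exists l.+1 => //; exact: leqW.
  by exists j.
have key k : good (N (u + k)) -> good (N u).
  elim: k => [|k ih]; first by rewrite addn0.
  rewrite addnS => h; apply: ih; apply: (good_coker dd Tin (hs (u + k)%N)) => //.
  by apply: ac; exact: leq_addr.
by apply: (key b); rewrite addnC; exact: good_tail.
Qed.

Let shift_van u l : (forall j, s + l%:Z < j -> homology_trivial (cpx_tensor K (N u)) j) ->
  forall j, s + (u + l)%N%:Z < j -> homology_trivial (cpx_tensor K (N 0%N)) j.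
Proof.
elim: u l => [|u ih] l h; first by rewrite add0n.
rewrite addSnnS; apply: ih => j sj.
have [r sr] := sdeg.
apply: (les_right (@koszul_flat _ _ x) (hs u) (j := j - 1)); first by rewrite subrK.
  by apply: h; move: sj; rewrite intS; lia.
by apply: (good_vanish st0 stS Kvan) => //; move: sj; rewrite intS; lia.
Qed.

(** The offset starts at l + 1 because H_j(K (x) P) is known to vanish only for j > s. *)
Let shift_nv u l : ~ homology_trivial (cpx_tensor K (N u)) (s + l.+1%:Z) ->
  ~ homology_trivial (cpx_tensor K (N 0%N)) (s + (u + l.+1)%N%:Z).
Proof.
elim: u l => [|u ih] l h; first by rewrite add0n.
rewrite addSnnS; apply: ih => h'; apply: h.
apply: (les_left (@koszul_flat _ _ x) (hs u) _ _ h'); first by rewrite (intS l.+1); ring.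
by apply: (good_vanish st0 stS Kvan) => //; rewrite ltrDl.
Qed.

Lemma resolution_sups :
  (forall j, tor_trivial j) /\ exact (cpx_tensor K (N 0%N)) \/
  exists u : nat, [/\ ~ tor_trivial u, forall j, (u < j)%N -> tor_trivial j,
    ~ homology_trivial (cpx_tensor K (N 0%N)) (s + u%:Z) &
    forall j, s + u%:Z < j -> homology_trivial (cpx_tensor K (N 0%N)) j].
Proof.
have [r sr] := sdeg.
have [all0|] := pselect (forall j, tor_trivial j).
  (* N_0 itself is good and E (x) N_0 = 0, so D (x) N_0 vanishes in every degree. *)
  left; split=> // l; have g0 : good (N 0%N) by apply: good_from => j _.
  apply: (good_homology g0) => r' _.
  by apply: Dtensor_trivial; exact: (all0 0%N).
move=> /existsNP[j0 nj0]; right.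
have ex : exists j, `[< ~ tor_trivial j >] by exists j0; apply/asboolP.
have bnd j : `[< ~ tor_trivial j >] -> (j <= b)%N.
  move/asboolP; case: j => // j nj; rewrite leqNgt; apply/negP => bj; apply: nj.
  exact: tor_tail.
case: (ex_maxnP ex bnd) => u /asboolP nu umax; exists u.
have van j : (u < j)%N -> tor_trivial j.
  move=> uj; apply: contrapT => nj; have := umax j; rewrite leqNgt uj.
  by move=> /(_ (asboolT nj)).
have gu : good (N u) by apply: good_from => j uj; exact: van.
have vK := shift_van (l := 0%N) (u := u); rewrite addn0 addr0 in vK.
have {}vK : forall j, s + u%:Z < j -> homology_trivial (cpx_tensor K (N 0%N)) j.
  by apply: vK => j sj; exact: (good_vanish st0 stS Kvan).
split=> //; case: u nu gu {umax van vK} => [|u] nu gu.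
  have [z nz] : exists z : tensor E (N 0%N), z <> 0.
    by apply: contrapT => h; apply: nu => z; apply: contrapT => nz; apply: h; exists z.
  have [c [cz mc]] := socle_exists mtors genx nz.
  by rewrite addr0; apply: (socle_nontrivial noethR maxm Einj e0P socE
      genx st0 stS stI sr Kvan Knv gu cz mc).
have [z [iz nz]] : exists z, tens_map (@idfun E) (i u) z = 0 /\ z <> 0.
  apply: contrapT => h; apply: nu; apply: linear_inj => z iz.
  by apply: contrapT => nz; apply: h; exists z.
have [c [cz mc]] := socle_exists mtors genx nz.
(* The connecting map produces a class in degree s + 1 over N_u; u further shifts reach degree s + u
   + 1 over N_0. *)
rewrite -addn1; apply: shift_nv.
apply: (connecting_nontrivial noethR maxm Einj e0P socE
    genx st0 stS stI sr Kvan Knv (hs u) gu _ cz mc) => //.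
by rewrite linearZ /= iz scaler0.
Qed.

End ResolutionShift.

(** * Syzygies of a projective resolution *)

Section ProjectiveSyzygies.
Variables (R : comNzRingType) (M : lmodType R) (P : complex R).
Hypothesis resP : projective_resolution M P.

Definition psyz (j : nat) : lmodType R :=
  if j is l.+1 then im (cdiff P l.+1%:Z l%:Z) else M.

Definition psyz_incl j : {linear psyz j.+1 -> P j%:Z} :=
  submod_val (hS := imageP (cdiff P j.+1%:Z j%:Z)).

(** This factorization of the differential is lost in the statement of exactness, yet it is what
    compares the kernels of [tor_trivial] with cycles of E (x) P. In degree 0 there is nothing to
    factor. *)
Definition psyz_factor (j : nat) : {linear P j%:Z -> psyz j} -> Prop :=
  match j with
  | 0%N => fun _ => True
  | l.+1 => fun p => forall y, psyz_incl l (p y) = cdiff P l.+1%:Z l%:Z y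
  end.

Lemma psyz_ses : exists p : forall j : nat, {linear P j%:Z -> psyz j},
  forall j, ses (psyz_incl j) (p j) /\ psyz_factor (p j).
Proof.
have [_ Pneg [f qf]] := resP.
suff h j : exists p : {linear P j%:Z -> psyz j}, ses (psyz_incl j) p /\ psyz_factor p.
  by exists (fun j => sval (cid (h j))) => j; case: cid.
case: j => [|j].
  exists (f 0); split=> //; split; first exact: submod_val_inj.
  split=> [v|y].
    have [_ h] := qf 0; have [|y [_ [z zE]]] := h v; first by [].
    by exists y; apply/eqP; rewrite -subr_eq0 -zE.
  split=> [fy|[u <-]].
    have [inj _] := qf 0; have [||z zy] := inj y.
    - exact: Pneg.
    - by rewrite fy; exact: boundary0.
    by apply: (@submod_lift R _ _ (imageP (cdiff P 1 0))); exists z.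
  have [z zu] := submod_valP u.
  by rewrite /psyz_incl /= -zu (@cmap_comm _ _ _ f 1 0 z).
have [g [gE gs]] := im_factor (cdiff P j.+1%:Z j%:Z); exists g.
split=> //; split; first exact: submod_val_inj.
split=> // y; split=> [gy|[u <-]].
  apply: (@submod_lift R _ _ (imageP (cdiff P j.+2%:Z j.+1%:Z))).
  have [inj _] := qf j.+1%:Z.
  have yc : cycle y by apply/(cycle_at y (j := j%:Z));
      rewrite -?gE ?gy ?linear0 // intS addrC.
  have [|z zy] := inj y yc; first by
      rewrite (stalk_trivial (_ : j.+1%:Z <> 0) (f _ y)) //; exact: boundary0.
  by apply/(boundary_at y (j := j.+2%:Z)); [rewrite intS addrC | exists z].
have [z zu] := submod_valP u; apply: submod_val_inj.
by rewrite gE linear0 /psyz_incl /= -zu cdiff_comp.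
Qed.

Variables (E : lmodType R) (p : forall j : nat, {linear P j%:Z -> psyz j}).
Hypothesis hs : forall j, ses (psyz_incl j) (p j).
Hypothesis pf : forall j, psyz_factor (p j).

Lemma tor_trivialE j : tor_trivial E psyz_incl j <-> homology_trivial (tensor_cpx E P) j%:Z.
Proof.
have fac l t : tens_map (@idfun E) (psyz_incl l) (tens_map (@idfun E) (p l.+1) t) =
    cdiff (tensor_cpx E P) l.+1%:Z l%:Z t.
  by apply: tens_map_comp => // y; exact: (pf l.+1 y).
have bd l t : tens_map (@idfun E) (p l) t = 0 <-> boundary (t : tensor_cpx E P l%:Z).
  have [_ /(_ t) ->] := tens_rexact E (hs l).2.
  rewrite (boundary_at (X := tensor_cpx E P) t (j := l.+1%:Z)); last by rewrite intS addrC.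
  split=> [[w <-]|[y <-]]; last by exists (tens_map (@idfun E) (p l.+1) y); exact: fac.
  have [h _] := tens_rexact E (hs l.+1).2; have [y <-] := h w; exists y; exact/esym/fac.
have [_ Pneg _] := resP.
case: j => [|j].
  have cyc0 (t : tensor_cpx E P 0) : cycle t.
    have h : trivial_module (tensor E (P (0 - 1))); last exact: h.
    apply: tensor_elim => [//|e v|a c -> ->]; last by rewrite addr0.
    by rewrite (Pneg _ _ v) ?tens0r.
  split=> [M0 t _|h t]; first by apply/(bd 0%N); exact: M0.
  have [hsurj _] := tens_rexact E (hs 0).2; have [y <-] := hsurj t.
  by apply/(bd 0%N); exact: h.
split=> [inj t tc|h].
  apply/bd; apply: (linear_inj0 inj); rewrite [LHS]fac.
  by apply/(cycle_at (X := tensor_cpx E P) t) => //; rewrite intS addrC.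
apply: linear_inj => w w0; have [hsurj _] := tens_rexact E (hs j.+1).2.
have [y yw] := hsurj w; rewrite -yw; apply/bd/h.
apply/(cycle_at (X := tensor_cpx E P) y (j := j%:Z)); first by rewrite intS addrC.
by rewrite -fac [tens_map _ (p j.+1) y]yw.
Qed.

End ProjectiveSyzygies.

Lemma koszul_sup (R : comNzRingType) (m : set R) n (x : 'I_n -> R) :
  generates x m -> ~ m 1 -> exists s : int, ~ homology_trivial (koszul x) s /\
  forall i, s < i -> homology_trivial (koszul x) i.
Proof.
move=> gx n1.
have big (i : int) : n%:Z < i -> homology_trivial (koszul x) i.
  by move=> ni f _; exists 0; rewrite linear0; apply: koszul_empty; right.
have ex : exists j : nat, `[< ~ homology_trivial (koszul x) j%:Z >].
  by exists 0%N; apply/asboolP; exact: koszul_H0 gx n1.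
have bnd (j : nat) : `[< ~ homology_trivial (koszul x) j%:Z >] -> (j <= n)%N.
  by move/asboolP => nj; rewrite leqNgt; apply/negP => nlj; apply/nj/big; rewrite ltz_nat.
case: (ex_maxnP ex bnd) => s /asboolP ns smax; exists s%:Z; split=> // -[i|i //].
rewrite ltz_nat => si; apply: contrapT => ni; have := smax i (asboolT ni).
by rewrite leqNgt si.
Qed.

Theorem theoremE (R : comNzRingType) (m : set R) (k E M : lmodType R)
    (noethR : noetherian R) (locR : local_ring m)
    (resk : residue_module m k) (hullE : injective_hull k E)
    (finM : exists d : int, Gfd (stalk M) = d%:E%E)
    (n : nat) (x : 'I_n -> R) (genx : generates x m)
    (P : complex R) (resP : projective_resolution M P) :
  depth x M = (depth x R^o%type - hsup (tensor_cpx E P))%E.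
Proof.
have [maxm _] := locR; have [Einj _] := hullE; have [_ n1 _] := maxm.
have [e0 [e0P socE mtors]] := hull_socle noethR maxm resk hullE.
have [st [delta [st0 stSI]]] := stages_exist noethR Einj socE genx.
have stS r : stage_step x r (delta r) by have [] := stSI r.
have stI r : stage_inv x r (st r) by have [] := stSI r.
pose dd := theta_dd stS; pose T0 := theta0 (x := x) st0.
pose Tin := @theta_inj _ E n x st.
pose Tex := theta_exact noethR maxm Einj e0P socE genx stS stI.
have [c fM] : exists c, fin_good E (theta_d x delta) c M.
  have [d /infimum_finite[_ [G [Gf [a Ga] GM] ->] /supremum_bounded[b Gb]]] := finM.
  apply: (resolves_fin dd T0 Tin Tex (derived_resolves GM) _ Ga (b := b)).
    by move=> i; exact: (Gflat_good dd T0 Tin Tex Einj).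
  by move=> i bi; apply: contrapT => /Gb; rewrite leNgt bi.
have [p hp] := psyz_ses resP.
have hs j : ses (psyz_incl M P j) (p j) by have [] := hp j.
have pf j : psyz_factor (p j) by have [] := hp j.
have [s [Knv Kvan]] := koszul_sup genx n1.
have Ps (j : nat) : projective (P j%:Z) by have [h _ _] := resP; exact: h.
have torE j := tor_trivialE resP E hs pf j.
have Pneg (i : int) : i < 0 -> homology_trivial (tensor_cpx E P) i.
  move=> i0 t _; exists 0; rewrite linear0; apply/esym.
  have [_ h _] := resP; move: t; apply: tensor_elim => [//|e v|a b -> ->].
    by rewrite (h _ i0 v) tens0r.
  by rewrite addr0.
rewrite /depth (@hsup_max _ (cpx_tensor (koszul x) R^o) s) ?homology_unit //; last first.
  by move=> i /Kvan; rewrite homology_unit.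
have [[all0 ex]|[u [nu van nK vK]]] := resolution_sups noethR maxm Einj e0P socE mtors
  genx st0 stS stI hs Ps fM Knv Kvan.
  (* Both suprema are -oo here, so both sides equal +oo. *)
  by rewrite !hsup_exact // => -[j|j]; [apply/torE; exact: all0 | exact: Pneg].
rewrite (hsup_max nK vK) (@hsup_max _ (tensor_cpx E P) u%:Z).
- by congr (_%:E); rewrite opprD addrA.
- by move/torE.
by move=> -[j|j] //; rewrite ltz_nat => uj; apply/torE; exact: van.
Qed.
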